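(* Let $X_0^{\star}(k,n,s)$ and $\Phi_0^{\star}(u,v,t)$ be as in the context. For complex variables $u,v,t$ let $a,b$ be defined by $a+b=-u+v$ and $ab=-uv-t^2$, i.e. $$a,b=\frac{-u+v\pm\sqrt{(u+v)^2+4t^2}}{2},$$ and put $$A(u,v,a,b)=\frac{1}{2\pi}\left\{\frac{\cos \pi u}{\sin \pi v}-\frac{\cos \pi v}{\sin \pi u}+\cos\pi(a-b)\,(\cot\pi u-\cot\pi v)\right\}.$$ Then, as an identity of functions of $(u,v,t)$ (complex, sufficiently close to the origin, wherever both sides are defined), $$u\Phi_0^{\star}(-u,v,t)-v\Phi_0^{\star}(-v,u,t)=\frac{u-v}{ab}+A(u,v,a,b)\,\frac{\Gamma(a)\Gamma(1-a)\Gamma(b)\Gamma(1-b)\Gamma(u+a)\Gamma(u+b)}{\Gamma(u)\Gamma(v)}.$$ (The right-hand side is symmetric in $a$ and $b$, so the choice of the labelling of the two roots is irrelevant.)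
   Context: For a sequence $\mathbf{k}=(k_1,\ldots,k_n)$ of positive integers with $k_1>1$, its weight is $k_1+\cdots+k_n$, its depth is $n$, and its height is $\#\{i\mid k_i\geqslant 2\}$. The multiple zeta-star value is $\zeta^{\star}(k_1,\ldots,k_n)=\sum_{m_1\geqslant\cdots\geqslant m_n\geqslant 1}m_1^{-k_1}\cdots m_n^{-k_n}$. For integers $k,n,s$ with $k\geqslant n+s$ and $n\geqslant s\geqslant 1$, $X_0^{\star}(k,n,s)$ denotes the sum of $\zeta^{\star}(\mathbf{k})$ over all such $\mathbf{k}$ of weight $k$, depth $n$ and height $s$. The generating function is $$\Phi_0^{\star}(u,v,t)=\sum_{k\geqslant n+s,\ n\geqslant s\geqslant 1}X_0^{\star}(k,n,s)\,u^{k-n-s}v^{n-s}t^{2s-2}.$$ $\Gamma$ is Euler's gamma function. *)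

(* Defs.v *)
From Stdlib Require Import Reals Lia Arith Bool.
From Coquelicot Require Import Coquelicot.
From Stdlib Require Import List FinFun.
Import ListNotations.

Open Scope C_scope.

Definition Cexp (z : C) : C :=
  ((exp (Re z) * cos (Im z))%R, (exp (Re z) * sin (Im z))%R).

Definition Csin (z : C) : C := (Cexp (Ci * z) - Cexp (- (Ci * z))) / (2 * Ci).
Definition Ccos (z : C) : C := (Cexp (Ci * z) + Cexp (- (Ci * z))) / 2.
Definition Ccot (z : C) : C := Ccos z / Csin z.

Definition CLim_seq (x : nat -> C) : C :=
  (real (Lim_seq (fun n => Re (x n))), real (Lim_seq (fun n => Im (x n)))).

Definition CSeries (x : nat -> C) : C :=
  (Series (fun n => Re (x n)), Series (fun n => Im (x n))).

(** Rising factorial z (z + 1) ... (z + n - 1). *)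
Fixpoint Crising (z : C) (n : nat) : C :=
  match n with
  | O => 1
  | S m => Crising z m * (z + INR m)
  end.

(** Euler's limit n! n^z / (z (z + 1) ... (z + n)), which converges to the
    gamma function at every z other than 0, -1, -2, ...; at these poles the
    value is irrelevant. *)
Definition Cgamma (z : C) : C :=
  CLim_seq (fun n => INR (fact n) * Cexp (z * ln (INR n)) / Crising z (S n)).

Definition gamma_defined (z : C) : Prop := forall n : nat, z <> - INR n.

(** The sum of m_1^{-k_1} ... m_n^{-k_n} over N >= m_1 >= ... >= m_n >= 1. *)
Fixpoint zeta_star_trunc (ks : list nat) (N : nat) : R :=
  match ks with
  | [] => 1%R
  | k :: ks' =>
      sum_n_m (fun m => (/ INR m ^ k * zeta_star_trunc ks' m)%R) 1 N
  end.

Definition zeta_star (ks : list nat) : R := real (Lim_seq (zeta_star_trunc ks)).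

Definition weight (ks : list nat) : nat := list_sum ks.
Definition depth (ks : list nat) : nat := length ks.
Definition height (ks : list nat) : nat := length (filter (Nat.leb 2) ks).

Definition admissible (ks : list nat) : Prop :=
  Forall (fun k => 1 <= k)%nat ks /\ (1 < hd 0 ks)%nat.

Fixpoint words (l : list nat) (n : nat) : list (list nat) :=
  match n with
  | O => [[]]
  | S n' => flat_map (fun k => map (cons k) (words l n')) l
  end.

(** Entries of a sequence of positive integers of weight k lie in [1, k];
    [In_indices] and [NoDup_indices] below show that this list enumerates
    the intended set exactly once. *)
Definition indices (k n s : nat) : list (list nat) :=
  filter (fun ks => (1 <? hd 0 ks) && (weight ks =? k) && (height ks =? s))%nat
    (words (seq 1 k) n).

Lemma In_words (l : list nat) (n : nat) (ks : list nat) :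
  In ks (words l n) <-> length ks = n /\ Forall (fun k => In k l) ks.
Proof.
  revert ks; induction n as [|n IH]; intros ks; simpl.
  - split.
    + intros [<- | []]; auto.
    + intros [H _]; left; destruct ks; [reflexivity | discriminate].
  - rewrite in_flat_map; split.
    + intros (k & Hk & H). apply in_map_iff in H as (w & <- & Hw).
      apply IH in Hw as [H1 H2]. simpl; auto.
    + intros [H1 H2]; destruct ks as [|k w]; [discriminate|].
      inversion H2; subst.
      exists k; split; [assumption|]. apply in_map, IH; auto.
Qed.

Lemma In_indices (k n s : nat) (ks : list nat) :
  In ks (indices k n s) <->
  admissible ks /\ weight ks = k /\ depth ks = n /\ height ks = s.
Proof.
  unfold indices, admissible, depth.
  rewrite filter_In, In_words, !andb_true_iff, Nat.ltb_lt, !Nat.eqb_eq.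
  split.
  - intros ((H1 & H2) & (H3 & H4) & H5). repeat split; auto.
    revert H2; apply Forall_impl; intros j Hj; apply in_seq in Hj; lia.
  - intros ((H1 & H2) & H3 & H4 & H5). repeat split; auto.
    subst k; clear - H1; unfold weight.
    assert (H : forall m, (list_sum ks <= m)%nat ->
                          Forall (fun j => In j (seq 1 m)) ks).
    { induction H1 as [|j l Hj Hl IH]; intros m Hm; constructor.
      - change (j + list_sum l <= m)%nat in Hm. apply in_seq; lia.
      - change (j + list_sum l <= m)%nat in Hm. apply IH; lia. }
    apply H; lia.
Qed.

Lemma NoDup_indices (k n s : nat) : NoDup (indices k n s).
Proof.
  apply NoDup_filter. generalize (seq_NoDup k 1); generalize (seq 1 k).
  intros l Hl; induction n as [|n IH]; simpl.
  - constructor; [intros []|constructor].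
  - generalize (words l n) IH; clear IH; intros W HW.
    induction Hl as [|j l Hj Hl IHl]; simpl; [constructor|].
    apply NoDup_app; auto.
    + apply Injective_map_NoDup; auto. intros x y E; congruence.
    + intros w H1 H2. apply in_map_iff in H1 as (x & <- & _).
      apply in_flat_map in H2 as (i & Hi & H2).
      apply in_map_iff in H2 as (y & E & _). congruence.
Qed.

Definition X0star (k n s : nat) : R :=
  fold_right Rplus 0%R (map zeta_star (indices k n s)).

Definition Phi0star_term (u v t : C) (k n s : nat) : C :=
  if ((n + s <=? k) && (s <=? n) && (1 <=? s))%nat
  then X0star k n s * u ^ (k - n - s) * v ^ (n - s) * t ^ (2 * s - 2)
  else 0.

(** The terms vanish unless n <= k and s <= k, so the triple series is
    summed by weight, with a finite sum over (n, s) for each k.  Under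
    [Phi0star_summable] the order of summation does not matter. *)
Definition Phi0star (u v t : C) : C :=
  CSeries (fun k => sum_n (fun n => sum_n (Phi0star_term u v t k n) k) k).

Definition Phi0star_summable (u v t : C) : Prop :=
  ex_series (fun k =>
    sum_n (fun n => sum_n (fun s => Cmod (Phi0star_term u v t k n s)) k) k).

Definition A_factor (u v a b : C) : C :=
  / (2 * PI) *
  (Ccos (PI * u) / Csin (PI * v) - Ccos (PI * v) / Csin (PI * u)
   + Ccos (PI * (a - b)) * (Ccot (PI * u) - Ccot (PI * v))).

(* Main.v *)
(** Grouping words by the runs of equal summation indices turns the generating function into
    the hypergeometric series
    [Phi0star u v t = sum_m 1 / (m (m - u)) prod_{j <= m} j (j - u) / ((j - al) (j - be))]
    with [al + be = u + v] and [al be = u v - t^2].  Put [s = v - u = a + b].  Then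
    [u Phi0star (- u) v t] is the sum over [m >= 1] of [(m-1)! (u)_m / ((1-a)_m (1-b)_m)], and
    decomposing each term into partial fractions in [a b], with poles where
    [(j - a) (j - b) = 0], and summing over [m] by Gauss's theorem gives
    [sum_{j >= 1} (-1)^(j-1) (2j - s) (u)_j / ((1-v)_j (j - a) (j - b))].
    The second series is obtained by the exchange [(u, v, a, b) -> (v, u, - a, - b)], so that
    the difference of the two, together with [s / (a b)], is a bilateral sum over all integers
    [j].  At every finite level [N] the corresponding sum over [|j| <= N] is exactly the
    partial fraction expansion of a product of linear factors, whose limit is expressed by
    sines and gamma functions by means of the product formula for the sine and Euler's limit.
    Tannery's theorem justifies all passages to the limit. *)
Require Import Defs.
From Stdlib Require Import Reals Lra Lia Psatz Arith Factorial Bool.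
From Coquelicot Require Import Coquelicot.
From Stdlib Require Import List.
Import ListNotations.

Open Scope C_scope.

Set Bullet Behavior "Strict Subproofs".

(** With a + b = s fixed, all products are rational in the single variable x = a b, since (j - a) (j
    - b) = x - (j s - j^2). Partial fractions can therefore be proved by induction on the number of
    factors, without any theorem on expansions of meromorphic functions. The coefficients of the
    truncated one-sided sums depend on the truncation N, so exchanging limit and sum needs a bound
    uniform in N. It comes from positivity: moduli are at most the values at the real point u = r0,
    s = 2 r0 (hence v = 3 r0), where the telescoping identity behind Gauss's theorem becomes an
    inequality once its boundary term is dropped. The series over words are majorized in the same
    way at u = v = t = r0, where al be = 0 and the product of the linear factors simplifies. The
    expansions divide by s and require u, v, s to be no integers. Near the origin this leaves the
    case u = v, which is settled separately because both sides of the identity then vanish. *)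

(** * Limits of complex sequences *)

Definition Clim (x : nat -> C) (l : C) : Prop :=
  is_lim_seq (fun n => Cmod (x n - l)) 0%R.

Lemma is_lim_seq_0_le (x y : nat -> R) :
  (exists N, forall n, (N <= n)%nat -> (0 <= x n <= y n)%R) ->
  is_lim_seq y 0%R -> is_lim_seq x 0%R.
Proof.
  intros [N H] Hy.
  apply is_lim_seq_le_le_loc with (fun _ => 0%R) y; auto.
  - exists N; auto.
  - apply is_lim_seq_const.
Qed.

Lemma Clim_le (x : nat -> C) (l : C) (y : nat -> R) :
  (exists N, forall n, (N <= n)%nat -> (Cmod (x n - l) <= y n)%R) ->
  is_lim_seq y 0%R -> Clim x l.
Proof.
  intros [N H] Hy. apply is_lim_seq_0_le with y; auto.
  exists N; intros n Hn; split; [apply Cmod_ge_0 | auto].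
Qed.

Lemma Clim_ext_loc (x y : nat -> C) (l : C) :
  (exists N, forall n, (N <= n)%nat -> x n = y n) -> Clim x l -> Clim y l.
Proof.
  intros [N H]. apply is_lim_seq_ext_loc. exists N; intros n Hn; now rewrite H.
Qed.

Lemma Clim_ext (x y : nat -> C) (l : C) :
  (forall n, x n = y n) -> Clim x l -> Clim y l.
Proof. intros H; apply Clim_ext_loc; exists 0%nat; auto. Qed.

Lemma Clim_const (c : C) : Clim (fun _ => c) c.
Proof.
  apply is_lim_seq_ext with (fun _ => 0%R); [|apply is_lim_seq_const].
  intros _; replace (c - c) with (RtoC 0) by ring; now rewrite Cmod_0.
Qed.

Lemma Clim_plus (x y : nat -> C) (l m : C) :
  Clim x l -> Clim y m -> Clim (fun n => x n + y n) (l + m).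
Proof.
  intros Hx Hy.
  apply Clim_le with (fun n => (Cmod (x n - l) + Cmod (y n - m))%R).
  - exists 0%nat; intros n _.
    replace (x n + y n - (l + m)) with ((x n - l) + (y n - m)) by ring.
    apply Cmod_triangle.
  - replace 0%R with (0 + 0)%R by ring. now apply is_lim_seq_plus'.
Qed.

Lemma Clim_bounded (x : nat -> C) (l : C) :
  Clim x l -> exists M, (0 < M)%R /\ forall n, (Cmod (x n) <= M)%R.
Proof.
  intros Hx.
  assert (Hx' : is_lim_seq (fun n => Cmod (x n - l)) (Finite 0)) by exact Hx.
  destruct (filterlim_bounded (K := R_AbsRing) (V := R_NormedModule)
             (fun n => Cmod (x n - l))) as [M HM].
  { exists 0%R; exact Hx'. }
  exists (Rmax M 0 + Cmod l + 1)%R.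
  pose proof (Rmax_l M 0); pose proof (Rmax_r M 0); pose proof (Cmod_ge_0 l).
  split; [lra|].
  intros n. specialize (HM n).
  change (Rabs (Cmod (x n - l)) <= M)%R in HM.
  rewrite Rabs_pos_eq in HM by apply Cmod_ge_0.
  replace (x n) with ((x n - l) + l) by ring.
  pose proof (Cmod_triangle (x n - l) l); lra.
Qed.

Lemma Clim_mult (x y : nat -> C) (l m : C) :
  Clim x l -> Clim y m -> Clim (fun n => x n * y n) (l * m).
Proof.
  intros Hx Hy.
  destruct (Clim_bounded _ _ Hx) as (M & HM0 & HM).
  apply Clim_le with (fun n => (Cmod m * Cmod (x n - l) + M * Cmod (y n - m))%R).
  - exists 0%nat; intros n _.
    replace (x n * y n - l * m) with (m * (x n - l) + x n * (y n - m)) by ring.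
    eapply Rle_trans; [apply Cmod_triangle|]. rewrite !Cmod_mult.
    apply Rplus_le_compat_l, Rmult_le_compat_r; [apply Cmod_ge_0 | auto].
  - replace 0%R with (Cmod m * 0 + M * 0)%R by ring.
    apply is_lim_seq_plus';
      [apply (is_lim_seq_scal_l _ (Cmod m) 0%R) | apply (is_lim_seq_scal_l _ M 0%R)];
      auto.
Qed.

Lemma Clim_scal (c : C) (x : nat -> C) (l : C) :
  Clim x l -> Clim (fun n => c * x n) (c * l).
Proof. intros; apply Clim_mult; auto using Clim_const. Qed.

Lemma Clim_opp (x : nat -> C) (l : C) : Clim x l -> Clim (fun n => - x n) (- l).
Proof.
  intros H; apply (Clim_ext (fun n => - (1) * x n)); [intros; ring|].
  replace (- l) with (- (1) * l) by ring. now apply Clim_scal.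
Qed.

Lemma Clim_minus (x y : nat -> C) (l m : C) :
  Clim x l -> Clim y m -> Clim (fun n => x n - y n) (l - m).
Proof. intros; apply Clim_plus; auto using Clim_opp. Qed.

Lemma Clim_spec (x : nat -> C) (l : C) :
  Clim x l <->
  forall eps : R, (0 < eps)%R ->
  exists N, forall n, (N <= n)%nat -> (Cmod (x n - l) < eps)%R.
Proof.
  unfold Clim. rewrite <- is_lim_seq_spec. split.
  - intros H eps He. destruct (H (mkposreal eps He)) as [N HN].
    exists N; intros n Hn. specialize (HN n Hn); simpl in HN.
    rewrite Rminus_0_r, Rabs_pos_eq in HN; auto using Cmod_ge_0.
  - intros H [eps He]. destruct (H eps He) as [N HN].
    exists N; intros n Hn; simpl.
    rewrite Rminus_0_r, Rabs_pos_eq; auto using Cmod_ge_0.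
Qed.

Lemma Clim_inv (x : nat -> C) (l : C) :
  l <> 0 -> Clim x l -> Clim (fun n => / x n) (/ l).
Proof.
  intros Hl Hx. pose proof (proj1 (Cmod_gt_0 l) Hl) as Hl0.
  destruct (proj1 (Clim_spec x l) Hx (Cmod l / 2)%R ltac:(lra)) as [N HN].
  apply Clim_le with (fun n => (2 / (Cmod l * Cmod l) * Cmod (x n - l))%R).
  - exists N; intros n Hn. specialize (HN n Hn).
    assert (H : (Cmod l / 2 <= Cmod (x n))%R).
    { pose proof (Cmod_triangle (x n) (- (x n - l))) as T.
      rewrite Cmod_opp in T. replace (x n + - (x n - l)) with l in T by ring. lra. }
    assert (Hxn : x n <> 0) by (apply Cmod_gt_0; lra).
    replace (/ x n - / l) with (- ((x n - l) / (x n * l))) by (field; auto).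
    rewrite Cmod_opp, Cmod_div by (now apply Cmult_neq_0). rewrite Cmod_mult.
    unfold Rdiv. rewrite Rmult_comm. apply Rmult_le_compat_r; [apply Cmod_ge_0|].
    replace (2 * / (Cmod l * Cmod l))%R with (/ ((Cmod l / 2) * Cmod l))%R
      by (field; lra).
    apply Rinv_le_contravar; [nra|]. apply Rmult_le_compat_r; lra.
  - replace 0%R with (2 / (Cmod l * Cmod l) * 0)%R by ring.
    now apply (is_lim_seq_scal_l _ _ 0%R).
Qed.

Lemma Clim_unique (x : nat -> C) (l m : C) : Clim x l -> Clim x m -> l = m.
Proof.
  intros H1 H2. apply Ceq_minus, Cmod_eq_0.
  pose proof (Clim_minus _ _ _ _ H2 H1) as H.
  assert (E : is_lim_seq (fun _ : nat => Cmod (l - m)) 0%R).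
  { apply is_lim_seq_ext with (2 := H). intros n.
    replace (x n - x n - (m - l)) with (l - m) by ring. reflexivity. }
  apply is_lim_seq_unique in E. rewrite Lim_seq_const in E. now injection E.
Qed.

Lemma Clim_incr_1 (x : nat -> C) (l : C) : Clim (fun n => x (S n)) l <-> Clim x l.
Proof. symmetry; apply (is_lim_seq_incr_1 (fun n => Cmod (x n - l)) 0%R). Qed.

Lemma Clim_Re (x : nat -> C) (l : C) : Clim x l -> is_lim_seq (fun n => Re (x n)) (Re l).
Proof.
  intros H. apply (is_lim_seq_ext (fun n => ((Re (x n) - Re l) + Re l)%R)).
  { intros; ring. }
  replace (Finite (Re l)) with (Finite (0 + Re l)) by (f_equal; ring).
  apply is_lim_seq_plus'; [|apply is_lim_seq_const].
  apply is_lim_seq_abs_0. apply is_lim_seq_0_le with (2 := H).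
  exists 0%nat; intros n _; split; [apply Rabs_pos|].
  change (Re (x n) - Re l)%R with (Re (x n - l)). apply re_le_Cmod.
Qed.

Lemma Clim_Im (x : nat -> C) (l : C) : Clim x l -> is_lim_seq (fun n => Im (x n)) (Im l).
Proof.
  intros H.
  apply (is_lim_seq_ext (fun n => Re (- Ci * x n))).
  { intros n; destruct (x n) as [a b]; simpl; ring. }
  replace (Im l) with (Re (- Ci * l)) by (destruct l; simpl; ring).
  apply Clim_Re, Clim_scal, H.
Qed.

Lemma Cmod_le_abs (z : C) : (Cmod z <= Rabs (Re z) + Rabs (Im z))%R.
Proof.
  replace z with (RtoC (Re z) + Ci * RtoC (Im z)).
  2:{ destruct z as [a b]. unfold RtoC, Ci, Cplus, Cmult; simpl. f_equal; ring. }
  eapply Rle_trans; [apply Cmod_triangle|].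
  rewrite Cmod_mult, Cmod_Ci, !Cmod_R, Rmult_1_l.
  destruct z as [a b]; simpl.
  replace (a + (0 * b - 1 * 0))%R with a by ring.
  replace (0 + (0 * 0 + 1 * b))%R with b by ring. lra.
Qed.

Lemma Clim_pair (x : nat -> C) (a b : R) :
  is_lim_seq (fun n => Re (x n)) a -> is_lim_seq (fun n => Im (x n)) b ->
  Clim x (a, b).
Proof.
  intros Ha Hb.
  apply Clim_le with (fun n => (Rabs (Re (x n) - a) + Rabs (Im (x n) - b))%R).
  - exists 0%nat; intros n _. eapply Rle_trans; [apply Cmod_le_abs|].
    destruct (x n); simpl; apply Rle_refl.
  - replace 0%R with (0 + 0)%R by ring.
    apply is_lim_seq_plus'; apply (proj1 (is_lim_seq_abs_0 _)).
    + replace 0%R with (a - a)%R by ring.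
      apply is_lim_seq_minus'; auto using is_lim_seq_const.
    + replace 0%R with (b - b)%R by ring.
      apply is_lim_seq_minus'; auto using is_lim_seq_const.
Qed.

Lemma CLim_seq_unique (x : nat -> C) (l : C) : Clim x l -> CLim_seq x = l.
Proof.
  intros H. unfold CLim_seq.
  rewrite (is_lim_seq_unique _ _ (Clim_Re _ _ H)), (is_lim_seq_unique _ _ (Clim_Im _ _ H)).
  now destruct l.
Qed.

Lemma Cauchy_lim (x : nat -> C) :
  (forall eps : R, (0 < eps)%R -> exists N, forall n m,
     (N <= n)%nat -> (N <= m)%nat -> (Cmod (x n - x m) < eps)%R) ->
  exists l, Clim x l.
Proof.
  intros H.
  assert (Hr : ex_finite_lim_seq (fun n => Re (x n))).
  { apply ex_lim_seq_cauchy_corr. intros [eps He].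
    destruct (H eps He) as [N HN]. exists N; intros n m Hn Hm; simpl.
    eapply Rle_lt_trans; [|apply (HN n m Hn Hm)].
    change (Re (x n) - Re (x m))%R with (Re (x n - x m)). apply re_le_Cmod. }
  assert (Hi : ex_finite_lim_seq (fun n => Im (x n))).
  { apply ex_lim_seq_cauchy_corr. intros [eps He].
    destruct (H eps He) as [N HN]. exists N; intros n m Hn Hm; simpl.
    eapply Rle_lt_trans; [|apply (HN n m Hn Hm)].
    eapply Rle_trans; [|apply Rmax_Cmod].
    eapply Rle_trans; [|apply Rmax_r]. apply Rle_refl. }
  destruct Hr as [a Ha], Hi as [b Hb]. exists (a, b); now apply Clim_pair.
Qed.

(** * Finite sums and dominated convergence *)

(** The summation runs over indices strictly below n, so that the empty sum exists; [sum_n] includes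
    its upper index, whence the shift in [Csum_sum_n]. *)
Fixpoint Csum (f : nat -> C) (n : nat) : C :=
  match n with O => 0 | S m => Csum f m + f m end.

Fixpoint Rsum (f : nat -> R) (n : nat) : R :=
  match n with O => 0%R | S m => (Rsum f m + f m)%R end.

Lemma Csum_ext (f g : nat -> C) (n : nat) :
  (forall i, (i < n)%nat -> f i = g i) -> Csum f n = Csum g n.
Proof.
  induction n as [|n IH]; simpl; intros H; [reflexivity|].
  rewrite IH by (intros; apply H; lia). rewrite H by lia. reflexivity.
Qed.

Lemma Csum_plus (f g : nat -> C) (n : nat) :
  Csum (fun i => f i + g i) n = Csum f n + Csum g n.
Proof. induction n as [|n IH]; simpl; [ring|]. rewrite IH; ring. Qed.

Lemma Csum_scal (c : C) (f : nat -> C) (n : nat) :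
  Csum (fun i => c * f i) n = c * Csum f n.
Proof. induction n as [|n IH]; simpl; [ring|]. rewrite IH; ring. Qed.

Lemma Csum_minus (f g : nat -> C) (n : nat) :
  Csum (fun i => f i - g i) n = Csum f n - Csum g n.
Proof. induction n as [|n IH]; simpl; [ring|]. rewrite IH; ring. Qed.

Lemma Csum_0 (f : nat -> C) (n : nat) :
  (forall i, (i < n)%nat -> f i = 0) -> Csum f n = 0.
Proof.
  induction n as [|n IH]; simpl; intros H; [reflexivity|].
  rewrite IH by (intros; apply H; lia). rewrite H by lia. ring.
Qed.

Lemma Csum_add (f : nat -> C) (n m : nat) :
  Csum f (n + m) = Csum f n + Csum (fun i => f (n + i)%nat) m.
Proof.
  induction m as [|m IH]; simpl.
  - rewrite Nat.add_0_r; ring.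
  - rewrite Nat.add_succ_r; simpl. rewrite IH; ring.
Qed.

Lemma Csum_S (f : nat -> C) (n : nat) :
  Csum f (S n) = f O + Csum (fun i => f (S i)) n.
Proof. change (S n) with (1 + n)%nat. rewrite Csum_add. simpl. ring. Qed.

Lemma Csum_swap (f : nat -> nat -> C) (n m : nat) :
  Csum (fun i => Csum (f i) m) n = Csum (fun j => Csum (fun i => f i j) n) m.
Proof.
  induction n as [|n IH]; simpl.
  - now rewrite Csum_0.
  - now rewrite IH, Csum_plus.
Qed.

Lemma Csum_telescope (f g : nat -> C) (n : nat) :
  (forall i, (i < n)%nat -> f i = g (S i) - g i) -> Csum f n = g n - g O.
Proof.
  induction n as [|n IH]; simpl; intros H; [ring|].
  rewrite IH by (intros; apply H; lia). rewrite H by lia. ring.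
Qed.

Lemma Csum_extend (f : nat -> C) (n m : nat) :
  (n <= m)%nat -> (forall i, (n <= i < m)%nat -> f i = 0) -> Csum f m = Csum f n.
Proof.
  intros Hnm H. replace m with (n + (m - n))%nat by lia.
  rewrite Csum_add, (Csum_0 (fun i => f (n + i)%nat)); [ring|].
  intros i Hi; apply H; lia.
Qed.

Lemma Cmod_Csum (f : nat -> C) (g : nat -> R) (n : nat) :
  (forall i, (i < n)%nat -> (Cmod (f i) <= g i)%R) ->
  (Cmod (Csum f n) <= Rsum g n)%R.
Proof.
  induction n as [|n IH]; simpl; intros H.
  - rewrite Cmod_0; lra.
  - eapply Rle_trans; [apply Cmod_triangle|].
    apply Rplus_le_compat; [apply IH; intros; apply H; lia | apply H; lia].
Qed.

Lemma Re_Csum (f : nat -> C) (n : nat) :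
  Re (Csum f n) = Rsum (fun i => Re (f i)) n.
Proof.
  induction n as [|n IH]; [reflexivity|].
  change (Re (Csum f n) + Re (f n) = Rsum (fun i => Re (f i)) (S n))%R.
  rewrite IH; reflexivity.
Qed.

Lemma Rsum_ext (f g : nat -> R) (n : nat) :
  (forall i, (i < n)%nat -> f i = g i) -> Rsum f n = Rsum g n.
Proof.
  induction n as [|n IH]; simpl; intros H; [reflexivity|].
  rewrite IH by (intros; apply H; lia). rewrite H by lia. reflexivity.
Qed.

Lemma Rsum_le (f g : nat -> R) (n : nat) :
  (forall i, (i < n)%nat -> (f i <= g i)%R) -> (Rsum f n <= Rsum g n)%R.
Proof.
  induction n as [|n IH]; simpl; intros H; [lra|].
  apply Rplus_le_compat; [apply IH; intros; apply H; lia | apply H; lia].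
Qed.

Lemma Rsum_ge_0 (f : nat -> R) (n : nat) :
  (forall i, (i < n)%nat -> (0 <= f i)%R) -> (0 <= Rsum f n)%R.
Proof.
  induction n as [|n IH]; simpl; intros H; [lra|].
  apply Rplus_le_le_0_compat; [apply IH; intros; apply H; lia | apply H; lia].
Qed.

Lemma Rsum_scal (c : R) (f : nat -> R) (n : nat) :
  Rsum (fun i => c * f i)%R n = (c * Rsum f n)%R.
Proof. induction n as [|n IH]; simpl; [ring|]. rewrite IH; ring. Qed.

Lemma Rsum_plus (f g : nat -> R) (n : nat) :
  Rsum (fun i => f i + g i)%R n = (Rsum f n + Rsum g n)%R.
Proof. induction n as [|n IH]; simpl; [ring|]. rewrite IH; ring. Qed.

Lemma Rsum_S (f : nat -> R) (n : nat) :
  Rsum f (S n) = (f O + Rsum (fun i => f (S i)) n)%R.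
Proof.
  induction n as [|n IH]; [simpl; ring|].
  change (Rsum f (S n) + f (S n) = f 0%nat + (Rsum (fun i => f (S i)) n + f (S n)))%R.
  rewrite IH; ring.
Qed.

Lemma Rsum_swap (f : nat -> nat -> R) (n m : nat) :
  Rsum (fun i => Rsum (f i) m) n = Rsum (fun j => Rsum (fun i => f i j) n) m.
Proof.
  induction n as [|n IH]; simpl.
  - induction m as [|m IHm]; simpl; [reflexivity|]. rewrite <- IHm; ring.
  - now rewrite IH, Rsum_plus.
Qed.

Lemma Rsum_sum_n (f : nat -> R) (n : nat) : Rsum f (S n) = sum_n f n.
Proof.
  induction n as [|n IH].
  - rewrite sum_O; simpl; ring.
  - rewrite sum_Sn, <- IH. reflexivity.
Qed.

Lemma Csum_sum_n (f : nat -> C) (n : nat) :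
  Csum f (S n) = sum_n (G := C_AbelianMonoid) f n.
Proof.
  induction n as [|n IH].
  - rewrite sum_O; simpl; ring.
  - rewrite sum_Sn, <- IH. reflexivity.
Qed.

Lemma Rsum_incr (f : nat -> R) (n m : nat) :
  (forall i, (0 <= f i)%R) -> (n <= m)%nat -> (Rsum f n <= Rsum f m)%R.
Proof.
  intros H; induction 1 as [|m _ IH]; simpl; [lra|]. pose proof (H m); lra.
Qed.

Lemma ex_series_Rsum_bound (f : nat -> R) (M : R) :
  (forall i, (0 <= f i)%R) -> (forall n, (Rsum f n <= M)%R) -> ex_series f.
Proof.
  intros H0 HM.
  destruct (ex_finite_lim_seq_incr (sum_n f) M) as [l Hl].
  - intros n; rewrite <- !Rsum_sum_n. apply Rsum_incr; auto.
  - intros n; rewrite <- Rsum_sum_n; auto.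
  - exists l; exact Hl.
Qed.

Lemma Rsum_is_lim (f : nat -> R) : ex_series f -> is_lim_seq (Rsum f) (Series f).
Proof.
  intros H; apply is_lim_seq_incr_1.
  apply is_lim_seq_ext with (sum_n f); [intros; now rewrite Rsum_sum_n|].
  apply Series_correct, H.
Qed.

Lemma Rsum_le_Series (f : nat -> R) (n : nat) :
  (forall i, (0 <= f i)%R) -> ex_series f -> (Rsum f n <= Series f)%R.
Proof.
  intros H0 H. apply is_lim_seq_incr_compare with (1 := Rsum_is_lim f H).
  intros m; simpl; pose proof (H0 m); lra.
Qed.

Lemma Csum_tail (f : nat -> C) (B : nat -> R) (n m : nat) :
  (forall i, (n <= i < m)%nat -> (Cmod (f i) <= B i)%R) -> (n <= m)%nat ->
  (Cmod (Csum f m - Csum f n) <= Rsum B m - Rsum B n)%R.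
Proof.
  intros H Hnm. revert H. induction Hnm as [|m Hnm IH]; intros H.
  - replace (Csum f n - Csum f n) with (RtoC 0) by ring. rewrite Cmod_0; lra.
  - simpl. replace (Csum f m + f m - Csum f n) with ((Csum f m - Csum f n) + f m) by ring.
    eapply Rle_trans; [apply Cmod_triangle|].
    assert (Cmod (Csum f m - Csum f n) <= Rsum B m - Rsum B n)%R
      by (apply IH; intros; apply H; lia).
    assert (Cmod (f m) <= B m)%R by (apply H; lia). lra.
Qed.

Lemma abs_conv (f : nat -> C) (B : nat -> R) :
  ex_series B -> (forall i, (Cmod (f i) <= B i)%R) ->
  exists L, Clim (Csum f) L.
Proof.
  intros HB H. apply Cauchy_lim. intros eps He.
  pose proof (Rsum_is_lim _ HB) as HL. apply is_lim_seq_spec in HL.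
  destruct (HL (mkposreal (eps / 2) ltac:(lra))) as [N HN]; simpl in HN.
  exists N.
  assert (K : forall n m, (N <= n)%nat -> (n <= m)%nat ->
                (Cmod (Csum f m - Csum f n) < eps)%R).
  { intros n m Hn Hm. eapply Rle_lt_trans; [apply (Csum_tail f B); auto|].
    pose proof (HN n Hn) as H1; pose proof (HN m ltac:(lia)) as H2.
    apply Rabs_def2 in H1; apply Rabs_def2 in H2. lra. }
  intros n m Hn Hm. destruct (Nat.le_ge_cases n m).
  - replace (Csum f n - Csum f m) with (- (Csum f m - Csum f n)) by ring.
    rewrite Cmod_opp; auto.
  - auto.
Qed.

Lemma Clim_Csum (x : nat -> nat -> C) (y : nat -> C) (n : nat) :
  (forall j, (j < n)%nat -> Clim (fun N => x N j) (y j)) ->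
  Clim (fun N => Csum (x N) n) (Csum y n).
Proof.
  induction n as [|n IH]; simpl; intros H.
  - apply Clim_const.
  - apply Clim_plus; [apply IH; intros; apply H; lia | apply H; lia].
Qed.

Lemma Clim_le_const (x : nat -> C) (l : C) (M : R) :
  (exists N, forall n, (N <= n)%nat -> (Cmod (x n) <= M)%R) -> Clim x l ->
  (Cmod l <= M)%R.
Proof.
  intros [N HN] H. apply Rnot_lt_le; intros Hlt.
  destruct (proj1 (Clim_spec _ _) H (Cmod l - M)%R ltac:(lra)) as [K HK].
  specialize (HK (N + K)%nat ltac:(lia)). specialize (HN (N + K)%nat ltac:(lia)).
  pose proof (Cmod_triangle (x (N + K)%nat) (- (x (N + K)%nat - l))) as T.
  rewrite Cmod_opp in T.
  replace (x (N + K)%nat + - (x (N + K)%nat - l)) with l in T by ring. lra.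
Qed.

(** Cut the series at an index J beyond which the sum of B is small: the heads converge as finite
    sums, and the tails of all rows and of the limit row are dominated. *)
Lemma tannery (x : nat -> nat -> C) (y : nat -> C) (B : nat -> R) (S : nat -> C) :
  ex_series B ->
  (forall N j, (Cmod (x N j) <= B j)%R) ->
  (forall j, Clim (fun N => x N j) (y j)) ->
  (forall N, Clim (Csum (x N)) (S N)) ->
  exists L, Clim (Csum y) L /\ Clim S L.
Proof.
  intros HB Hx Hy HS.
  assert (HyB : forall j, (Cmod (y j) <= B j)%R).
  { intros j. apply (Clim_le_const (fun N => x N j)); auto. exists O; auto. }
  destruct (abs_conv y B HB HyB) as [L HL].
  exists L; split; auto. apply Clim_spec. intros eps He.
  pose proof (Rsum_is_lim _ HB) as HT. apply is_lim_seq_spec in HT.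
  (* Partial sums of B within eps / 8 of the limit differ among themselves by at most eps / 4, which
     bounds each tail. *)
  destruct (HT (mkposreal (eps / 8) ltac:(lra))) as [J HJ]; simpl in HJ.
  assert (Htail : forall f l, (forall j, (Cmod (f j) <= B j)%R) -> Clim (Csum f) l ->
            (Cmod (l - Csum f J) <= eps / 4)%R).
  { intros f l Hf Hl.
    apply (Clim_le_const (fun n => Csum f n - Csum f J)).
    - exists J; intros n Hn. eapply Rle_trans; [apply (Csum_tail f B); auto|].
      pose proof (HJ n Hn) as H1; pose proof (HJ J ltac:(lia)) as H2.
      apply Rabs_def2 in H1; apply Rabs_def2 in H2. lra.
    - apply Clim_minus; auto using Clim_const. }
  destruct (proj1 (Clim_spec _ _) (Clim_Csum x y J (fun j _ => Hy j)) (eps / 4)%R ltac:(lra))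
    as [N HN].
  exists N; intros n Hn.
  pose proof (Htail _ _ (Hx n) (HS n)) as H1.
  pose proof (Htail _ _ HyB HL) as H2.
  specialize (HN n Hn).
  replace (S n - L) with
    ((S n - Csum (x n) J) + ((Csum (x n) J - Csum y J) + - (L - Csum y J))) by ring.
  eapply Rle_lt_trans; [apply Cmod_triangle|].
  pose proof (Cmod_triangle (Csum (x n) J - Csum y J) (- (L - Csum y J))) as H3.
  rewrite Cmod_opp in H3. lra.
Qed.

(** Rows of finite length N are extended by 0. The bound is asked for j < N only, so B has to be
    nonnegative to dominate the added zeros. *)
Lemma tannery_trunc (x : nat -> nat -> C) (y : nat -> C) (B : nat -> R) :
  ex_series B -> (forall j, (0 <= B j)%R) ->
  (forall N j, (j < N)%nat -> (Cmod (x N j) <= B j)%R) ->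
  (forall j, Clim (fun N => x N j) (y j)) ->
  exists L, Clim (Csum y) L /\ Clim (fun N => Csum (x N) N) L.
Proof.
  intros HB HB0 Hx Hy.
  apply (tannery (fun N j => if (j <? N)%nat then x N j else 0) y B); auto.
  - intros N j. destruct (Nat.ltb_spec j N); auto. rewrite Cmod_0; auto.
  - intros j. apply (Clim_ext_loc (fun N => x N j)); auto.
    exists (S j); intros n Hn. destruct (Nat.ltb_spec j n); [auto|lia].
  - intros N. apply (Clim_ext_loc (fun _ => Csum (x N) N)); [|apply Clim_const].
    exists N; intros n Hn. symmetry.
    rewrite (Csum_extend _ N n Hn).
    + apply Csum_ext; intros i Hi. destruct (Nat.ltb_spec i N); [auto|lia].
    + intros i Hi. destruct (Nat.ltb_spec i N); [lia|auto].
Qed.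

Definition conv (a b : nat -> C) (k : nat) : C := Csum (fun i => a i * b (k - i)%nat) (S k).

Lemma Csum_conv (a b : nat -> C) (n : nat) :
  Csum (conv a b) n = Csum (fun i => a i * Csum b (n - i)) n.
Proof.
  induction n as [|n IH]; [reflexivity|].
  cbn [Csum]. rewrite IH. unfold conv.
  replace (S n - n)%nat with 1%nat by lia. cbn [Csum].
  rewrite Nat.sub_diag.
  replace (Csum (fun i => a i * Csum b (S n - i)) n) with
    (Csum (fun i => a i * Csum b (n - i) + a i * b (n - i)%nat) n).
  - rewrite Csum_plus. ring.
  - apply Csum_ext; intros i Hi. rewrite Nat.sub_succ_l by lia. simpl. ring.
Qed.

(** Mertens' theorem: absolute convergence of one factor is enough, because the partial sums of the
    other are bounded and the sum of a_i B_(N-i) falls under dominated convergence. *)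
Lemma Clim_conv (a b : nat -> C) (Ba : nat -> R) (A B : C) :
  ex_series Ba -> (forall i, (Cmod (a i) <= Ba i)%R) ->
  Clim (Csum a) A -> Clim (Csum b) B -> Clim (Csum (conv a b)) (A * B).
Proof.
  intros HBa Ha HA HB.
  destruct (Clim_bounded _ _ HB) as (M & HM0 & HM).
  apply Clim_ext with (fun N => Csum (fun i => a i * Csum b (N - i)) N).
  { intros n; now rewrite Csum_conv. }
  destruct (tannery_trunc (fun N i => a i * Csum b (N - i)) (fun i => B * a i)
              (fun i => (M * Ba i)%R)) as (L & HL1 & HL2).
  - exact (ex_series_scal (V := R_NormedModule) M Ba HBa).
  - intros j. apply Rmult_le_pos; [lra|]. eapply Rle_trans; [apply Cmod_ge_0|apply Ha].
  - intros N j _. rewrite Cmod_mult, Rmult_comm.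
    apply Rmult_le_compat; auto using Cmod_ge_0.
  - intros j. rewrite Cmult_comm. apply Clim_scal.
    apply Clim_spec; intros eps He.
    destruct (proj1 (Clim_spec _ _) HB eps He) as [N HN].
    exists (N + j)%nat; intros n Hn; apply HN; lia.
  - replace (A * B) with L; [exact HL2|].
    apply (Clim_unique (Csum (fun i => B * a i))); auto.
    apply Clim_ext with (fun n => B * Csum a n); [intros; now rewrite Csum_scal|].
    rewrite (Cmult_comm A). now apply Clim_scal.
Qed.

(** * Factorial powers *)

(** Being off the integers is preserved by adding integers and by negation, so nonvanishing of the
    linear factors in u, v and s becomes a syntactic search, performed by [nz]. *)
Definition Cint (z : C) : Prop := exists k : Z, z = IZR k.
Definition noint (z : C) : Prop := forall k : Z, z <> IZR k.

Lemma Cint_IZR (k : Z) : Cint (IZR k).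
Proof. now exists k. Qed.
Lemma Cint_INR (n : nat) : Cint (INR n).
Proof. exists (Z.of_nat n); now rewrite <- INR_IZR_INZ. Qed.
Lemma Cint_plus (x y : C) : Cint x -> Cint y -> Cint (x + y).
Proof. intros [k ->] [l ->]; exists (k + l)%Z; now rewrite plus_IZR, RtoC_plus. Qed.
Lemma Cint_opp (x : C) : Cint x -> Cint (- x).
Proof. intros [k ->]; exists (- k)%Z; now rewrite opp_IZR, RtoC_opp. Qed.
Lemma Cint_minus (x y : C) : Cint x -> Cint y -> Cint (x - y).
Proof. intros; apply Cint_plus; auto using Cint_opp. Qed.
Lemma Cint_mult (x y : C) : Cint x -> Cint y -> Cint (x * y).
Proof. intros [k ->] [l ->]; exists (k * l)%Z; now rewrite mult_IZR, RtoC_mult. Qed.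

Lemma noint_opp (x : C) : noint x -> noint (- x).
Proof.
  intros H k E. apply (H (- k)%Z). rewrite opp_IZR, RtoC_opp, <- E. ring.
Qed.
Lemma noint_plus_l (x y : C) : noint x -> Cint y -> noint (x + y).
Proof.
  intros H [l ->] k E. apply (H (k - l)%Z).
  rewrite minus_IZR, RtoC_minus, <- E. ring.
Qed.
Lemma noint_plus_r (x y : C) : Cint x -> noint y -> noint (x + y).
Proof. intros; rewrite Cplus_comm; now apply noint_plus_l. Qed.
Lemma noint_minus_l (x y : C) : noint x -> Cint y -> noint (x - y).
Proof. intros; apply noint_plus_l; auto using Cint_opp. Qed.
Lemma noint_minus_r (x y : C) : Cint x -> noint y -> noint (x - y).
Proof. intros; apply noint_plus_r; auto using noint_opp. Qed.
Lemma noint_nz (x : C) : noint x -> x <> 0.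
Proof. intros H; exact (H 0%Z). Qed.

Lemma noint_small (z : C) : z <> 0 -> (Cmod z < 1)%R -> noint z.
Proof.
  intros H0 H1 k E. rewrite E, Cmod_R in H1. rewrite <- abs_IZR in H1.
  apply lt_IZR in H1. assert (k = 0%Z) as -> by lia. now apply H0.
Qed.

Create HintDb noint.
#[export] Hint Resolve Cint_IZR Cint_INR Cint_plus Cint_opp Cint_minus Cint_mult noint_opp
  noint_plus_l noint_plus_r noint_minus_l noint_minus_r : noint.
Ltac nz := apply noint_nz; auto 12 with noint.

Lemma INR_C_S (n : nat) : RtoC (INR (S n)) = INR n + 1.
Proof. rewrite S_INR, RtoC_plus. reflexivity. Qed.

Lemma INR_C_nz (n : nat) : RtoC (INR (S n)) <> 0.
Proof. intros E; apply RtoC_inj in E. revert E; apply not_0_INR; lia. Qed.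

Lemma INR_C_minus_nz (m n : nat) : (m < n)%nat -> RtoC (INR n) - INR m <> 0.
Proof.
  intros H E. rewrite <- RtoC_minus in E. apply RtoC_inj in E.
  apply lt_INR in H. lra.
Qed.

Lemma INR_C_plus_nz (m n : nat) : (0 < n)%nat -> RtoC (INR n) + INR m <> 0.
Proof.
  intros H E. rewrite <- RtoC_plus in E. apply RtoC_inj in E.
  apply lt_INR in H. pose proof (pos_INR m). simpl in H. lra.
Qed.

Definition Cfact (n : nat) : C := INR (fact n).

Lemma Cfact_S (n : nat) : Cfact (S n) = (INR n + 1) * Cfact n.
Proof. unfold Cfact. rewrite fact_simpl, mult_INR, RtoC_mult, INR_C_S. reflexivity. Qed.

Lemma Cfact_nz (n : nat) : Cfact n <> 0.
Proof. intros E. apply RtoC_inj in E. now apply INR_fact_neq_0 in E. Qed.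

Fixpoint Cfall (z : C) (n : nat) : C :=
  match n with O => 1 | S m => Cfall z m * (z - INR m) end.

Lemma Crising_S (z : C) (n : nat) : Crising z (S n) = Crising z n * (z + INR n).
Proof. reflexivity. Qed.

Lemma Cfall_S (z : C) (n : nat) : Cfall z (S n) = Cfall z n * (z - INR n).
Proof. reflexivity. Qed.

Lemma Crising_nz (z : C) (n : nat) :
  (forall i, (i < n)%nat -> z + INR i <> 0) -> Crising z n <> 0.
Proof.
  induction n as [|n IH]; simpl; intros H; [exact C1_nz|].
  apply Cmult_neq_0; [apply IH; intros; apply H; lia | apply H; lia].
Qed.

Lemma Cfall_nz (z : C) (n : nat) :
  (forall i, (i < n)%nat -> z - INR i <> 0) -> Cfall z n <> 0.
Proof.
  induction n as [|n IH]; simpl; intros H; [exact C1_nz|].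
  apply Cmult_neq_0; [apply IH; intros; apply H; lia | apply H; lia].
Qed.

Lemma Crising_noint (z : C) (n : nat) : noint z -> Crising z n <> 0.
Proof. intros H; apply Crising_nz; intros; nz. Qed.

Lemma Cfall_noint (z : C) (n : nat) : noint z -> Cfall z n <> 0.
Proof. intros H; apply Cfall_nz; intros; nz. Qed.

Lemma Crising_minus_nz (a : C) (n : nat) :
  (forall i, (i < n)%nat -> INR (S i) - a <> 0) -> Crising (1 - a) n <> 0.
Proof.
  intros H; apply Crising_nz; intros i Hi.
  replace (1 - a + INR i) with (INR (S i) - a) by (rewrite INR_C_S; ring). auto.
Qed.

Lemma Crising_plus_nz (a : C) (n : nat) :
  (forall i, (i < n)%nat -> INR (S i) + a <> 0) -> Crising (1 + a) n <> 0.
Proof.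
  intros H; apply Crising_nz; intros i Hi.
  replace (1 + a + INR i) with (INR (S i) + a) by (rewrite INR_C_S; ring). auto.
Qed.

Lemma Crising_head (z : C) (n : nat) : Crising z (S n) = z * Crising (z + 1) n.
Proof.
  induction n as [|n IH]; [simpl; ring|].
  rewrite Crising_S, IH, Crising_S, INR_C_S. ring.
Qed.

Lemma Crising_shift (z : C) (n : nat) :
  z <> 0 -> Crising (z + 1) n = Crising z n * (z + INR n) / z.
Proof. intros H. rewrite <- Crising_S, Crising_head. field; auto. Qed.

Lemma Cfall_head (z : C) (n : nat) : Cfall (z + 1) (S n) = (z + 1) * Cfall z n.
Proof.
  induction n as [|n IH]; [simpl; ring|].
  rewrite Cfall_S, IH, Cfall_S, INR_C_S. ring.
Qed.

Lemma Cfall_shift (z : C) (n : nat) :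
  z + 1 - INR n <> 0 -> Cfall (z + 1) n = (z + 1) * Cfall z n / (z + 1 - INR n).
Proof. intros H. rewrite <- Cfall_head, Cfall_S. field; auto. Qed.

Lemma Cfall_Crising (z : C) (n : nat) : Cfall (z + INR n) n = Crising (z + 1) n.
Proof.
  revert z; induction n as [|n IH]; intros z; [reflexivity|].
  rewrite INR_C_S. replace (z + (INR n + 1)) with ((z + 1) + INR n) by ring.
  rewrite Cfall_S, IH, Crising_head. ring.
Qed.

Lemma Crising_opp (z : C) (n : nat) : Crising (- z) n = (- (1)) ^ n * Cfall z n.
Proof.
  induction n as [|n IH]; [simpl; ring|]. rewrite Crising_S, IH, Cfall_S, Cpow_S. ring.
Qed.

Lemma Crising_fact (n : nat) : Crising 1 n = Cfact n.
Proof.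
  induction n as [|n IH]; [reflexivity|]. rewrite Crising_S, IH, Cfact_S. ring.
Qed.

Lemma Cfall_fact (n : nat) : Cfall (INR n) n = Cfact n.
Proof.
  rewrite <- (Cplus_0_l (INR n)), Cfall_Crising, Cplus_0_l. apply Crising_fact.
Qed.

Lemma Csign_cases (n : nat) : (- (1)) ^ n = 1 \/ (- (1)) ^ n = - (1).
Proof.
  induction n as [|n [IH | IH]]; [now left | right | left];
    rewrite Cpow_S, IH; ring.
Qed.

(** * Partial fractions of the bilateral product *)

(** [bcoef j] is the coefficient of [1 / ((j - a) (j - b))] in the bilateral sum, and
    [bcoef j * bdefect N j] the one in its finite version at level [N]. *)
Definition bcoef (u v s : C) (j : nat) : C :=
  (- (1)) ^ j * (s - 2 * INR j) * Crising u j / Crising (1 - v) j.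

Definition bdefect (u v s : C) (N j : nat) : C :=
  (Crising (INR N + 1 - v) j * Cfall (INR N) j * Cfall (INR N + s) j) /
  (Cfall (INR N - u) j * Crising (INR N + 1) j * Crising (INR N + 1 - s) j).

(** In x = a b the factor of index n is linear over quadratic, because (n - u - a) (n - u - b) = x +
    (n - u) (n - v) for a + b = s and v = u + s. The constants [bratio] make each factor equal to 1
    at x = 0, so the residue there stays s. *)
Definition bprod (u v s : C) (N : nat) (a b : C) : C :=
  s / (a * b) *
  (Crising (1 - s) N * Crising (1 + s) N * (Cfact N * Cfact N)
   * (Crising (1 - u - a) N * Crising (1 - u - b) N)) /
  (Crising (1 - a) N * Crising (1 + a) N * (Crising (1 - b) N * Crising (1 + b) N)
   * (Crising (1 - u) N * Crising (1 - v) N)).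

Definition bratio (u v s : C) (n : nat) : C :=
  INR n * INR n * (INR n - s) * (INR n + s) / ((INR n - u) * (INR n - v)).

(** The multiplier is the value of the new factor, of index n = N + 1, at the old pole x = j s -
    j^2; this is how the coefficient of an existing pole changes from level N to level N + 1. *)
Lemma bdefect_step (u v s : C) (N j : nat) :
  noint u -> noint v -> noint s -> (j <= N)%nat ->
  let n := RtoC (INR (S N)) in
  bdefect u v s (S N) j =
  bdefect u v s N j * bratio u v s (S N) *
  ((n - u - INR j) * (n - v + INR j)) /
  (((n - INR j) * (n + INR j - s)) * ((n + INR j) * (n - INR j + s))).
Proof.
  intros Hu Hv Hs Hj n. unfold bdefect, bratio. fold n.
  assert (En : n = INR N + 1) by apply INR_C_S.
  assert (N1 : INR N + 1 - INR j <> 0) by (rewrite <- En; apply INR_C_minus_nz; lia).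
  assert (N2 : INR N + 1 <> 0) by (rewrite <- En; apply INR_C_nz).
  assert (N3 : INR N + 1 + INR j <> 0) by (rewrite <- En; apply INR_C_plus_nz; lia).
  assert (D1 : Cfall (INR N - u) j <> 0) by (apply Cfall_noint; auto with noint).
  assert (D2 : Crising (INR N + 1 - s) j <> 0) by (apply Crising_noint; auto with noint).
  assert (D3 : Crising (INR N + 1) j <> 0).
  { apply Crising_nz; intros i _. rewrite <- En. apply INR_C_plus_nz; lia. }
  rewrite En.
  replace (INR N + 1 + 1 - v) with ((INR N + 1 - v) + 1) by ring.
  replace (INR N + 1 + 1 - s) with ((INR N + 1 - s) + 1) by ring.
  replace (INR N + 1 + s) with ((INR N + s) + 1) by ring.
  replace (INR N + 1 - u) with ((INR N - u) + 1) by ring.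
  rewrite (Crising_shift (INR N + 1 - v)), (Crising_shift (INR N + 1 - s)),
    (Crising_shift (INR N + 1)) by (auto; nz).
  rewrite (Cfall_shift (INR N)), (Cfall_shift (INR N - u)), (Cfall_shift (INR N + s))
    by (auto; nz).
  field; repeat split; auto; try nz.
Qed.

Lemma bprod_step (u v s : C) (N : nat) (a b : C) :
  noint u -> noint v ->
  a <> 0 -> b <> 0 ->
  (forall i, (i <= N)%nat -> INR (S i) - a <> 0 /\ INR (S i) - b <> 0 /\
                             INR (S i) + a <> 0 /\ INR (S i) + b <> 0) ->
  let n := RtoC (INR (S N)) in
  bprod u v s (S N) a b =
  bprod u v s N a b * bratio u v s (S N) * ((n - u - a) * (n - u - b)) /
  (((n - a) * (n - b)) * ((n + a) * (n + b))).
Proof.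
  intros Hu Hv Ha Hb H n. unfold bprod, bratio. fold n.
  assert (En : n = INR N + 1) by apply INR_C_S.
  destruct (H N ltac:(lia)) as (H1 & H2 & H3 & H4). rewrite INR_C_S in *.
  assert (D1 : Crising (1 - a) N <> 0) by (apply Crising_minus_nz; intros; apply H; lia).
  assert (D2 : Crising (1 - b) N <> 0) by (apply Crising_minus_nz; intros; apply H; lia).
  assert (D3 : Crising (1 + a) N <> 0) by (apply Crising_plus_nz; intros; apply H; lia).
  assert (D4 : Crising (1 + b) N <> 0) by (apply Crising_plus_nz; intros; apply H; lia).
  assert (D5 : Crising (1 - u) N <> 0) by (apply Crising_noint; auto with noint).
  assert (D6 : Crising (1 - v) N <> 0) by (apply Crising_noint; auto with noint).
  rewrite !Crising_S, Cfact_S, En.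
  field; repeat split; auto; try nz.
  all: match goal with
       | |- 1 + ?c + INR N <> 0 => replace (1 + c + INR N) with (INR N + 1 + c) by ring
       | |- 1 - ?c + INR N <> 0 => replace (1 - c + INR N) with (INR N + 1 - c) by ring
       end; auto.
Qed.

(** The residue at the new pole [n = N + 1]. *)
Lemma bcoef_new (u v s : C) (N : nat) :
  v = u + s -> noint u -> noint v -> noint s ->
  let n := RtoC (INR (S N)) in
  bcoef u v s (S N) * bdefect u v s (S N) (S N) =
  bratio u v s (S N) * (- u * (2 * n - v)) / (2 * n * s) * bprod u v s N n (s - n).
Proof.
  intros Ev Hu Hv Hs n. unfold bcoef, bdefect, bprod, bratio. fold n.
  assert (En : n = INR N + 1) by apply INR_C_S.
  assert (Nn : n <> 0) by apply INR_C_nz.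
  replace (Cfall n (S N)) with (Cfact (S N)) by (symmetry; apply Cfall_fact).
  replace (Cfall (n + s) (S N)) with (Crising (s + 1) (S N))
    by (rewrite <- Cfall_Crising; f_equal; unfold n; ring).
  replace (Cfall (n - u) (S N)) with (Crising (- u + 1) (S N))
    by (rewrite <- Cfall_Crising; f_equal; unfold n; ring).
  replace (1 - n) with (- INR N) by (rewrite En; ring).
  rewrite Crising_opp, Cfall_fact.
  replace (1 - u - n) with (- (u + INR N)) by (rewrite En; ring).
  rewrite Crising_opp, Cfall_Crising.
  replace (1 + (s - n)) with (- (- s + INR N)) by (rewrite En; ring).
  rewrite Crising_opp, Cfall_Crising.
  replace (1 - u - (s - n)) with (n + 1 - v) by (rewrite Ev; ring).
  replace (1 - (s - n)) with (n + 1 - s) by ring.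
  replace (1 + n) with (n + 1) by ring.
  rewrite (Crising_head u), (Crising_S (1 - v)), (Crising_S (n + 1 - v)), Cfact_S.
  rewrite (Crising_S (s + 1)), (Crising_S (- u + 1)), (Crising_S (n + 1)),
    (Crising_S (n + 1 - s)), Cpow_S, <- En.
  replace (1 + s) with (s + 1) by ring.
  replace (1 - u) with (- u + 1) by ring.
  replace (1 - s) with (- s + 1) by ring.
  assert (D1 : Crising (n + 1) N <> 0).
  { apply Crising_nz; intros i _. replace (n + 1 + INR i) with (n + INR (S i)) by (rewrite INR_C_S; ring).
    apply INR_C_plus_nz; lia. }
  assert (D2 : Crising (n + 1 - s) N <> 0) by (apply Crising_noint; unfold n; auto with noint).
  assert (D3 : Crising (- u + 1) N <> 0) by (apply Crising_noint; auto with noint).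
  assert (D4 : Crising (- s + 1) N <> 0) by (apply Crising_noint; auto with noint).
  assert (D5 : Crising (1 - v) N <> 0) by (apply Crising_noint; auto with noint).
  assert (F1 := Cfact_nz N).
  assert (N1 : n + 1 + INR N <> 0).
  { replace (n + 1 + INR N) with (n + INR (S N)) by (rewrite INR_C_S; ring).
    apply INR_C_plus_nz; lia. }
  assert (N2 : n + n <> 0) by (apply INR_C_plus_nz; lia).
  assert (I : Cint n) by apply Cint_INR. clearbody n.
  replace (RtoC (INR N)) with (n - 1) in * by (rewrite En; ring).
  (* The powers of the sign cancel only because its square is 1, hence the case distinction. *)
  destruct (Csign_cases N) as [-> | ->]; rewrite Ev.
  all: rewrite Ev in Hv, D5; field; repeat split; auto; try nz.
Qed.

Lemma Copp_involutive (z : C) : - - z = z.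
Proof. ring. Qed.

Lemma Copp_nz (z : C) : z <> 0 -> - z <> 0.
Proof. intros H E; apply H. rewrite <- (Copp_involutive z), E; ring. Qed.

(** The exchange permutes the linear factors, and only the leading s changes sign. It carries
    results at the poles (j - a) (j - b) = 0 over to the poles (j + a) (j + b) = 0. *)
Lemma bprod_swap (u v s : C) (N : nat) (a b : C) :
  v = u + s -> a + b = s -> bprod v u (- s) N (- a) (- b) = - bprod u v s N a b.
Proof.
  intros Ev Es. unfold bprod.
  replace (1 - - s) with (1 + s) by ring. replace (1 + - s) with (1 - s) by ring.
  replace (1 - - a) with (1 + a) by ring. replace (1 + - a) with (1 - a) by ring.
  replace (1 - - b) with (1 + b) by ring. replace (1 + - b) with (1 - b) by ring.
  replace (1 - v - - a) with (1 - u - b) by (rewrite Ev, <- Es; ring).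
  replace (1 - v - - b) with (1 - u - a) by (rewrite Ev, <- Es; ring).
  replace (- a * - b) with (a * b) by ring. unfold Cdiv.
  replace (Crising (1 + a) N * Crising (1 - a) N * (Crising (1 + b) N * Crising (1 - b) N)
           * (Crising (1 - v) N * Crising (1 - u) N)) with
    (Crising (1 - a) N * Crising (1 + a) N * (Crising (1 - b) N * Crising (1 + b) N)
     * (Crising (1 - u) N * Crising (1 - v) N)) by ring.
  ring.
Qed.

(** The two families of denominators are (j - a) (j - b) and (j + a) (j + b) written in x = a b; the
    second has the coefficients of the first after the exchange of parameters. Together they are the
    nonzero j of the bilateral sum. *)
Definition bsum (u v s : C) (N : nat) (x : C) : C :=
  s / x +
  Csum (fun i =>
    bcoef u v s (S i) * bdefect u v s N (S i)
      / (x - (INR (S i) * s - INR (S i) * INR (S i)))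
    - bcoef v u (- s) (S i) * bdefect v u (- s) N (S i)
      / (x - (- (INR (S i) * s) - INR (S i) * INR (S i)))) N.

(** Multiplying an expansion over simple poles by one factor with poles p and q multiplies each old
    coefficient by the value of the factor at its pole, and gives p and q coefficients containing
    the old expansion evaluated there. Everything is linear in the coefficients, so the case of a
    single pole w, proved as [K], is enough. *)
Lemma Csum_partial_fraction (x p q e k c0 : C) (y z al be : nat -> C) (N : nat) :
  p <> q -> x <> p -> x <> q -> x <> 0 -> p <> 0 -> q <> 0 ->
  (forall i, (i < N)%nat ->
     x <> y i /\ x <> z i /\ p <> y i /\ p <> z i /\ q <> y i /\ q <> z i) ->
  k * (x + e) / ((x - p) * (x - q)) *
    (c0 / x + Csum (fun i => al i / (x - y i) - be i / (x - z i)) N) =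
  k * e / (p * q) * (c0 / x) +
  Csum (fun i => k * (y i + e) / ((y i - p) * (y i - q)) * al i / (x - y i)
                 - k * (z i + e) / ((z i - p) * (z i - q)) * be i / (x - z i)) N +
  (k * (p + e) / (p - q) *
    (c0 / p + Csum (fun i => al i / (p - y i) - be i / (p - z i)) N) / (x - p) +
   k * (q + e) / (q - p) *
    (c0 / q + Csum (fun i => al i / (q - y i) - be i / (q - z i)) N) / (x - q)).
Proof.
  intros Hpq Hxp Hxq Hx Hp Hq.
  assert (A1 := Cminus_eq_contra _ _ Hpq). assert (A2 := Cminus_eq_contra _ _ Hxp).
  assert (A3 := Cminus_eq_contra _ _ Hxq).
  assert (A4 := Cminus_eq_contra _ _ (not_eq_sym Hpq)).
  induction N as [|N IH]; intros H.
  - simpl. field; repeat split; auto.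
  - cbn [Csum].
    destruct (H N ltac:(lia)) as (B1 & B2 & B3 & B4 & B5 & B6).
    assert (D1 := Cminus_eq_contra _ _ B1). assert (D2 := Cminus_eq_contra _ _ B2).
    assert (D3 := Cminus_eq_contra _ _ B3). assert (D4 := Cminus_eq_contra _ _ B4).
    assert (D5 := Cminus_eq_contra _ _ B5). assert (D6 := Cminus_eq_contra _ _ B6).
    assert (E3 := Cminus_eq_contra _ _ (not_eq_sym B3)).
    assert (E4 := Cminus_eq_contra _ _ (not_eq_sym B4)).
    assert (E5 := Cminus_eq_contra _ _ (not_eq_sym B5)).
    assert (E6 := Cminus_eq_contra _ _ (not_eq_sym B6)).
    rewrite Cplus_assoc, Cmult_plus_distr_l, IH by (intros; apply H; lia).
    assert (K : forall w c : C, x - w <> 0 -> p - w <> 0 -> q - w <> 0 ->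
              w - p <> 0 -> w - q <> 0 ->
      k * (x + e) / ((x - p) * (x - q)) * (c / (x - w)) =
      k * (w + e) / ((w - p) * (w - q)) * c / (x - w) +
      (k * (p + e) / (p - q) * (c / (p - w)) / (x - p) +
       k * (q + e) / (q - p) * (c / (q - w)) / (x - q))).
    { intros w c; intros. field; repeat split; auto. }
    replace (k * (x + e) / ((x - p) * (x - q)) * (al N / (x - y N) - be N / (x - z N)))
      with (k * (x + e) / ((x - p) * (x - q)) * (al N / (x - y N))
            - k * (x + e) / ((x - p) * (x - q)) * (be N / (x - z N))) by ring.
    rewrite !K by auto. unfold Cdiv. ring.
Qed.

(** The induction on N quantifies over all a, b with sum s, because the residues at the two new
    poles are values of the previous product at other points: a = n, b = s - n for p, and a = - n, b
    = s + n for q. *)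
Lemma bprod_eq_bsum (u v s : C) (N : nat) :
  v = u + s -> noint u -> noint v -> noint s ->
  forall a b, a + b = s -> a <> 0 -> b <> 0 ->
  (forall i, (i < N)%nat -> INR (S i) - a <> 0 /\ INR (S i) - b <> 0 /\
                            INR (S i) + a <> 0 /\ INR (S i) + b <> 0) ->
  bprod u v s N a b = bsum u v s N (a * b).
Proof.
  intros Ev Hu Hv Hs. induction N as [|N IH]; intros a b Es Ha Hb H.
  { unfold bprod, bsum, Cfact; simpl. field; auto. }
  rewrite bprod_step by (auto; intros; apply H; lia).
  rewrite IH by (auto; intros; apply H; lia).
  set (n := RtoC (INR (S N))). set (x := a * b).
  set (k := bratio u v s (S N)).
  set (p := n * s - n * n). set (q := - (n * s) - n * n).
  set (e := (n - u) * (n - v)).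
  destruct (H N ltac:(lia)) as (H1 & H2 & H3 & H4). fold n in H1, H2, H3, H4.
  assert (Nn : n <> 0) by apply INR_C_nz.
  assert (Xp : x - p = (n - a) * (n - b)) by (unfold x, p; rewrite <- Es; ring).
  assert (Xq : x - q = (n + a) * (n + b)) by (unfold x, q; rewrite <- Es; ring).
  assert (Xe : x + e = (n - u - a) * (n - u - b)).
  { unfold x, e; rewrite Ev, <- Es; ring. }
  assert (Hsn : n - s <> 0) by (unfold n; nz).
  assert (Hsn' : n + s <> 0) by (unfold n; nz).
  assert (Hs0 : s <> 0) by nz.
  rewrite <- Xp, <- Xq, <- Xe.
  assert (Hx0 : x <> 0) by (now apply Cmult_neq_0).
  assert (Hp0 : p <> 0).
  { replace p with (- (n * (n - s))) by (unfold p; ring).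
    now apply Copp_nz, Cmult_neq_0. }
  assert (Hq0 : q <> 0).
  { replace q with (- (n * (n + s))) by (unfold q; ring).
    now apply Copp_nz, Cmult_neq_0. }
  assert (Hxp : x <> p).
  { intros E. apply (Cmult_neq_0 _ _ H1 H2). rewrite <- Xp, E; ring. }
  assert (Hxq : x <> q).
  { intros E. apply (Cmult_neq_0 _ _ H3 H4). rewrite <- Xq, E; ring. }
  assert (Hpq' : p - q = 2 * n * s) by (unfold p, q; ring).
  assert (Hpq : p <> q).
  { intros E. apply (Cmult_neq_0 (2 * n) s); auto.
    - apply Cmult_neq_0; auto. intros E'; apply RtoC_inj in E'; lra.
    - rewrite <- Hpq', E; ring. }
  replace (bsum u v s N x * k * (x + e) / ((x - p) * (x - q))) with
    (k * (x + e) / ((x - p) * (x - q)) * bsum u v s N x) by (unfold Cdiv; ring).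
  unfold bsum at 1. rewrite Csum_partial_fraction; auto.
  2: { intros i Hi. destruct (H i ltac:(lia)) as (K1 & K2 & K3 & K4).
       set (j := RtoC (INR (S i))) in *.
       assert (J1 : n - j <> 0) by (apply INR_C_minus_nz; lia).
       assert (J2 : n + j <> 0) by (apply INR_C_plus_nz; lia).
       assert (J3 : n + j - s <> 0) by (unfold n, j; nz).
       assert (J4 : n + j + s <> 0) by (unfold n, j; nz).
       assert (J5 : n - j - s <> 0) by (unfold n, j; nz).
       assert (J6 : n - j + s <> 0) by (unfold n, j; nz).
       assert (Z : forall X Y A B : C, A <> 0 -> B <> 0 -> X - Y = A * B -> X <> Y).
       { intros X Y A B HA HB E E'. apply (Cmult_neq_0 _ _ HA HB). rewrite <- E, E'; ring. }
       unfold x, p, q; rewrite <- Es in *. repeat split.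
       - apply (Z _ _ _ _ K1 K2); ring.
       - apply (Z _ _ _ _ K3 K4); ring.
       - apply not_eq_sym, (Z _ _ _ _ J1 J3); ring.
       - apply not_eq_sym, (Z _ _ _ _ J2 J5); ring.
       - apply not_eq_sym, (Z _ _ _ _ J2 J6); ring.
       - apply not_eq_sym, (Z _ _ _ _ J1 J4); ring. }
  fold (bsum u v s N p). fold (bsum u v s N q).
  assert (Bp : bsum u v s N p = bprod u v s N n (s - n)).
  { rewrite IH; auto; [f_equal; unfold p; ring | ring | unfold n; nz | ].
    intros i Hi. repeat split.
    - intros E. apply (INR_C_minus_nz (S i) (S N)); [lia|]. fold n.
      replace (n - INR (S i)) with (- (INR (S i) - n)) by ring. rewrite E; ring.
    - unfold n; nz.
    - rewrite Cplus_comm. apply INR_C_plus_nz; lia.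
    - unfold n; nz. }
  (* The pole q is reached at (- n, s + n); the exchange turns this point into (n, - s - n), the
     form in which [bcoef_new] gives the residue. *)
  assert (Bq : bsum u v s N q = - bprod v u (- s) N n (- s - n)).
  { rewrite <- (Copp_involutive n) at 1.
    replace (- s - n) with (- (s + n)) by ring.
    rewrite bprod_swap, Copp_involutive by (auto; ring).
    rewrite IH; auto; [f_equal; unfold q; ring | ring | now apply Copp_nz | unfold n; nz | ].
    intros i Hi. repeat split.
    - replace (INR (S i) - - n) with (n + INR (S i)) by ring. apply INR_C_plus_nz; lia.
    - unfold n; nz.
    - intros E. apply (INR_C_minus_nz (S i) (S N)); [lia|]. fold n.
      replace (n - INR (S i)) with (- (INR (S i) + - n)) by ring. rewrite E; ring.
    - unfold n; nz. }
  assert (Bc := bcoef_new u v s N Ev Hu Hv Hs).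
  assert (Bd := bcoef_new v u (- s) N ltac:(rewrite Ev; ring) Hv Hu (noint_opp _ Hs)).
  cbv zeta in Bc, Bd. fold n in Bc, Bd. fold k in Bc.
  replace (bratio v u (- s) (S N)) with k in Bd.
  2: { unfold k, bratio. fold n. rewrite (Cmult_comm (n - u)). unfold Cdiv. ring. }
  rewrite Bp, Bq.
  unfold bsum. cbn [Csum]. fold n. rewrite Bc, Bd. fold p q.
  replace (p + e) with (- u * (2 * n - v)) by (unfold p, e; rewrite Ev; ring).
  replace (q + e) with (- v * (2 * n - u)) by (unfold q, e; rewrite Ev; ring).
  replace (q - p) with (2 * n * - s) by (unfold p, q; ring). rewrite Hpq'.
  (* The new factor is 1 at x = 0, so the term s / x is unchanged. *)
  replace (k * e / (p * q)) with (RtoC 1).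
  2: { unfold k, bratio, e, p, q. fold n. field. repeat split; auto; try (unfold n; nz).
       all: first [ replace (- (n * s) - n * n) with (- (n * (n + s))) by ring
                  | replace (n * s - n * n) with (- (n * (n - s))) by ring ];
         now apply Copp_nz, Cmult_neq_0. }
  rewrite Cmult_1_l, <- Cplus_assoc. f_equal. f_equal.
  - apply Csum_ext; intros i Hi. fold x. set (j := RtoC (INR (S i))).
    rewrite !bdefect_step by (auto with noint; lia). fold n j k.
    replace (bratio v u (- s) (S N)) with k.
    2: { unfold k, bratio. fold n. rewrite (Cmult_comm (n - u)). unfold Cdiv. ring. }
    replace (j * s - j * j + e) with ((n - u - j) * (n - v + j))
      by (unfold e; rewrite Ev; ring).
    replace (- (j * s) - j * j + e) with ((n - v - j) * (n - u + j))
      by (unfold e; rewrite Ev; ring).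
    replace (j * s - j * j - p) with ((n - j) * (n + j - s)) by (unfold p; ring).
    replace (j * s - j * j - q) with ((n + j) * (n - j + s)) by (unfold q; ring).
    replace (- (j * s) - j * j - p) with ((n + j) * (n - j - s)) by (unfold p; ring).
    replace (- (j * s) - j * j - q) with ((n - j) * (n + j + s)) by (unfold q; ring).
    replace (n + j - - s) with (n + j + s) by ring.
    replace (n - j + - s) with (n - j - s) by ring.
    rewrite (Cmult_comm ((n + j) * (n - j - s))).
    unfold Cdiv. ring.
  - fold x. unfold Cdiv. ring.
Qed.

(** * Partial fractions of the one-sided sums *)

Lemma Cfall_zero (k i : nat) : (k < i)%nat -> Cfall (INR k) i = 0.
Proof.
  induction 1 as [|i _ IH]; rewrite Cfall_S.
  - replace (INR k - INR k) with (RtoC 0) by ring. ring.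
  - rewrite IH; ring.
Qed.

(** Induction on k with a and b free: the coefficient of the new pole is the old expansion evaluated
    at a = n, b = s - n, and the induction hypothesis turns it back into a product. *)
Lemma inv_Crising_partial_fraction (s : C) (k : nat) : noint s ->
  forall a b, a + b = s ->
  (forall i, (i <= k)%nat -> INR (S i) - a <> 0 /\ INR (S i) - b <> 0) ->
  / (Crising (1 - a) (S k) * Crising (1 - b) (S k)) =
  Csum (fun i =>
    (- (1)) ^ i * (2 * INR (S i) - s) / (Cfact i * Cfact k) * Cfall (INR k) i
    / Crising (INR i + 2 - s) (S k) / ((INR (S i) - a) * (INR (S i) - b))) (S k).
Proof.
  intros Hs. induction k as [|k IH]; intros a b Es H.
  { destruct (H O ltac:(lia)) as [H1 H2]. simpl in *. unfold Cfact; simpl.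
    field. repeat split; auto; try nz. }
  rewrite (Crising_S (1 - a)), (Crising_S (1 - b)).
  set (n := RtoC (INR (S (S k)))).
  assert (En : n = INR k + 2) by (unfold n; rewrite !INR_C_S; ring).
  destruct (H (S k) ltac:(lia)) as [Hna Hnb]. fold n in Hna, Hnb.
  replace (1 - a + INR (S k)) with (n - a) by (rewrite En, INR_C_S; ring).
  replace (1 - b + INR (S k)) with (n - b) by (rewrite En, INR_C_S; ring).
  assert (Da : Crising (1 - a) (S k) <> 0) by (apply Crising_minus_nz; intros; apply H; lia).
  assert (Db : Crising (1 - b) (S k) <> 0) by (apply Crising_minus_nz; intros; apply H; lia).
  replace (/ (Crising (1 - a) (S k) * (n - a) * (Crising (1 - b) (S k) * (n - b)))) with
    (/ ((n - a) * (n - b)) * / (Crising (1 - a) (S k) * Crising (1 - b) (S k)))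
    by (field; auto).
  rewrite IH by (auto; intros; apply H; lia).
  (* This evaluates the coefficient of the new pole n = k + 2 in closed form. *)
  assert (IHn := IH n (s - n) ltac:(ring)).
  assert (Hn : forall i, (i <= k)%nat -> INR (S i) - n <> 0 /\ INR (S i) - (s - n) <> 0).
  { intros i Hi; split; [|unfold n; nz].
    replace (INR (S i) - n) with (- (n - INR (S i))) by ring.
    apply Copp_nz, INR_C_minus_nz; lia. }
  specialize (IHn Hn).
  set (d := fun i => (- (1)) ^ i * (2 * INR (S i) - s) / (Cfact i * Cfact k)
                     * Cfall (INR k) i / Crising (INR i + 2 - s) (S k)).
  change (/ (Crising (1 - n) (S k) * Crising (1 - (s - n)) (S k)) =
    Csum (fun i => d i / ((INR (S i) - n) * (INR (S i) - (s - n)))) (S k)) in IHn.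
  (* Each product of an old and the new denominator splits because (n - a) (n - b) - (j - a) (j - b)
     = (n - j) (n + j - s) does not involve a and b separately. *)
  transitivity (Csum (fun i => d i / ((n - INR (S i)) * (n + INR (S i) - s))
                         / ((INR (S i) - a) * (INR (S i) - b))) (S k)
    + / ((n - a) * (n - b)) *
      Csum (fun i => d i / ((INR (S i) - n) * (INR (S i) - (s - n)))) (S k)).
  - rewrite <- !Csum_scal, <- Csum_plus. apply Csum_ext; intros i Hi.
    destruct (H i ltac:(lia)) as [H1 H2]. destruct (Hn i ltac:(lia)) as [H3 H4].
    cbv beta. fold (d i). generalize (d i); intros c.
    set (j := RtoC (INR (S i))) in *.
    assert (H5 : n - j <> 0) by (apply INR_C_minus_nz; lia).
    assert (H6 : n + j - s <> 0) by (unfold n, j; nz).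
    rewrite <- Es in *.
    field. repeat split; auto.
  - rewrite <- IHn. cbn [Csum].
    assert (Step : forall i, (i <= k)%nat ->
      d i / ((n - INR (S i)) * (n + INR (S i) - s)) =
      (- (1)) ^ i * (2 * INR (S i) - s) / (Cfact i * Cfact (S k))
        * Cfall (INR (S k)) i / Crising (INR i + 2 - s) (S (S k))).
    { intros i Hi. unfold d. rewrite (Crising_S _ (S k)), Cfact_S.
      assert (F1 := Cfact_nz k). assert (F2 := Cfact_nz i).
      rewrite (INR_C_S k), Cfall_shift.
      2: { rewrite <- INR_C_S. apply INR_C_minus_nz; lia. }
      replace (INR i + 2 - s + (INR k + 1)) with (n + INR (S i) - s)
        by (rewrite En, (INR_C_S i); ring).
      replace (INR k + 1 - INR i) with (n - INR (S i)) by (rewrite En, (INR_C_S i); ring).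
      assert (N1 : n - INR (S i) <> 0) by (apply INR_C_minus_nz; lia).
      assert (N2 : n + INR (S i) - s <> 0) by (unfold n; nz).
      assert (N3 : INR k + 1 <> 0) by (rewrite <- INR_C_S; apply INR_C_nz).
      assert (N4 : Crising (INR i + 2 - s) (S k) <> 0) by (apply Crising_noint; auto with noint).
      field. repeat split; auto. }
    rewrite (Csum_ext _ (fun i =>
      (- (1)) ^ i * (2 * INR (S i) - s) / (Cfact i * Cfact (S k))
        * Cfall (INR (S k)) i / Crising (INR i + 2 - s) (S (S k))
        / ((INR (S i) - a) * (INR (S i) - b))) k)
      by (intros i Hi; rewrite Step by lia; reflexivity).
    rewrite Step by lia.
    f_equal.
    replace (1 - n) with (- INR (S k)) by (rewrite En, INR_C_S; ring).
    rewrite Crising_opp, !Cfall_fact. fold n.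
    replace (1 - (s - n)) with (INR (S k) + 2 - s) by (rewrite En, INR_C_S; ring).
    rewrite (Crising_S _ (S k)).
    replace (INR (S k) + 2 - s + INR (S k)) with (2 * n - s) by (rewrite En, INR_C_S; ring).
    assert (N4 : Crising (INR (S k) + 2 - s) (S k) <> 0) by (apply Crising_noint; auto with noint).
    assert (F1 := Cfact_nz (S k)).
    assert (N5 : 2 * n - s <> 0) by (unfold n; nz).
    destruct (Csign_cases (S k)) as [-> | ->]; field; repeat split; auto.
Qed.

Definition one_sided_term (u a b : C) (k : nat) : C :=
  Cfact k * Crising u (S k) / (Crising (1 - a) (S k) * Crising (1 - b) (S k)).

(** The terms vanish for k < i; from k = i on they form, up to a constant factor, the series 2F1(i +
    1, u + i + 1; 2 i + 3 - s; 1), whose excess of the lower over the upper parameters is 1 - v for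
    v = u + s. *)
Definition gauss_term (u s : C) (i k : nat) : C :=
  Cfall (INR k) i * Crising u (S k) / Crising (INR i + 2 - s) (S k).

Definition gauss_coef (u s : C) (N i : nat) : C :=
  (- (1)) ^ i * (2 * INR (S i) - s) / Cfact i * Csum (gauss_term u s i) N.

(** The inner sums over i <= k extend to i < N because the falling factorial vanishes for i > k; the
    finite double sum is then a rectangle and can be exchanged. *)
Lemma one_sided_partial_fraction (u s a b : C) (N : nat) :
  noint s -> a + b = s ->
  (forall i, (i < N)%nat -> INR (S i) - a <> 0 /\ INR (S i) - b <> 0) ->
  Csum (one_sided_term u a b) N =
  Csum (fun i => gauss_coef u s N i / ((INR (S i) - a) * (INR (S i) - b))) N.
Proof.
  intros Hs Es H.
  rewrite (Csum_ext _ (fun k => Csum (fun i =>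
     (- (1)) ^ i * (2 * INR (S i) - s) / Cfact i * gauss_term u s i k
     / ((INR (S i) - a) * (INR (S i) - b))) N)).
  - rewrite Csum_swap. apply Csum_ext; intros i Hi. unfold gauss_coef.
    rewrite (Csum_ext _ (fun k =>
       (- (1)) ^ i * (2 * INR (S i) - s) / Cfact i
       / ((INR (S i) - a) * (INR (S i) - b)) * gauss_term u s i k))
      by (intros; unfold Cdiv; ring).
    rewrite Csum_scal. unfold Cdiv; ring.
  - intros k Hk. unfold one_sided_term, Cdiv.
    rewrite (inv_Crising_partial_fraction s) by (auto; intros; apply H; lia).
    rewrite (Csum_extend _ (S k) N) by
      (try lia; intros i Hi; unfold gauss_term; rewrite Cfall_zero by lia; unfold Cdiv; ring).
    rewrite <- Csum_scal. apply Csum_ext; intros i Hi. unfold gauss_term.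
    assert (F := Cfact_nz k). assert (F2 := Cfact_nz i).
    assert (N1 : Crising (INR i + 2 - s) (S k) <> 0) by (apply Crising_noint; auto with noint).
    destruct (H i ltac:(lia)) as [H1 H2]. field. repeat split; auto.
Qed.

(** A telescoping certificate for Gauss's summation theorem. *)
Lemma gauss_term_S (u v s : C) (i k : nat) : v = u + s -> noint s ->
  (INR i + 2 - v) * gauss_term u s (S i) k =
  (INR i + 1) * (u + INR i + 1) * gauss_term u s i k
  + (- (2 * INR i + 3 - s) * ((INR (S k) - INR i) * gauss_term u s i (S k))
     - - (2 * INR i + 3 - s) * ((INR k - INR i) * gauss_term u s i k)).
Proof.
  intros -> Hs. unfold gauss_term.
  assert (E : (INR (S k) - INR i) * Cfall (INR (S k)) i = INR (S k) * Cfall (INR k) i).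
  { rewrite Cmult_comm, <- Cfall_S, INR_C_S. apply Cfall_head. }
  rewrite Cfall_S.
  rewrite (Crising_S u (S k)), (Crising_S (INR i + 2 - s) (S k)), (INR_C_S i).
  replace (INR i + 1 + 2 - s) with (INR i + 2 - s + 1) by ring.
  rewrite Crising_shift by nz.
  assert (N1 : Crising (INR i + 2 - s) (S k) <> 0) by (apply Crising_noint; auto with noint).
  replace ((INR (S k) - INR i) *
    (Cfall (INR (S k)) i * (Crising u (S k) * (u + INR (S k))) /
     (Crising (INR i + 2 - s) (S k) * (INR i + 2 - s + INR (S k)))))
  with ((INR (S k) * Cfall (INR k) i) * (Crising u (S k) * (u + INR (S k))) /
     (Crising (INR i + 2 - s) (S k) * (INR i + 2 - s + INR (S k))))
    by (rewrite <- E; unfold Cdiv; ring).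
  rewrite INR_C_S. field. repeat split; auto; try nz.
Qed.

(** For i = 0 the summand is itself a difference, which starts the recursion in i with a closed
    form. *)
Lemma gauss_term_0 (u v s : C) (k : nat) : v = u + s -> noint s ->
  (1 - v) * gauss_term u s 0 k =
  - (1 - s) * (Crising u (S (S k)) / Crising (1 - s) (S (S k)))
  - - (1 - s) * (Crising u (S k) / Crising (1 - s) (S k)).
Proof.
  intros -> Hs. unfold gauss_term. simpl (Cfall _ 0). simpl (INR 0).
  replace (0 + 2 - s) with (1 - s + 1) by ring.
  rewrite Crising_shift by nz.
  rewrite (Crising_S u (S k)), (Crising_S (1 - s) (S k)).
  assert (N1 : Crising (1 - s) (S k) <> 0) by (apply Crising_noint; auto with noint).
  rewrite INR_C_S. field. repeat split; auto; try nz.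
Qed.

Lemma Csum_gauss_term_S (u v s : C) (i N : nat) : v = u + s -> noint s ->
  (INR i + 2 - v) * Csum (gauss_term u s (S i)) N =
  (INR i + 1) * (u + INR i + 1) * Csum (gauss_term u s i) N
  - (2 * INR i + 3 - s) * ((INR N - INR i) * gauss_term u s i N).
Proof.
  intros Ev Hs. rewrite <- Csum_scal.
  rewrite (Csum_ext _ _ N (fun k _ => gauss_term_S u v s i k Ev Hs)), Csum_plus, Csum_scal.
  set (U := fun k => - (2 * INR i + 3 - s) * ((INR k - INR i) * gauss_term u s i k)).
  rewrite (Csum_telescope (fun k => _ - _) U) by (intros; reflexivity).
  unfold U.
  (* The lower boundary term vanishes: at k = 0 either k - i = 0 or the falling factorial is
     zero. *)
  replace ((INR 0 - INR i) * gauss_term u s i 0) with (RtoC 0).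
  2: { unfold gauss_term. destruct i as [|i].
       - simpl. unfold Cdiv. ring.
       - rewrite Cfall_zero by lia. unfold Cdiv; ring. }
  ring.
Qed.

Lemma Csum_gauss_term_0 (u v s : C) (N : nat) : v = u + s -> noint s ->
  (1 - v) * Csum (gauss_term u s 0) N =
  u - (1 - s) * (Crising u (S N) / Crising (1 - s) (S N)).
Proof.
  intros Ev Hs. rewrite <- Csum_scal.
  rewrite (Csum_ext _ _ N (fun k _ => gauss_term_0 u v s k Ev Hs)).
  set (U := fun k => - (1 - s) * (Crising u (S k) / Crising (1 - s) (S k))).
  rewrite (Csum_telescope _ U) by (intros; reflexivity).
  unfold U.
  replace (Crising u 1 / Crising (1 - s) 1) with (u / (1 - s)).
  2: { simpl. field. nz. }
  field. split; [apply Crising_noint; auto with noint | nz].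
Qed.

(** * Bounds *)

Fixpoint Rrising (x : R) (n : nat) : R :=
  match n with O => 1%R | S m => (Rrising x m * (x + INR m))%R end.

Lemma Rrising_pos (x : R) (n : nat) : (0 < x)%R -> (0 < Rrising x n)%R.
Proof.
  intros H; induction n as [|n IH]; simpl; [lra|].
  pose proof (pos_INR n). apply Rmult_lt_0_compat; lra.
Qed.

Lemma Rrising_head (x : R) (n : nat) : Rrising x (S n) = (x * Rrising (x + 1) n)%R.
Proof.
  induction n as [|n IH]; [simpl; ring|].
  change (Rrising x (S n) * (x + INR (S n)) = x * Rrising (x + 1) (S n))%R.
  rewrite IH, S_INR. simpl. ring.
Qed.

Lemma Rrising_shift (x : R) (n : nat) :
  (0 < x)%R -> Rrising (x + 1) n = (Rrising x n * (x + INR n) / x)%R.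
Proof.
  intros H.
  change (Rrising (x + 1) n = Rrising x (S n) / x)%R.
  rewrite Rrising_head. field; lra.
Qed.

Lemma Crising_RtoC (x : R) (n : nat) : Crising x n = Rrising x n.
Proof.
  induction n as [|n IH]; [reflexivity|].
  rewrite Crising_S, IH. simpl. now rewrite RtoC_mult, RtoC_plus.
Qed.

Lemma Cfall_INR (k i : nat) : exists x, (0 <= x)%R /\ Cfall (INR k) i = RtoC x.
Proof.
  induction i as [|i (x & Hx & IH)].
  - exists 1%R; split; [lra|reflexivity].
  - destruct (Nat.le_gt_cases i k) as [H|H].
    + apply le_INR in H. exists (x * (INR k - INR i))%R.
      split; [apply Rmult_le_pos; lra|]. now rewrite Cfall_S, IH, RtoC_mult, RtoC_minus.
    + exists 0%R; split; [lra|]. apply Cfall_zero; lia.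
Qed.

Lemma Cmod_INR (n : nat) : Cmod (INR n) = INR n.
Proof. rewrite Cmod_R. apply Rabs_pos_eq, pos_INR. Qed.

Lemma Crising_le (z : C) (x : R) (n : nat) :
  (Cmod z <= x)%R -> (Cmod (Crising z n) <= Rrising x n)%R.
Proof.
  intros H; induction n as [|n IH]; simpl; [rewrite Cmod_1; lra|].
  rewrite Cmod_mult. apply Rmult_le_compat; auto using Cmod_ge_0.
  eapply Rle_trans; [apply Cmod_triangle|]. rewrite Cmod_INR. lra.
Qed.

Lemma Cmod_ge_Re (z : C) (x : R) : (x <= Re z)%R -> (x <= Cmod z)%R.
Proof.
  intros H. pose proof (re_le_Cmod z). pose proof (Rle_abs (Re z)). lra.
Qed.

Lemma Crising_ge (z : C) (x : R) (n : nat) :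
  (0 < x <= Re z)%R -> (Rrising x n <= Cmod (Crising z n))%R.
Proof.
  intros H; induction n as [|n IH]; simpl; [rewrite Cmod_1; lra|].
  rewrite Cmod_mult. pose proof (pos_INR n).
  apply Rmult_le_compat; auto; [left; apply Rrising_pos; lra | lra |].
  apply Cmod_ge_Re. destruct z; simpl in *. lra.
Qed.

(** The radius of the neighbourhood of the origin. It gives |s| <= 2 r0 = 1/16, and the value 1/32
    leaves slack in the numerical inequalities that follow. *)
Definition r0 : R := (/ 32)%R.

Ltac r0lra := unfold r0 in *; repeat split; lra.

(** Here 3 r0 is the value of v = u + s at u = r0, s = 2 r0, so that i! [rho] (i + 1) is Gauss's
    value of the inner sum at this point. The order of growth is n^(4 r0 - 1). *)
Definition rho (n : nat) : R := (Rrising r0 n / Rrising (1 - 3 * r0) n)%R.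

Lemma Rrising_q_pos (n : nat) : (0 < Rrising (1 - 3 * r0) n)%R.
Proof. apply Rrising_pos; r0lra. Qed.

Lemma rho_pos (n : nat) : (0 < rho n)%R.
Proof.
  apply Rdiv_lt_0_compat; [apply Rrising_pos; r0lra | apply Rrising_q_pos].
Qed.

Lemma rho_S (n : nat) : rho (S n) = (rho n * ((r0 + INR n) / (1 - 3 * r0 + INR n)))%R.
Proof.
  unfold rho; simpl. pose proof (Rrising_q_pos n). pose proof (pos_INR n).
  field; r0lra.
Qed.

(** Comparison with this telescoping series replaces estimates of the growth of rising
    factorials. *)
Lemma rho_telescope (n : nat) :
  (rho n / (1 - 3 * r0 + INR n) = (rho n - rho (S n)) / (1 - 4 * r0))%R.
Proof.
  rewrite rho_S. pose proof (pos_INR n). field; r0lra.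
Qed.

Lemma ex_series_rho (K : R) :
  ex_series (fun n => K * (rho (S n) / (1 - 3 * r0 + INR (S n))))%R.
Proof.
  apply (ex_series_scal (V := R_NormedModule) K
           (fun n => rho (S n) / (1 - 3 * r0 + INR (S n)))%R).
  apply ex_series_Rsum_bound with (rho 1 / (1 - 4 * r0))%R.
  - intros i. pose proof (rho_pos (S i)). pose proof (pos_INR (S i)).
    apply Rlt_le, Rdiv_lt_0_compat; r0lra.
  - intros n.
    assert (E : Rsum (fun n => rho (S n) / (1 - 3 * r0 + INR (S n)))%R n =
                ((rho 1 - rho (S n)) / (1 - 4 * r0))%R).
    { induction n as [|n IH].
      - simpl. unfold Rdiv. ring.
      - change (Rsum (fun n => rho (S n) / (1 - 3 * r0 + INR (S n)))%R n
                + rho (S n) / (1 - 3 * r0 + INR (S n))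
                = (rho 1 - rho (S (S n))) / (1 - 4 * r0))%R.
        rewrite IH, rho_telescope. unfold Rdiv. ring. }
    rewrite E. pose proof (rho_pos (S n)).
    apply Rmult_le_compat_r; [|lra].
    apply Rlt_le, Rinv_0_lt_compat. r0lra.
Qed.

(** The order n^(-1/2) is weaker than the true one but is preserved by a one-step induction, and it
    suffices for convergence to 0. *)
Lemma rho_sqr (n : nat) : (rho n * rho n * INR (S n) <= 1)%R.
Proof.
  induction n as [|n IH].
  - unfold rho; simpl. lra.
  - rewrite rho_S, (S_INR (S n)), S_INR in *. pose proof (pos_INR n) as Hn.
    set (x := INR n) in *. pose proof (rho_pos n) as Hr. set (p := rho n) in *.
    set (t := ((r0 + x) / (1 - 3 * r0 + x))%R).
    assert (Ht : (t * (1 - 3 * r0 + x) = r0 + x)%R) by (unfold t; field; r0lra).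
    assert (Ht2 : (t * t * (x + 1 + 1) <= x + 1)%R).
    { assert (D : (0 < (1 - 3 * r0 + x) * (1 - 3 * r0 + x))%R) by (unfold r0; nra).
      apply Rmult_le_reg_r with (1 := D).
      replace (t * t * (x + 1 + 1) * ((1 - 3 * r0 + x) * (1 - 3 * r0 + x)))%R with
        ((t * (1 - 3 * r0 + x)) * (t * (1 - 3 * r0 + x)) * (x + 1 + 1))%R by ring.
      rewrite Ht. unfold r0. nra. }
    replace (p * t * (p * t) * (x + 1 + 1))%R with (p * p * (t * t * (x + 1 + 1)))%R by ring.
    eapply Rle_trans; [|exact IH]. apply Rmult_le_compat_l; nra.
Qed.

Lemma is_lim_rho : is_lim_seq rho 0%R.
Proof.
  apply is_lim_seq_0_le with (fun n => sqrt (/ INR (S n))).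
  - exists O; intros n _. pose proof (rho_pos n) as Hr. split; [lra|].
    rewrite <- (sqrt_square (rho n)) by lra. apply sqrt_le_1_alt.
    assert (Hn : (0 < INR (S n))%R) by (apply lt_0_INR; lia).
    apply Rmult_le_reg_r with (INR (S n)); auto.
    rewrite Rinv_l by lra. apply rho_sqr.
  - rewrite <- sqrt_0.
    apply (is_lim_seq_continuous sqrt (fun n => / INR (S n))%R 0%R).
    + apply continuity_pt_sqrt; lra.
    + apply (is_lim_seq_incr_1 (fun n => / INR n)%R).
      replace (Finite 0) with (Rbar_inv p_infty) by reflexivity.
      apply is_lim_seq_inv; [apply is_lim_seq_INR | discriminate].
Qed.

(** The inner sum at the real point u = r0, s = 2 r0, where its terms are nonnegative. It is kept as
    the real part of a complex sum so that the complex telescoping identities apply to it. *)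
Definition gauss_bound (N i : nat) : R := Re (Csum (gauss_term r0 (2 * r0)%R i) N).

Lemma Crising_quotient_r0 (i k n : nat) (f : C) (x : R) : (0 <= x)%R -> f = x ->
  exists y, (0 <= y)%R /\ f * Crising r0 k / Crising (INR i + 1 - (2 * r0)%R) n = RtoC y.
Proof.
  intros Hx ->. pose proof (pos_INR i).
  assert (P : (0 < Rrising (INR i + 1 - 2 * r0) n)%R) by (apply Rrising_pos; r0lra).
  exists (x * Rrising r0 k / Rrising (INR i + 1 - 2 * r0) n)%R. split.
  - apply Rmult_le_pos; [|apply Rlt_le, Rinv_0_lt_compat, P].
    apply Rmult_le_pos; auto. left; apply Rrising_pos; r0lra.
  - rewrite RtoC_div by lra.
    now rewrite (RtoC_mult x), <- !Crising_RtoC, RtoC_minus, RtoC_plus.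
Qed.

(** At the real point the boundary term of the telescoping recursion in i is nonnegative and enters
    with a minus sign. Dropping it turns Gauss's value of the infinite sum into an upper bound for
    every N. *)
Lemma gauss_bound_le (i N : nat) : (gauss_bound N i <= INR (fact i) * rho (S i))%R.
Proof.
  assert (Ns : noint (2 * r0)%R).
  { apply noint_small.
    - intros E; apply RtoC_inj in E. unfold r0 in E; lra.
    - rewrite Cmod_R, Rabs_pos_eq; r0lra. }
  assert (Ev : RtoC (3 * r0)%R = r0 + (2 * r0)%R) by (rewrite <- RtoC_plus; f_equal; ring).
  unfold gauss_bound. induction i as [|i IH].
  - pose proof (Csum_gauss_term_0 _ _ _ N Ev Ns) as E.
    destruct (Crising_quotient_r0 0 (S N) (S N) 1 1 ltac:(lra) eq_refl) as (y & Hy & Ey).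
    rewrite Cmult_1_l, Cplus_0_l in Ey. rewrite Ey in E. apply (f_equal Re) in E.
    rewrite <- !RtoC_minus, <- RtoC_mult, <- RtoC_minus, re_scal_l, re_RtoC in E.
    assert (0 <= (1 - 2 * r0) * y)%R by (apply Rmult_le_pos; r0lra).
    unfold rho; simpl. unfold r0 in *. lra.
  - pose proof (Csum_gauss_term_S _ _ _ i N Ev Ns) as E.
    destruct (Cfall_INR N (S i)) as (x & Hx & Ex).
    destruct (Crising_quotient_r0 (S i) (S N) (S N) _ x Hx Ex) as (y & Hy & Ey).
    replace ((INR N - INR i) * gauss_term r0 (2 * r0)%R i N) with (RtoC y) in E.
    2: { rewrite <- Ey, INR_C_S. replace (INR i + 1 + 1) with (INR i + 2) by ring.
         unfold gauss_term. rewrite Cfall_S. unfold Cdiv; ring. }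
    pose proof (pos_INR i) as Hi. apply (f_equal Re) in E.
    replace (INR i + 2 - (3 * r0)%R) with (RtoC (INR i + 2 - 3 * r0)) in E
      by now rewrite RtoC_minus, RtoC_plus.
    replace ((INR i + 1) * (r0 + INR i + 1)) with (RtoC ((INR i + 1) * (r0 + INR i + 1))) in E
      by now rewrite RtoC_mult, !RtoC_plus.
    replace ((2 * INR i + 3 - (2 * r0)%R) * y) with (RtoC ((2 * INR i + 3 - 2 * r0) * y)) in E
      by now rewrite RtoC_mult, RtoC_minus, RtoC_plus, RtoC_mult.
    set (c' := Csum (gauss_term r0 (2 * r0)%R (S i)) N) in *.
    set (c := Csum (gauss_term r0 (2 * r0)%R i) N) in *.
    rewrite re_scal_l in E.
    assert (E' : ((INR i + 2 - 3 * r0) * Re c' <= (INR i + 1) * (r0 + INR i + 1) * Re c)%R).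
    { rewrite E. assert (0 <= (2 * INR i + 3 - 2 * r0) * y)%R by (apply Rmult_le_pos; r0lra).
      set (z := ((2 * INR i + 3 - 2 * r0) * y)%R) in *.
      set (w := ((INR i + 1) * (r0 + INR i + 1))%R) in *.
      change (Re (w * c) + - z <= w * Re c)%R. rewrite re_scal_l. lra. }
    apply Rmult_le_reg_l with (INR i + 2 - 3 * r0)%R; [r0lra|].
    eapply Rle_trans; [exact E'|].
    rewrite (rho_S (S i)), fact_simpl, mult_INR, S_INR.
    replace ((INR i + 2 - 3 * r0) * ((INR i + 1) * INR (fact i) *
       (rho (S i) * ((r0 + (INR i + 1)) / (1 - 3 * r0 + (INR i + 1))))))%R
     with ((INR i + 1) * (r0 + INR i + 1) * (INR (fact i) * rho (S i)))%R
     by (field; r0lra).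
    apply Rmult_le_compat_l; auto. apply Rmult_le_pos; r0lra.
Qed.

(** * Passage to the limit *)

Lemma Clim_shift_ratio (c d : C) : Clim (fun N => (INR N + c) / (INR N + d)) 1.
Proof.
  destruct (INR_unbounded (2 * Cmod d + 1)) as [N0 HN0].
  pose proof (Cmod_ge_0 d) as Hd.
  apply Clim_le with (fun N => (2 * Cmod (c - d) * / INR N)%R).
  - exists N0; intros n Hn. apply le_INR in Hn.
    assert (K : (INR n / 2 <= Cmod (INR n + d))%R).
    { pose proof (Cmod_triangle (INR n + d) (- d)) as T. rewrite Cmod_opp in T.
      replace (INR n + d + - d) with (RtoC (INR n)) in T by ring.
      rewrite Cmod_INR in T. lra. }
    assert (Nz : INR n + d <> 0) by (apply Cmod_gt_0; lra).
    replace ((INR n + c) / (INR n + d) - 1) with ((c - d) / (INR n + d)) by (field; auto).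
    rewrite Cmod_div by auto. unfold Rdiv.
    replace (2 * Cmod (c - d) * / INR n)%R with (Cmod (c - d) * / (INR n / 2))%R
      by (field; lra).
    apply Rmult_le_compat_l; [apply Cmod_ge_0|]. apply Rinv_le_contravar; lra.
  - replace (Finite 0) with (Rbar_mult (2 * Cmod (c - d))%R 0%R)
      by (simpl; f_equal; ring).
    apply is_lim_seq_scal_l.
    replace (Finite 0) with (Rbar_inv p_infty) by reflexivity.
    apply is_lim_seq_inv; [apply is_lim_seq_INR | discriminate].
Qed.

Lemma Clim_eq (x : nat -> C) (l m : C) : Clim x l -> l = m -> Clim x m.
Proof. now intros H <-. Qed.

Definition small (u v s : C) : Prop :=
  (Cmod u <= r0)%R /\ (Cmod v <= r0)%R /\ v = u + s /\ noint u /\ noint v /\ noint s.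

Lemma small_s (u v s : C) : small u v s -> (Cmod s <= 2 * r0)%R.
Proof.
  intros (Hu & Hv & E & _). replace s with (v + - u) by (rewrite E; ring).
  eapply Rle_trans; [apply Cmod_triangle|]. rewrite Cmod_opp. lra.
Qed.

Lemma small_swap (u v s : C) : small u v s -> small v u (- s).
Proof.
  intros (Hu & Hv & E & Nu & Nv & Ns). repeat split; auto with noint.
  rewrite E; ring.
Qed.

Lemma Re_minus_ge (x : R) (z : C) (c : R) : (Cmod z <= c)%R -> (x - c <= Re (RtoC x - z))%R.
Proof.
  intros H. pose proof (re_le_Cmod z) as K. pose proof (Rle_abs (Re z)).
  change (x - c <= x - Re z)%R. lra.
Qed.

Lemma Clim_Crising_ratio (u v s : C) : small u v s ->
  Clim (fun N => Crising u (S N) / Crising (1 - s) (S N)) 0.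
Proof.
  intros Hs. pose proof (small_s _ _ _ Hs) as Hs2. destruct Hs as (Hu & Hv & E & Nu & Nv & Ns).
  apply Clim_incr_1 with (x := fun N => Crising u N / Crising (1 - s) N).
  apply Clim_le with rho; [|apply is_lim_rho].
  exists O; intros n _.
  replace (Crising u n / Crising (1 - s) n - 0) with (Crising u n / Crising (1 - s) n) by ring.
  rewrite Cmod_div by (apply Crising_noint; auto with noint).
  assert (H1 := Crising_le _ _ n Hu).
  assert (H2 : (Rrising (1 - 3 * r0) n <= Cmod (Crising (1 - s) n))%R).
  { apply Crising_ge. pose proof (Re_minus_ge 1 s _ Hs2). r0lra. }
  pose proof (Rrising_q_pos n).
  apply Rmult_le_compat; auto using Cmod_ge_0.
  - apply Rlt_le, Rinv_0_lt_compat; lra.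
  - apply Rinv_le_contravar; auto.
Qed.

(** Passing from i to i + 1 multiplies the boundary term by a factor with a finite limit, so
    everything rests on i = 0, where the quotient of rising factorials tends to 0. *)
Lemma Clim_gauss_boundary (u v s : C) (i : nat) : small u v s ->
  Clim (fun N => (INR N - INR i) * gauss_term u s i N) 0.
Proof.
  intros Hs. pose proof (Clim_Crising_ratio _ _ _ Hs) as H0.
  destruct Hs as (Hu & Hv & E & Nu & Nv & Ns).
  induction i as [|i IH].
  - apply (Clim_ext (fun N => (Crising u (S N) / Crising (1 - s) (S N)) *
             ((1 - s) * ((INR N + 0) / (INR N + (2 - s)))))).
    + intros n. unfold gauss_term. simpl (Cfall _ 0). simpl (INR 0).
      replace (0 + 2 - s) with (1 - s + 1) by ring.
      rewrite Crising_shift by nz.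
      assert (N1 : Crising (1 - s) (S n) <> 0) by (apply Crising_noint; auto with noint).
      rewrite INR_C_S. field. repeat split; auto; try nz.
    + eapply Clim_eq; [apply Clim_mult; [exact H0|]; apply Clim_scal, Clim_shift_ratio|ring].
  - apply (Clim_ext (fun N => ((INR N - INR i) * gauss_term u s i N) *
             ((INR i + 2 - s) * ((INR N + - (INR i + 1)) / (INR N + (INR i + 3 - s)))))).
    + intros n. unfold gauss_term. rewrite Cfall_S, !INR_C_S.
      replace (INR i + 1 + 2 - s) with (INR i + 2 - s + 1) by ring.
      rewrite (Crising_shift (INR i + 2 - s)) by nz.
      assert (N1 : Crising (INR i + 2 - s) (S n) <> 0) by (apply Crising_noint; auto with noint).
      rewrite INR_C_S. field. repeat split; auto; try nz.
    + eapply Clim_eq; [apply Clim_mult; [exact IH|]; apply Clim_scal, Clim_shift_ratio|ring].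
Qed.

(** Gauss's theorem for this family: as the boundary terms disappear, the telescoping identities
    leave a first-order recursion in i, which the stated quotient satisfies. *)
Lemma Clim_gauss (u v s : C) (i : nat) : small u v s ->
  Clim (Csum (gauss_term u s i)) (Cfact i * Crising u (S i) / Crising (1 - v) (S i)).
Proof.
  intros Hs. pose proof Hs as (Hu & Hv & E & Nu & Nv & Ns).
  induction i as [|i IH].
  - apply (Clim_ext (fun N => / (1 - v) *
             (u - (1 - s) * (Crising u (S N) / Crising (1 - s) (S N))))).
    + intros n. rewrite <- (Csum_gauss_term_0 u v) by auto. field. nz.
    + eapply Clim_eq.
      * apply Clim_scal, Clim_minus; [apply Clim_const|].
        apply Clim_scal, (Clim_Crising_ratio u v s Hs).
      * unfold Cfact; simpl. field. nz.
  - apply (Clim_ext (fun N => / (INR i + 2 - v) *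
       ((INR i + 1) * (u + INR i + 1) * Csum (gauss_term u s i) N
         - (2 * INR i + 3 - s) * ((INR N - INR i) * gauss_term u s i N)))).
    + intros n. rewrite <- (Csum_gauss_term_S u v) by auto. field. nz.
    + eapply Clim_eq.
      * apply Clim_scal, Clim_minus; [apply Clim_scal, IH|].
        apply Clim_scal, (Clim_gauss_boundary u v s i Hs).
      * rewrite (Crising_S u (S i)), (Crising_S (1 - v) (S i)), Cfact_S, INR_C_S.
        assert (N1 : Crising (1 - v) (S i) <> 0) by (apply Crising_noint; auto with noint).
        field. repeat split; auto; nz.
Qed.

Lemma Clim_gauss_coef (u v s : C) (i : nat) : small u v s ->
  Clim (fun N => gauss_coef u s N i) (bcoef u v s (S i)).
Proof.
  intros Hs. eapply Clim_eq; [apply Clim_scal, (Clim_gauss u v s i Hs)|].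
  destruct Hs as (Hu & Hv & E & Nu & Nv & Ns).
  unfold bcoef. rewrite Cpow_S. assert (F := Cfact_nz i).
  assert (N1 : Crising (1 - v) (S i) <> 0) by (apply Crising_noint; auto with noint).
  field; auto.
Qed.

Lemma bdefect_S (u v s : C) (N j : nat) : noint u -> noint s ->
  bdefect u v s N (S j) =
  bdefect u v s N j *
  (((INR N + 1 + INR j - v) * (INR N - INR j) * (INR N - INR j + s)) /
   ((INR N - INR j - u) * (INR N + 1 + INR j) * (INR N + 1 + INR j - s))).
Proof.
  intros Nu Ns. unfold bdefect. cbn [Crising Cfall].
  assert (D1 : Cfall (INR N - u) j <> 0) by (apply Cfall_noint; auto with noint).
  assert (D2 : Crising (INR N + 1 - s) j <> 0) by (apply Crising_noint; auto with noint).
  assert (D0 : forall i, INR N + 1 + INR i <> 0).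
  { intros i. rewrite <- INR_C_S. apply INR_C_plus_nz; lia. }
  assert (D3 : Crising (INR N + 1) j <> 0) by (apply Crising_nz; auto).
  field. repeat split; auto; nz.
Qed.

Lemma Clim_bdefect (u v s : C) (j : nat) : noint u -> noint s ->
  Clim (fun N => bdefect u v s N j) 1.
Proof.
  intros Nu Ns. induction j as [|j IH].
  - apply Clim_ext with (2 := Clim_const 1). intros n. unfold bdefect; simpl. field.
  - apply (Clim_ext (fun N => bdefect u v s N j *
      (((INR N + (1 + INR j - v)) / (INR N + (1 + INR j))) *
       ((INR N + - INR j) / (INR N + (- INR j - u))) *
       ((INR N + (s - INR j)) / (INR N + (1 + INR j - s)))))).
    + intros n. rewrite bdefect_S by auto.
      assert (D0 : INR n + 1 + INR j <> 0).
      { rewrite <- INR_C_S. apply INR_C_plus_nz; lia. }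
      field. repeat split; auto; try nz.
    + eapply Clim_eq; [apply Clim_mult; [exact IH|]|].
      * apply Clim_mult; [apply Clim_mult|]; apply Clim_shift_ratio.
      * ring.
Qed.

(** Since v = u + s, the numbers x + s and x - u differ by v, and y - v and y - s differ by u.
    Comparing them in pairs costs two factors 1 + O(r0 / x), which the gain x / y <= x / (x + 1)
    outweighs. The use is with x = N - j and y = N + 1 + j. *)
Lemma bdefect_factor_le (u v s : C) (x y : R) : small u v s -> (1 <= x)%R -> (x + 1 <= y)%R ->
  (Cmod (((y - v) * x * (x + s)) / ((x - u) * y * (y - s))) <= 1)%R.
Proof.
  intros Hs Hx Hy. pose proof (small_s _ _ _ Hs) as Hs2.
  destruct Hs as (Hu & Hv & E & Nu & Nv & Ns).
  assert (A1 : (x - r0 <= Cmod (x - u))%R) by (apply Cmod_ge_Re, Re_minus_ge; auto).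
  assert (B1 : (y - 2 * r0 <= Cmod (y - s))%R) by (apply Cmod_ge_Re, Re_minus_ge; auto).
  assert (A2 : (Cmod (x + s) <= Cmod (x - u) + r0)%R).
  { replace (x + s) with ((x - u) + v) by (rewrite E; ring).
    eapply Rle_trans; [apply Cmod_triangle|]; lra. }
  assert (B2 : (Cmod (y - v) <= Cmod (y - s) + r0)%R).
  { replace (y - v) with ((y - s) + - u) by (rewrite E; ring).
    eapply Rle_trans; [apply Cmod_triangle|]; rewrite Cmod_opp; lra. }
  assert (Nx : x - u <> 0) by (apply Cmod_gt_0; r0lra).
  assert (Ny : y - s <> 0) by (apply Cmod_gt_0; r0lra).
  assert (Ny0 : RtoC y <> 0) by (intros K; apply RtoC_inj in K; lra).
  rewrite Cmod_div by (repeat apply Cmult_neq_0; auto). rewrite !Cmod_mult, !Cmod_R.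
  rewrite (Rabs_pos_eq x), (Rabs_pos_eq y) by lra.
  set (A := Cmod (x - u)) in *. set (B := Cmod (y - s)) in *.
  set (A' := Cmod (x + s)) in *. set (B' := Cmod (y - v)) in *.
  assert (PA : (0 <= A')%R) by apply Cmod_ge_0. assert (PB : (0 <= B')%R) by apply Cmod_ge_0.
  clearbody A B A' B'. unfold r0 in *.
  assert (D : (0 < A * y * B)%R) by (repeat apply Rmult_lt_0_compat; lra).
  apply Rmult_le_reg_r with (1 := D). unfold Rdiv. rewrite Rmult_assoc, Rinv_l by lra.
  assert (K : (B' * A' <= (B + / 32) * (A + / 32))%R) by (apply Rmult_le_compat; lra).
  assert (K2 : (x * (B' * A') <= x * ((B + / 32) * (A + / 32)))%R)
    by (apply Rmult_le_compat_l; lra).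
  assert (K3 : (A * B * (x + 1) <= A * B * y)%R) by (apply Rmult_le_compat_l; nra).
  assert (K4 : (x * A <= 32 / 31 * (B * A))%R).
  { replace (32 / 31 * (B * A))%R with ((32 / 31 * B) * A)%R by ring.
    apply Rmult_le_compat_r; lra. }
  assert (K5 : (x * B <= 32 / 31 * (B * A))%R).
  { replace (32 / 31 * (B * A))%R with ((32 / 31 * A) * B)%R by ring.
    apply Rmult_le_compat_r; lra. }
  assert (K6 : (x <= 32 / 31 * (B * A))%R) by nra.
  nra.
Qed.

Lemma bdefect_le (u v s : C) (N j : nat) : small u v s -> (j <= N)%nat ->
  (Cmod (bdefect u v s N j) <= 1)%R.
Proof.
  intros Hs. pose proof Hs as (Hu & Hv & E & Nu & Nv & Ns).
  induction j as [|j IH]; intros Hj.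
  - unfold bdefect; simpl. replace (1 * 1 * 1 / (1 * 1 * 1)) with (RtoC 1) by field.
    rewrite Cmod_1; lra.
  - rewrite bdefect_S by auto. rewrite Cmod_mult.
    apply Rle_trans with (1 * 1)%R; [|lra].
    apply Rmult_le_compat; auto using Cmod_ge_0.
    + apply IH; lia.
    + assert (H1 := le_INR _ _ Hj). rewrite S_INR in H1. pose proof (pos_INR j).
      pose proof (bdefect_factor_le u v s (INR N - INR j) (INR N + 1 + INR j) Hs
                    ltac:(lra) ltac:(lra)) as K.
      rewrite !RtoC_plus, !RtoC_minus in K. exact K.
Qed.

(** With j = i + 1 this dominates (2 j + 1) [rho] j / (j - 1/2)^2, rewritten in the form that
    telescopes. The constant 24 is dictated by j = 1. *)
Definition dom_bound (i : nat) : R := (24 * (rho (S i) / (1 - 3 * r0 + INR (S i))))%R.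

Lemma dom_bound_le (a b c : C) (i : nat) :
  (Cmod a <= / 2)%R -> (Cmod b <= / 2)%R ->
  (Cmod c <= (2 * INR (S i) + 1) * rho (S i))%R ->
  (Cmod (c / ((INR (S i) - a) * (INR (S i) - b))) <= dom_bound i)%R.
Proof.
  intros Ha Hb Hc. unfold dom_bound. rewrite S_INR in *. set (x := INR i) in *.
  assert (Hx : (0 <= x)%R) by apply pos_INR.
  assert (A1 : (x + 1 - / 2 <= Cmod (RtoC (x + 1) - a))%R) by (apply Cmod_ge_Re, Re_minus_ge; auto).
  assert (B1 : (x + 1 - / 2 <= Cmod (RtoC (x + 1) - b))%R) by (apply Cmod_ge_Re, Re_minus_ge; auto).
  assert (N1 : RtoC (x + 1) - a <> 0) by (apply Cmod_gt_0; lra).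
  assert (N2 : RtoC (x + 1) - b <> 0) by (apply Cmod_gt_0; lra).
  rewrite Cmod_div, Cmod_mult by (now apply Cmult_neq_0).
  pose proof (rho_pos (S i)) as Hr. set (p := rho (S i)) in *.
  assert (D : ((x + / 2) * (x + / 2) <= Cmod (RtoC (x + 1) - a) * Cmod (RtoC (x + 1) - b))%R).
  { apply Rmult_le_compat; lra. }
  assert (D0 : (0 < (x + / 2) * (x + / 2))%R) by nra.
  apply Rle_trans with ((2 * (x + 1) + 1) * p / ((x + / 2) * (x + / 2)))%R.
  - apply Rmult_le_compat; auto using Cmod_ge_0.
    + apply Rlt_le, Rinv_0_lt_compat; lra.
    + apply Rinv_le_contravar; auto.
  - assert (Q : (0 < 1 - 3 * r0 + (x + 1))%R) by r0lra.
    apply Rmult_le_reg_r with (1 := D0). unfold Rdiv. rewrite Rmult_assoc, Rinv_l, Rmult_1_r by lra.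
    apply Rmult_le_reg_r with (1 := Q).
    replace (24 * (p * / (1 - 3 * r0 + (x + 1))) * ((x + / 2) * (x + / 2)) * (1 - 3 * r0 + (x + 1)))%R
      with (24 * p * ((x + / 2) * (x + / 2)))%R by (field; lra).
    replace ((2 * (x + 1) + 1) * p * (1 - 3 * r0 + (x + 1)))%R
      with (p * ((2 * (x + 1) + 1) * (1 - 3 * r0 + (x + 1))))%R by ring.
    replace (24 * p * ((x + / 2) * (x + / 2)))%R with (p * (24 * ((x + / 2) * (x + / 2))))%R by ring.
    apply Rmult_le_compat_l; [lra|]. unfold r0; nra.
Qed.

Lemma dom_bound_nonneg (i : nat) : (0 <= dom_bound i)%R.
Proof.
  unfold dom_bound. pose proof (rho_pos (S i)). pose proof (pos_INR (S i)).
  apply Rmult_le_pos; [lra|]. apply Rlt_le, Rdiv_lt_0_compat; r0lra.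
Qed.

Lemma Cmod_sign (n : nat) : Cmod ((- (1)) ^ n) = 1%R.
Proof. destruct (Csign_cases n) as [-> | ->]; [apply Cmod_1 | apply Cmod_m1]. Qed.

Lemma Cmod_2j_s (s : C) (i : nat) : (Cmod s <= 1)%R ->
  (Cmod (2 * INR (S i) - s) <= 2 * INR (S i) + 1)%R.
Proof.
  intros H. eapply Rle_trans; [apply Cmod_triangle|].
  rewrite Cmod_opp, Cmod_mult, Cmod_INR, Cmod_R, Rabs_pos_eq by lra. lra.
Qed.

Lemma bcoef_le (u v s : C) (i : nat) : small u v s ->
  (Cmod (bcoef u v s (S i)) <= (2 * INR (S i) + 1) * rho (S i))%R.
Proof.
  intros Hs. pose proof (small_s _ _ _ Hs) as Hs2. destruct Hs as (Hu & Hv & E & Nu & Nv & Ns).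
  unfold bcoef. rewrite Cmod_div by (apply Crising_noint; auto with noint).
  rewrite !Cmod_mult, Cmod_sign, Rmult_1_l.
  unfold rho, Rdiv. rewrite Rmult_assoc.
  assert (H2 : (Rrising (1 - 3 * r0) (S i) <= Cmod (Crising (1 - v) (S i)))%R).
  { apply Crising_ge. pose proof (Re_minus_ge 1 v _ Hv). r0lra. }
  pose proof (Rrising_q_pos (S i)).
  apply Rmult_le_compat; auto using Cmod_ge_0.
  - apply Rmult_le_pos; [apply Cmod_ge_0|]. apply Rlt_le, Rinv_0_lt_compat; lra.
  - replace (s - 2 * INR (S i)) with (- (2 * INR (S i) - s)) by ring.
    rewrite Cmod_opp. apply Cmod_2j_s. r0lra.
  - apply Rmult_le_compat; auto using Cmod_ge_0, Crising_le.
    + apply Rlt_le, Rinv_0_lt_compat; lra.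
    + apply Rinv_le_contravar; auto.
Qed.

(** Termwise comparison with the real point u = r0, s = 2 r0; the bound does not depend on N, as
    dominated convergence requires. *)
Lemma gauss_coef_le (u v s : C) (N i : nat) : small u v s ->
  (Cmod (gauss_coef u s N i) <= (2 * INR (S i) + 1) * rho (S i))%R.
Proof.
  intros Hs. pose proof (small_s _ _ _ Hs) as Hs2. destruct Hs as (Hu & Hv & E & Nu & Nv & Ns).
  assert (F : (0 < INR (fact i))%R) by apply INR_fact_lt_0.
  assert (G : (Cmod (Csum (gauss_term u s i) N) <= INR (fact i) * rho (S i))%R).
  { eapply Rle_trans; [|apply (gauss_bound_le i N)]. unfold gauss_bound. rewrite Re_Csum.
    apply Cmod_Csum. intros k _. unfold gauss_term.
    destruct (Cfall_INR k i) as (x & Hx & ->).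
    pose proof (pos_INR i).
    assert (P : (0 < Rrising (INR i + 2 - 2 * r0) (S k))%R)
      by (apply Rrising_pos; r0lra).
    assert (H2 : (Rrising (INR i + 2 - 2 * r0) (S k) <= Cmod (Crising (INR i + 2 - s) (S k)))%R).
    { apply Crising_ge. pose proof (Re_minus_ge (INR i + 2) s _ Hs2) as K.
      rewrite RtoC_plus in K. r0lra. }
    replace (INR i + 2 - (2 * r0)%R) with (RtoC (INR i + 2 - 2 * r0))
      by now rewrite RtoC_minus, RtoC_plus.
    rewrite !Crising_RtoC, <- RtoC_mult, <- RtoC_div, re_RtoC by lra.
    rewrite Cmod_div by (apply Crising_noint; auto with noint).
    rewrite Cmod_mult, Cmod_R, (Rabs_pos_eq x) by auto.
    apply Rmult_le_compat.
    - apply Rmult_le_pos; auto using Cmod_ge_0.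
    - apply Rlt_le, Rinv_0_lt_compat; lra.
    - apply Rmult_le_compat_l; auto using Crising_le.
    - apply Rinv_le_contravar; auto. }
  unfold gauss_coef. rewrite Cmod_mult, Cmod_div by apply Cfact_nz.
  rewrite Cmod_mult, Cmod_sign, Rmult_1_l. unfold Cfact. rewrite Cmod_INR.
  replace ((2 * INR (S i) + 1) * rho (S i))%R with
    (((2 * INR (S i) + 1) / INR (fact i)) * (INR (fact i) * rho (S i)))%R by (field; lra).
  apply Rmult_le_compat; auto using Cmod_ge_0.
  - apply Rmult_le_pos; [apply Cmod_ge_0 | apply Rlt_le, Rinv_0_lt_compat; auto].
  - apply Rmult_le_compat_r; [apply Rlt_le, Rinv_0_lt_compat; auto|].
    apply Cmod_2j_s. r0lra.
Qed.

Lemma noint_small_nz (a : C) (i : nat) : (Cmod a <= / 2)%R -> INR (S i) - a <> 0.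
Proof.
  intros H. apply Cmod_gt_0.
  pose proof (Cmod_ge_Re _ _ (Re_minus_ge (INR (S i)) a _ H)) as K.
  rewrite S_INR in *. pose proof (pos_INR i). lra.
Qed.

(** The truncated one-sided sum and the half of the finite bilateral sum have different coefficients
    at level N, but both tend to [bcoef] under the common majorant [dom_bound]. Hence they have the
    same limit. *)
Lemma one_sided_limit (u v s a b : C) : small u v s -> a + b = s ->
  (Cmod a <= / 2)%R -> (Cmod b <= / 2)%R ->
  exists L, Clim (Csum (one_sided_term u a b)) L /\
    Clim (fun N => Csum (fun i => bcoef u v s (S i) * bdefect u v s N (S i)
                                  / ((INR (S i) - a) * (INR (S i) - b))) N) L.
Proof.
  intros Hs Es Ha Hb. pose proof Hs as (Hu & Hv & E & Nu & Nv & Ns).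
  set (y := fun i => bcoef u v s (S i) / ((INR (S i) - a) * (INR (S i) - b))).
  assert (HB : ex_series dom_bound) by apply ex_series_rho.
  destruct (tannery_trunc
    (fun N i => gauss_coef u s N i / ((INR (S i) - a) * (INR (S i) - b))) y dom_bound HB
    dom_bound_nonneg) as (L & HL1 & HL2).
  - intros N i _. apply (dom_bound_le a b); auto. apply (gauss_coef_le u v); auto.
  - intros i. unfold y, Cdiv. apply Clim_mult; [|apply Clim_const].
    now apply Clim_gauss_coef.
  - destruct (tannery_trunc
      (fun N i => bcoef u v s (S i) * bdefect u v s N (S i)
                  / ((INR (S i) - a) * (INR (S i) - b))) y dom_bound HB
      dom_bound_nonneg) as (L' & HL1' & HL2').
    + intros N i Hi. apply (dom_bound_le a b); auto. rewrite Cmod_mult.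
      rewrite <- (Rmult_1_r (_ * rho (S i))).
      apply Rmult_le_compat; auto using Cmod_ge_0.
      * now apply bcoef_le.
      * apply bdefect_le; auto; lia.
    + intros i. unfold y, Cdiv. apply Clim_mult; [|apply Clim_const].
      eapply Clim_eq; [apply Clim_scal, Clim_bdefect; auto|]. ring.
    + exists L. split.
      * apply Clim_ext with (2 := HL2). intros n. symmetry.
        apply one_sided_partial_fraction; auto. intros i _; split; now apply noint_small_nz.
      * rewrite (Clim_unique _ _ _ HL1 HL1'). exact HL2'.
Qed.

Lemma bprod_limit (u v s a b : C) : small u v s -> a + b = s -> a * b <> 0 ->
  (Cmod a <= / 2)%R -> (Cmod b <= / 2)%R ->
  exists F G, Clim (Csum (one_sided_term u a b)) F /\
    Clim (Csum (one_sided_term v (- a) (- b))) G /\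
    Clim (fun N => bprod u v s N a b) (s / (a * b) + (F - G)).
Proof.
  intros Hs Es Hab Ha Hb. pose proof Hs as (Hu & Hv & E & Nu & Nv & Ns).
  destruct (one_sided_limit u v s a b) as (F & HF1 & HF2); auto.
  destruct (one_sided_limit v u (- s) (- a) (- b)) as (G & HG1 & HG2);
    rewrite ?Cmod_opp; auto using small_swap; [rewrite <- Es; ring|].
  exists F, G; repeat split; auto.
  apply Clim_ext with (2 := Clim_plus _ _ _ _ (Clim_const (s / (a * b)))
                              (Clim_minus _ _ _ _ HF2 HG2)).
  intros N.
  assert (Na : a <> 0) by (intros Z; apply Hab; rewrite Z; ring).
  assert (Nb : b <> 0) by (intros Z; apply Hab; rewrite Z; ring).
  rewrite (bprod_eq_bsum u v s N E Nu Nv Ns a b Es Na Nb).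
  - unfold bsum. f_equal. rewrite <- Csum_minus. apply Csum_ext; intros i Hi.
    set (j := RtoC (INR (S i))).
    replace (a * b - (j * s - j * j)) with ((j - a) * (j - b)) by (rewrite <- Es; ring).
    replace (a * b - (- (j * s) - j * j)) with ((j - - a) * (j - - b)) by (rewrite <- Es; ring).
    reflexivity.
  - intros i _.
    replace (INR (S i) + a) with (INR (S i) - - a) by ring.
    replace (INR (S i) + b) with (INR (S i) - - b) by ring.
    repeat split; apply noint_small_nz; rewrite ?Cmod_opp; auto.
Qed.

(** * The product formula for the sine *)

Open Scope R_scope.

Lemma sin_abs_le (w : R) : Rabs (sin w) <= Rabs w.
Proof.
  pose proof (bounded_variation sin cos 1 0 w) as H.
  rewrite sin_0, !Rminus_0_r, Rmult_1_l in H. apply H. intros t _. split.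
  - auto_derive; auto. ring.
  - apply Rabs_le, COS_bound.
Qed.

Definition ch (h : R) : R := (exp h + exp (- h)) / 2.
Definition sh (h : R) : R := (exp h - exp (- h)) / 2.

Lemma sh_abs_le (h : R) : Rabs (sh h) <= Rabs h * exp (Rabs h).
Proof.
  assert (K : forall x, 0 <= x -> Rabs (sh x) <= x * exp x).
  { intros x Hx. unfold sh.
    assert (E : exp (- x) = exp x * exp (- (2 * x))) by (rewrite <- exp_plus; f_equal; ring).
    pose proof (exp_ineq1_le (- (2 * x))). pose proof (exp_pos x).
    assert (L : exp (- x) <= exp x).
    { destruct Hx as [Hx | <-]; [left; apply exp_increasing; lra | rewrite Ropp_0; lra]. }
    rewrite Rabs_pos_eq by lra. rewrite E. nra. }
  destruct (Rle_or_lt 0 h).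
  - rewrite (Rabs_pos_eq h) by auto. auto.
  - rewrite (Rabs_left h) by auto.
    replace (sh h) with (- sh (- h)) by (unfold sh; rewrite Ropp_involutive; field).
    rewrite Rabs_Ropp. apply K; lra.
Qed.

Lemma ch_minus_1 (h : R) : ch h - 1 = 2 * (sh (h / 2) * sh (h / 2)).
Proof.
  unfold ch, sh.
  assert (E1 : exp h = exp (h / 2) * exp (h / 2)) by (rewrite <- exp_plus; f_equal; field).
  assert (E2 : exp (- h) = exp (- (h / 2)) * exp (- (h / 2)))
    by (rewrite <- exp_plus; f_equal; field).
  assert (E3 : exp (h / 2) * exp (- (h / 2)) = 1)
    by (rewrite <- exp_plus, <- exp_0; f_equal; ring).
  rewrite E1, E2. nra.
Qed.

(** With [z = x + i y], [cr + i ci] and [sr + i si] are [cos (2 z t)] and [sin (2 z t)].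
    Integration by parts gives [(n^2 - 4 z^2) J_n = n (n - 1) J_(n-2)] for the integrals [J_n]
    of [cos t ^ n * cos (2 z t)], which produces the factors [1 - z^2 / k^2]. *)
Definition cr (x y t : R) : R := cos (2 * x * t) * ch (2 * y * t).
Definition ci (x y t : R) : R := - (sin (2 * x * t) * sh (2 * y * t)).
Definition sr (x y t : R) : R := sin (2 * x * t) * ch (2 * y * t).
Definition si (x y t : R) : R := cos (2 * x * t) * sh (2 * y * t).

Definition Jr (x y : R) (n : nat) : R := RInt (fun t => cos t ^ n * cr x y t) 0 (PI / 2).
Definition Ji (x y : R) (n : nat) : R := RInt (fun t => cos t ^ n * ci x y t) 0 (PI / 2).

Lemma is_RInt_Jr (x y : R) (n : nat) : is_RInt (fun t => cos t ^ n * cr x y t) 0 (PI / 2) (Jr x y n).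
Proof.
  apply (RInt_correct (V := R_CompleteNormedModule)).
  apply (ex_RInt_continuous (V := R_CompleteNormedModule)). intros t _.
  apply (ex_derive_continuous (K := R_AbsRing) (V := R_NormedModule)).
  unfold cr, ch. auto_derive; auto.
Qed.

Lemma is_RInt_Ji (x y : R) (n : nat) : is_RInt (fun t => cos t ^ n * ci x y t) 0 (PI / 2) (Ji x y n).
Proof.
  apply (RInt_correct (V := R_CompleteNormedModule)).
  apply (ex_RInt_continuous (V := R_CompleteNormedModule)). intros t _.
  apply (ex_derive_continuous (K := R_AbsRing) (V := R_NormedModule)).
  unfold ci, sh. auto_derive; auto.
Qed.

Lemma is_RInt_lin2 (f g : R -> R) (a b c d F G : R) :
  is_RInt f a b F -> is_RInt g a b G ->
  is_RInt (fun t => c * f t + d * g t) a b (c * F + d * G).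
Proof.
  intros Hf Hg.
  apply (is_RInt_plus (V := R_NormedModule) (fun t => c * f t) (fun t => d * g t));
    now apply (is_RInt_scal (V := R_NormedModule)).
Qed.

Lemma is_RInt_uniq (f : R -> R) (a b F G : R) : is_RInt f a b F -> is_RInt f a b G -> F = G.
Proof.
  intros HF HG. rewrite <- (is_RInt_unique f a b F HF). now apply is_RInt_unique.
Qed.

Lemma FTC (f df : R -> R) (b : R) :
  (forall t, is_derive f t (df t)) -> (forall t, ex_derive df t) ->
  is_RInt df 0 b (f b - f 0).
Proof.
  intros H1 H2. apply (is_RInt_derive (V := R_CompleteNormedModule) f df).
  - intros t _; auto.
  - intros t _. apply (ex_derive_continuous (K := R_AbsRing) (V := R_NormedModule)); auto.
Qed.

Lemma RInt_derive_0 (f df : R -> R) (F : R) :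
  (forall t, is_derive f t (df t)) -> (forall t, ex_derive df t) ->
  f 0 = 0 -> f (PI / 2) = 0 -> is_RInt df 0 (PI / 2) F -> F = 0.
Proof.
  intros H1 H2 Z0 Z1 H. rewrite (is_RInt_uniq _ _ _ _ _ H (FTC f df (PI / 2) H1 H2)). lra.
Qed.

Lemma sin_sqr (t : R) : sin t * sin t = 1 - cos t * cos t.
Proof. pose proof (sin2_cos2 t) as H. unfold Rsqr in H. lra. Qed.

Lemma Jr_rec (x y : R) (n : nat) : let m := INR (S (S n)) in
  (m * m - 4 * (x * x - y * y)) * Jr x y (S (S n)) + 8 * x * y * Ji x y (S (S n))
  = m * (m - 1) * Jr x y n.
Proof.
  intros m.
  set (df := fun t => 1 * ((m * m - 4 * (x * x - y * y)) * (cos t ^ S (S n) * cr x y t) +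
                      8 * x * y * (cos t ^ S (S n) * ci x y t))
                      + (- (m * (m - 1))) * (cos t ^ n * cr x y t)).
  assert (H1 : is_RInt df 0 (PI / 2)
    (1 * ((m * m - 4 * (x * x - y * y)) * Jr x y (S (S n)) + 8 * x * y * Ji x y (S (S n)))
     + (- (m * (m - 1))) * Jr x y n)).
  { unfold df. apply is_RInt_lin2; [apply is_RInt_lin2|];
      auto using is_RInt_Jr, is_RInt_Ji. }
  (* The real part of m cos(t)^(m-1) sin(t) cos(2 z t) - 2 z cos(t)^m sin(2 z t), which vanishes at
     0 and at pi / 2. *)
  set (f := fun t => m * (cos t ^ S n * sin t * cr x y t)
                     - 2 * (cos t ^ S (S n) * (x * sr x y t - y * si x y t))).
  match type of H1 with is_RInt _ _ _ ?F => enough (F = 0) by lra end.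
  apply (RInt_derive_0 f df) with (5 := H1).
  - intros t. unfold f, df, cr, ci, sr, si, ch, sh. auto_derive; auto.
    change (match n with O => 1 | S _ => INR n + 1 end) with (INR (S n)).
    replace (INR (S n)) with (m - 1) by (unfold m; rewrite (S_INR (S n)); ring).
    pose proof (sin_sqr t) as Q. simpl pow. field [Q].
  - intros t. unfold df, cr, ci, ch, sh. auto_derive; auto.
  - unfold f, sr, si, sh. rewrite !Rmult_0_r, sin_0, Ropp_0, exp_0. field.
  - unfold f; simpl pow; rewrite cos_PI2; ring.
Qed.

Lemma Ji_rec (x y : R) (n : nat) : let m := INR (S (S n)) in
  (m * m - 4 * (x * x - y * y)) * Ji x y (S (S n)) - 8 * x * y * Jr x y (S (S n))
  = m * (m - 1) * Ji x y n.
Proof.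
  intros m.
  set (df := fun t => 1 * ((m * m - 4 * (x * x - y * y)) * (cos t ^ S (S n) * ci x y t) +
                      (- (8 * x * y)) * (cos t ^ S (S n) * cr x y t))
                      + (- (m * (m - 1))) * (cos t ^ n * ci x y t)).
  assert (H1 : is_RInt df 0 (PI / 2)
    (1 * ((m * m - 4 * (x * x - y * y)) * Ji x y (S (S n)) + (- (8 * x * y)) * Jr x y (S (S n)))
     + (- (m * (m - 1))) * Ji x y n)).
  { unfold df. apply is_RInt_lin2; [apply is_RInt_lin2|];
      auto using is_RInt_Jr, is_RInt_Ji. }
  (* The imaginary part of the same function. *)
  set (f := fun t => m * (cos t ^ S n * sin t * ci x y t)
                     - 2 * (cos t ^ S (S n) * (x * si x y t + y * sr x y t))).
  match type of H1 with is_RInt _ _ _ ?F => enough (F = 0) by lra end.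
  apply (RInt_derive_0 f df) with (5 := H1).
  - intros t. unfold f, df, cr, ci, sr, si, ch, sh. auto_derive; auto.
    change (match n with O => 1 | S _ => INR n + 1 end) with (INR (S n)).
    replace (INR (S n)) with (m - 1) by (unfold m; rewrite (S_INR (S n)); ring).
    pose proof (sin_sqr t) as Q. simpl pow. field [Q].
  - intros t. unfold df, cr, ci, ch, sh. auto_derive; auto.
  - unfold f, sr, si, sh. rewrite !Rmult_0_r, sin_0, Ropp_0, exp_0. field.
  - unfold f; simpl pow; rewrite cos_PI2; ring.
Qed.

(** The integral of cos(2 z t) is elementary: 2 z J_0 = sin(pi z). Keeping z on the left includes z
    = 0. *)
Lemma J_0 (x y : R) :
  2 * (x * Jr x y 0 - y * Ji x y 0) = sin (PI * x) * ch (PI * y) /\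
  2 * (x * Ji x y 0 + y * Jr x y 0) = cos (PI * x) * sh (PI * y).
Proof.
  assert (S0 : sr x y 0 = 0) by (unfold sr; rewrite !Rmult_0_r, sin_0; ring).
  assert (S1 : si x y 0 = 0) by (unfold si, sh; rewrite !Rmult_0_r, Ropp_0; field).
  assert (S2 : sr x y (PI / 2) = sin (PI * x) * ch (PI * y)).
  { unfold sr. f_equal; f_equal; field. }
  assert (S3 : si x y (PI / 2) = cos (PI * x) * sh (PI * y)).
  { unfold si. f_equal; f_equal; field. }
  split.
  - assert (H1 := is_RInt_lin2 _ _ _ _ (2 * x) (- (2 * y)) _ _ (is_RInt_Jr x y 0) (is_RInt_Ji x y 0)).
    assert (H2 : is_RInt (fun t => 2 * x * (cos t ^ 0 * cr x y t) + - (2 * y) * (cos t ^ 0 * ci x y t))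
                   0 (PI / 2) (sr x y (PI / 2) - sr x y 0)).
    { apply FTC; intros t; unfold sr, cr, ci, ch, sh; auto_derive; auto. simpl pow. field. }
    pose proof (is_RInt_uniq _ _ _ _ _ H1 H2). lra.
  - assert (H1 := is_RInt_lin2 _ _ _ _ (2 * x) (2 * y) _ _ (is_RInt_Ji x y 0) (is_RInt_Jr x y 0)).
    assert (H2 : is_RInt (fun t => 2 * x * (cos t ^ 0 * ci x y t) + 2 * y * (cos t ^ 0 * cr x y t))
                   0 (PI / 2) (si x y (PI / 2) - si x y 0)).
    { apply FTC; intros t; unfold si, cr, ci, ch, sh; auto_derive; auto. simpl pow. field. }
    pose proof (is_RInt_uniq _ _ _ _ _ H1 H2). lra.
Qed.

Definition wallis (n : nat) : R := Jr 0 0 n.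

Lemma is_RInt_wallis (n : nat) : is_RInt (fun t => cos t ^ n) 0 (PI / 2) (wallis n).
Proof.
  apply (is_RInt_ext (fun t => cos t ^ n * cr 0 0 t)); [|apply is_RInt_Jr].
  intros t _. unfold cr, ch. rewrite !Rmult_0_r, !Rmult_0_l, Ropp_0, cos_0, exp_0.
  match goal with |- ?a = ?b => change (@eq R a b) end. field.
Qed.

Lemma wallis_rec (n : nat) : INR (S (S n)) * wallis (S (S n)) = (INR (S n)) * wallis n.
Proof.
  pose proof (Jr_rec 0 0 n) as H. cbv zeta in H.
  change (Jr 0 0 (S (S n))) with (wallis (S (S n))) in H.
  change (Jr 0 0 n) with (wallis n) in H.
  rewrite (S_INR (S n)) in *. pose proof (pos_INR (S n)).
  apply Rmult_eq_reg_l with (INR (S n) + 1); [|lra].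
  ring_simplify in H. ring_simplify. lra.
Qed.

Lemma wallis_0 : wallis 0 = PI / 2.
Proof.
  apply (is_RInt_uniq (fun t => cos t ^ 0) 0 (PI / 2)); [apply is_RInt_wallis|].
  replace (PI / 2) with (scal (PI / 2 - 0) 1) at 2
    by (unfold scal; simpl; unfold mult; simpl; ring).
  apply (is_RInt_const (V := R_NormedModule) 0 (PI / 2) 1).
Qed.

Lemma wallis_even_pos (n : nat) : 0 < wallis (2 * n).
Proof.
  induction n as [|n IH].
  - simpl. rewrite wallis_0. pose proof PI_RGT_0. lra.
  - replace (2 * S n)%nat with (S (S (2 * n))) by lia.
    pose proof (wallis_rec (2 * n)) as H.
    assert (0 < INR (S (2 * n))) by (apply lt_0_INR; lia).
    assert (0 < INR (S (S (2 * n)))) by (apply lt_0_INR; lia).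
    nra.
Qed.

Lemma x_cos_le_sin (t : R) : 0 <= t <= PI / 2 -> t * cos t <= sin t.
Proof.
  intros Ht. pose proof PI_RGT_0 as Hpi.
  destruct (MVT_gen (fun t => sin t - t * cos t) 0 t (fun t => t * sin t)) as (c & Hc & E).
  - intros u _. auto_derive; auto. ring.
  - intros u _. apply continuity_pt_filterlim.
    apply (ex_derive_continuous (K := R_AbsRing) (V := R_NormedModule) (fun t => sin t - t * cos t)).
    auto_derive; auto.
  - rewrite Rmin_left, Rmax_right in Hc by lra. rewrite sin_0 in E.
    assert (0 <= sin c) by (apply sin_ge_0; lra).
    assert (0 <= c * sin c * (t - 0)) by (apply Rmult_le_pos; [apply Rmult_le_pos|]; lra).
    lra.
Qed.

Lemma exp_le_mono (a b : R) : a <= b -> exp a <= exp b.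
Proof. intros [H | ->]; [left; now apply exp_increasing | lra]. Qed.

Definition Jbound (x y : R) : R := 2 * (x ^ 2 + (y * exp (2 * Rabs y)) ^ 2).

(* [1 - cos (2 w) = 2 (sin w)^2] and [|sin (p + i q)|^2 = (sin p)^2 + (sh q)^2]. *)
Lemma cr_ci_bound (x y t : R) : 0 <= t <= 2 ->
  Rabs (cr x y t - 1) <= Jbound x y * (t * t) /\ Rabs (ci x y t) <= Jbound x y * (t * t).
Proof.
  intros Ht. unfold cr, ci, Jbound.
  replace (2 * x * t) with (2 * (x * t)) by ring. replace (2 * y * t) with (2 * (y * t)) by ring.
  assert (A : Rabs (sin (x * t)) <= Rabs (x * t)) by apply sin_abs_le.
  assert (B : Rabs (sh (y * t)) <= Rabs (y * exp (2 * Rabs y) * t)).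
  { eapply Rle_trans; [apply sh_abs_le|].
    replace (y * exp (2 * Rabs y) * t) with (y * t * exp (2 * Rabs y)) by ring.
    rewrite (Rabs_mult (y * t) (exp _)), (Rabs_pos_eq (exp _)) by (left; apply exp_pos).
    apply Rmult_le_compat_l; [apply Rabs_pos|]. apply exp_le_mono.
    rewrite Rabs_mult, (Rabs_pos_eq t) by lra. pose proof (Rabs_pos y). nra. }
  apply Rsqr_le_abs_1 in A, B. unfold Rsqr in A, B.
  pose proof (ch_minus_1 (2 * (y * t))) as H1. replace (2 * (y * t) / 2) with (y * t) in H1 by field.
  assert (H3 : ch (y * t) * ch (y * t) = 1 + sh (y * t) * sh (y * t)).
  { unfold ch, sh. assert (E : exp (y * t) * exp (- (y * t)) = 1)
      by (rewrite <- exp_plus, <- exp_0; f_equal; ring). nra. }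
  assert (H4 : sh (2 * (y * t)) = 2 * sh (y * t) * ch (y * t)).
  { unfold ch, sh. replace (- (2 * (y * t))) with (- (y * t) + - (y * t)) by ring.
    replace (2 * (y * t)) with (y * t + y * t) by ring. rewrite !exp_plus. field. }
  rewrite H4, sin_2a. replace (ch (2 * (y * t))) with (1 + 2 * (sh (y * t) * sh (y * t))) by lra.
  rewrite cos_2a_sin. pose proof (sin2_cos2 (x * t)) as H5. unfold Rsqr in H5.
  set (a := sin (x * t)) in *. set (c := cos (x * t)) in *.
  set (h := sh (y * t)) in *. set (k := ch (y * t)) in *. clearbody a c h k.
  assert (S : 2 * (a * a + h * h) <= 2 * (x ^ 2 + (y * exp (2 * Rabs y)) ^ 2) * (t * t)) by nra.
  assert (Ha : 0 <= a * a <= 1) by nra. assert (Hh : 0 <= h * h) by nra.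
  split; apply Rabs_le.
  - assert (0 <= (a * a) * (h * h) <= h * h) by nra. split; nra.
  - pose proof (Rle_0_sqr (a * k - c * h)) as P1. pose proof (Rle_0_sqr (a * k + c * h)) as P2.
    unfold Rsqr in P1, P2.
    assert (E : (a * k) * (a * k) + (c * h) * (c * h) = a * a + h * h).
    { replace (a * k * (a * k)) with (a * a * (k * k)) by ring. rewrite H3.
      replace (c * h * (c * h)) with ((1 - a * a) * (h * h)) by (rewrite <- H5; ring). ring. }
    split; lra.
Qed.

Lemma is_RInt_abs_le (f g : R -> R) (b F G : R) : 0 <= b ->
  is_RInt f 0 b F -> is_RInt g 0 b G ->
  (forall t, 0 < t < b -> Rabs (f t) <= g t) -> Rabs F <= G.
Proof.
  intros Hb HF HG H. apply Rabs_le. split.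
  - apply (is_RInt_le (fun t => - g t) f 0 b); auto.
    + now apply (is_RInt_opp (V := R_NormedModule)).
    + intros t Ht. specialize (H t Ht). pose proof (Rle_abs (- f t)) as L. rewrite Rabs_Ropp in L. lra.
  - apply (is_RInt_le f g 0 b); auto.
    intros t Ht. specialize (H t Ht). pose proof (Rle_abs (f t)). lra.
Qed.

(** From t cos t <= sin t one gets t^2 cos(t)^2 <= 1 - cos(t)^2, so an error of order t^2 under the
    weight cos(t)^(n+2) integrates to at most a difference of Wallis integrals. *)
Lemma cos_weight_bound (c t : R) (n : nat) (C : R) : 0 <= C -> 0 < t < PI / 2 ->
  Rabs c <= C * (t * t) ->
  Rabs (cos t ^ S (S n) * c) <= C * (cos t ^ n) + (- C) * cos t ^ S (S n).
Proof.
  intros HC Ht Hc.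
  assert (K1 : 0 <= cos t) by (apply cos_ge_0; pose proof PI_RGT_0; lra).
  assert (K2 : 0 <= cos t ^ n) by (apply pow_le; auto).
  assert (K3 := x_cos_le_sin t ltac:(lra)).
  assert (K4 : (t * cos t) * (t * cos t) <= sin t * sin t).
  { apply Rmult_le_compat; auto; apply Rmult_le_pos; lra. }
  rewrite sin_sqr in K4.
  rewrite Rabs_mult, Rabs_pos_eq by (apply pow_le; auto).
  simpl pow.
  apply Rle_trans with (cos t * (cos t * cos t ^ n) * (C * (t * t))).
  - apply Rmult_le_compat_l; auto. apply Rmult_le_pos; auto. now apply Rmult_le_pos.
  - replace (cos t * (cos t * cos t ^ n) * (C * (t * t))) with
      ((C * cos t ^ n) * ((t * cos t) * (t * cos t))) by ring.
    replace (C * cos t ^ n + - C * (cos t * (cos t * cos t ^ n))) with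
      ((C * cos t ^ n) * (1 - cos t * cos t)) by ring.
    apply Rmult_le_compat_l; auto. now apply Rmult_le_pos.
Qed.

Lemma Jbound_nonneg (x y : R) : 0 <= Jbound x y.
Proof.
  unfold Jbound. pose proof (pow2_ge_0 x). pose proof (pow2_ge_0 (y * exp (2 * Rabs y))). lra.
Qed.

(** The weight cos(t)^n concentrates near t = 0, where cos(2 z t) = 1 + O(t^2). This is what forces
    the quotient of J_n by the Wallis integral towards 1. *)
Lemma J_close (x y : R) (n : nat) :
  Rabs (Jr x y (S (S n)) - wallis (S (S n))) <= Jbound x y * (wallis n - wallis (S (S n))) /\
  Rabs (Ji x y (S (S n))) <= Jbound x y * (wallis n - wallis (S (S n))).
Proof.
  pose proof (Jbound_nonneg x y) as HC. pose proof PI_RGT_0 as Hpi. pose proof PI_4 as Hpi4.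
  assert (HG : is_RInt (fun t => Jbound x y * cos t ^ n + (- Jbound x y) * cos t ^ S (S n))
                 0 (PI / 2) (Jbound x y * (wallis n - wallis (S (S n))))).
  { replace (Jbound x y * (wallis n - wallis (S (S n)))) with
      (Jbound x y * wallis n + (- Jbound x y) * wallis (S (S n))) by ring.
    apply is_RInt_lin2; apply is_RInt_wallis. }
  split.
  - apply (is_RInt_abs_le (fun t => 1 * (cos t ^ S (S n) * cr x y t) + (- (1)) * cos t ^ S (S n))
             _ (PI / 2) _ _ ltac:(lra)) with (2 := HG).
    + replace (Jr x y (S (S n)) - wallis (S (S n))) with
        (1 * Jr x y (S (S n)) + (- (1)) * wallis (S (S n))) by ring.
      apply is_RInt_lin2; [apply is_RInt_Jr | apply is_RInt_wallis].
    + intros t Ht.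
      replace (1 * (cos t ^ S (S n) * cr x y t) + - (1) * cos t ^ S (S n)) with
        (cos t ^ S (S n) * (cr x y t - 1)) by ring.
      apply cos_weight_bound; auto. apply cr_ci_bound; lra.
  - apply (is_RInt_abs_le (fun t => cos t ^ S (S n) * ci x y t)
             _ (PI / 2) _ _ ltac:(lra)) with (2 := HG).
    + apply is_RInt_Ji.
    + intros t Ht. apply cos_weight_bound; auto. apply cr_ci_bound; lra.
Qed.

Open Scope C_scope.

Lemma Cmult_eq_reg_l (c x y : C) : c * x = c * y -> c <> 0 -> x = y.
Proof.
  intros E H. rewrite <- (Cmult_1_l x), <- (Cmult_1_l y), <- (Cinv_l c H).
  now rewrite <- !Cmult_assoc, E.
Qed.

Definition Jc (z : C) (n : nat) : C := (Jr (Re z) (Im z) n, Ji (Re z) (Im z) n).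

Lemma Jc_rec (z : C) (n : nat) : let m := RtoC (INR (S (S n))) in
  (m * m - 4 * (z * z)) * Jc z (S (S n)) = m * (m - 1) * Jc z n.
Proof.
  pose proof (Jr_rec (Re z) (Im z) n) as H1. pose proof (Ji_rec (Re z) (Im z) n) as H2.
  cbv zeta in *. destruct z as [x y]. unfold Jc. cbn [Re Im fst snd] in *.
  set (m := INR (S (S n))) in *. clearbody m.
  set (a := Jr x y (S (S n))) in *. set (b := Ji x y (S (S n))) in *.
  set (c := Jr x y n) in *. set (d := Ji x y n) in *. clearbody a b c d.
  unfold RtoC, Cmult, Cminus, Cplus, Copp; simpl. f_equal; lra.
Qed.

Lemma Csin_PI (z : C) :
  Csin (PI * z) = ((sin (PI * Re z) * ch (PI * Im z))%R, (cos (PI * Re z) * sh (PI * Im z))%R).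
Proof.
  destruct z as [x y]. unfold Csin, Cexp, ch, sh.
  replace (Ci * (PI * (x, y))) with ((- (PI * y))%R, (PI * x)%R).
  2: { unfold Ci, RtoC, Cmult; simpl; f_equal; ring. }
  unfold Copp; simpl. rewrite sin_neg, cos_neg, Ropp_involutive.
  unfold Cdiv. replace (/ (2 * Ci)) with ((0, - / 2)%R : C).
  - unfold Cminus, Cplus, Copp, Cmult; simpl. f_equal; field.
  - apply Cmult_eq_reg_l with (2 * Ci).
    + rewrite Cinv_r; [|apply Cmult_neq_0; [|exact Ci_nz]; intros E; apply RtoC_inj in E; lra].
      unfold Ci, RtoC, Cmult; simpl. f_equal; field.
    + apply Cmult_neq_0; [|exact Ci_nz]. intros E; apply RtoC_inj in E; lra.
Qed.

Definition sin_partial (N : nat) (z : C) : C :=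
  z * (Crising (1 - z) N * Crising (1 + z) N) / (Cfact N * Cfact N).

(** The recursions for J and for the Wallis integrals differ exactly by the factor 1 - z^2 / k^2 at
    index 2 k, so the left-hand side is independent of N; at N = 0 it is computed from [J_0] and W_0
    = pi / 2. *)
Lemma sin_partial_Jc (z : C) (N : nat) :
  sin_partial N z * (Jc z (2 * N) / wallis (2 * N)) = Csin (PI * z) / PI.
Proof.
  assert (W : forall n, RtoC (wallis (2 * n)) <> 0).
  { intros n E. apply RtoC_inj in E. pose proof (wallis_even_pos n). lra. }
  assert (P0 : RtoC PI <> 0) by (intros E; apply RtoC_inj in E; pose proof PI_RGT_0; lra).
  assert (T0 : RtoC 2 <> 0) by (intros E; apply RtoC_inj in E; lra).
  induction N as [|N IH].
  - unfold sin_partial, Cfact. simpl (2 * 0)%nat. rewrite wallis_0. cbn [Crising fact INR].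
    assert (E : 2 * (z * Jc z 0) = Csin (PI * z)).
    { rewrite Csin_PI. destruct (J_0 (Re z) (Im z)) as [<- <-].
      destruct z as [x y]; unfold Jc, RtoC, Cmult; simpl. f_equal; ring. }
    rewrite <- E, RtoC_div by lra. field. auto.
  - rewrite <- IH. specialize (W N) as W0. specialize (W (S N)) as W1.
    replace (2 * S N)%nat with (S (S (2 * N))) in * by lia.
    pose proof (Jc_rec z (2 * N)) as H. cbv zeta in H.
    pose proof (wallis_rec (2 * N)) as HW. apply (f_equal RtoC) in HW.
    rewrite !RtoC_mult in HW.
    replace (RtoC (INR (S (S (2 * N))))) with (2 * (INR N + 1)) in H, HW.
    2: { rewrite !INR_C_S, mult_INR, RtoC_mult. simpl (INR 2). ring_simplify.
         replace (RtoC (1 + 1)) with (RtoC 2) by (f_equal; ring). ring. }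
    replace (RtoC (INR (S (2 * N)))) with (2 * INR N + 1) in HW.
    2: { rewrite !INR_C_S, mult_INR, RtoC_mult. simpl (INR 2).
         replace (RtoC (1 + 1)) with (RtoC 2) by (f_equal; ring). ring. }
    unfold sin_partial. rewrite !Crising_S, Cfact_S.
    assert (F := Cfact_nz N).
    assert (N1 : INR N + 1 <> 0) by (rewrite <- INR_C_S; apply INR_C_nz).
    assert (N2 : 2 * INR N + 1 <> 0).
    { replace (2 * INR N + 1) with (INR N + INR (S N)) by (rewrite INR_C_S; ring).
      rewrite Cplus_comm. apply INR_C_plus_nz; lia. }
    set (w1 := RtoC (wallis (S (S (2 * N))))) in *. set (w0 := RtoC (wallis (2 * N))) in *.
    set (j1 := Jc z (S (S (2 * N)))) in *. set (j0 := Jc z (2 * N)) in *.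
    set (n := RtoC (INR N)) in *.
    assert (Ew : w0 = 2 * (n + 1) * w1 / (2 * n + 1)) by (rewrite HW; field; auto).
    assert (Ej : j0 = ((n + 1) * (n + 1) - z * z) * 2 * j1 / ((n + 1) * (2 * n + 1))).
    { apply Cmult_eq_reg_l with (2 * (n + 1) * (2 * (n + 1) - 1)).
      - rewrite <- H. field; auto.
      - replace (2 * (n + 1) - 1) with (2 * n + 1) by ring.
        repeat apply Cmult_neq_0; auto. }
    rewrite Ew, Ej. field. repeat split; auto.
Qed.

Lemma Clim_sin_partial (z : C) : Clim (fun N => sin_partial N z) (Csin (PI * z) / PI).
Proof.
  assert (HJ : Clim (fun N => Jc z (2 * N) / wallis (2 * N)) 1).
  { apply (proj1 (Clim_incr_1 (fun N => Jc z (2 * N) / wallis (2 * N)) 1)).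
    pose proof (Jbound_nonneg (Re z) (Im z)) as HC.
    set (K := Jbound (Re z) (Im z)) in *.
    apply Clim_le with (fun n => (2 * K * / INR (S n))%R).
    - exists O; intros n _. replace (2 * S n)%nat with (S (S (2 * n))) by lia.
      pose proof (wallis_even_pos n) as W0. pose proof (wallis_even_pos (S n)) as W1.
      replace (2 * S n)%nat with (S (S (2 * n))) in W1 by lia.
      pose proof (wallis_rec (2 * n)) as HW.
      destruct (J_close (Re z) (Im z) (2 * n)) as [H1 H2]. fold K in H1, H2.
      set (w1 := wallis (S (S (2 * n)))) in *. set (w0 := wallis (2 * n)) in *.
      assert (Nw : RtoC w1 <> 0) by (intros E; apply RtoC_inj in E; lra).
      replace (Jc z (S (S (2 * n))) / w1 - 1) with ((Jc z (S (S (2 * n))) - w1) / w1)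
        by (field; auto).
      rewrite Cmod_div, Cmod_R, Rabs_pos_eq by (auto; lra).
      assert (HR : (0 < INR (S (2 * n)))%R) by (apply lt_0_INR; lia).
      rewrite (S_INR (S (2 * n))) in HW.
      assert (HS : (INR (S n) <= INR (S (2 * n)))%R) by (apply le_INR; lia).
      assert (HS0 : (0 < INR (S n))%R) by (apply lt_0_INR; lia).
      set (q := INR (S (2 * n))) in *.
      (* The Wallis recursion makes the difference of neighbours smaller than w1 by the factor q = 2
         n + 1, which is the decay that is needed. *)
      assert (D : (w0 - w1 = w1 * / q)%R).
      { apply Rmult_eq_reg_l with q; [|lra].
        replace (q * (w1 * / q))%R with w1 by (field; lra). lra. }
      assert (B : (Cmod (Jc z (S (S (2 * n))) - w1) <= 2 * (K * (w1 * / q)))%R).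
      { eapply Rle_trans; [apply Cmod_le_abs|]. rewrite <- D.
        change (Rabs (Jr (Re z) (Im z) (S (S (2 * n))) - w1) +
          Rabs (Ji (Re z) (Im z) (S (S (2 * n))) - 0) <= 2 * (K * (w0 - w1)))%R.
        rewrite Rminus_0_r. lra. }
      apply Rle_trans with (2 * (K * (w1 * / q)) / w1)%R.
      + apply Rmult_le_compat_r; auto. apply Rlt_le, Rinv_0_lt_compat; lra.
      + replace (2 * (K * (w1 * / q)) / w1)%R with (2 * K * / q)%R by (field; lra).
        apply Rmult_le_compat_l; [lra|]. apply Rinv_le_contravar; auto.
    - apply (is_lim_seq_incr_1 (fun n => 2 * K * / INR n)%R).
      replace (Finite 0) with (Rbar_mult (2 * K)%R 0%R) by (simpl; f_equal; ring).
      apply is_lim_seq_scal_l.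
      replace (Finite 0) with (Rbar_inv p_infty) by reflexivity.
      apply is_lim_seq_inv; [apply is_lim_seq_INR | discriminate]. }
  assert (HI := Clim_inv _ _ C1_nz HJ).
  destruct (proj1 (Clim_spec _ _) HJ 1%R ltac:(lra)) as [N0 HN0].
  apply (Clim_ext_loc (fun N => Csin (PI * z) / PI * / (Jc z (2 * N) / wallis (2 * N)))).
  - exists N0; intros n Hn. rewrite <- (sin_partial_Jc z n).
    specialize (HN0 n Hn).
    assert (Nz : Jc z (2 * n) / wallis (2 * n) <> 0).
    { intros E. rewrite E in HN0. replace (0 - 1) with (- (1)) in HN0 by ring.
      rewrite Cmod_m1 in HN0. lra. }
    rewrite <- Cmult_assoc, Cinv_r by auto. ring.
  - eapply Clim_eq; [apply (Clim_scal (Csin (PI * z) / PI)), HI|].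
    field. intros E; apply RtoC_inj in E; pose proof PI_RGT_0; lra.
Qed.

(** * Euler's limit for the gamma function *)

(** The partial products are bounded by |p 0| exp(sum of d), hence the increments p n (q n - 1) are
    absolutely summable. *)
Lemma infinite_product (p q : nat -> C) (d : nat -> R) :
  (forall n, p (S n) = p n * q n) -> ex_series d ->
  (forall n, (Cmod (q n - 1) <= d n)%R) -> exists L, Clim p L.
Proof.
  intros Hp Hd Hq.
  assert (d0 : forall n, (0 <= d n)%R).
  { intros n. eapply Rle_trans; [apply Cmod_ge_0 | apply Hq]. }
  assert (Hb : forall n, (Cmod (p n) <= Cmod (p O) * exp (Rsum d n))%R).
  { induction n as [|n IH].
    - simpl. rewrite exp_0. lra.
    - rewrite Hp, Cmod_mult. simpl. rewrite exp_plus, <- Rmult_assoc.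
      apply Rmult_le_compat; auto using Cmod_ge_0.
      replace (q n) with (1 + (q n - 1)) by ring.
      eapply Rle_trans; [apply Cmod_triangle|]. rewrite Cmod_1.
      pose proof (exp_ineq1_le (d n)). pose proof (Hq n). lra. }
  set (M := (Cmod (p O) * exp (Series d))%R).
  assert (HM : forall n, (Cmod (p n) <= M)%R).
  { intros n. eapply Rle_trans; [apply Hb|]. apply Rmult_le_compat_l; [apply Cmod_ge_0|].
    apply exp_le_mono, Rsum_le_Series; auto. }
  destruct (abs_conv (fun i => p i * (q i - 1)) (fun i => M * d i)%R) as [L HL].
  - exact (ex_series_scal (V := R_NormedModule) M d Hd).
  - intros i. rewrite Cmod_mult. apply Rmult_le_compat; auto using Cmod_ge_0.
  - exists (p O + L). apply Clim_ext with (2 := Clim_plus _ _ _ _ (Clim_const (p O)) HL).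
    intros n. rewrite (Csum_telescope _ p); [ring|]. intros i _. rewrite Hp; ring.
Qed.

(** The reciprocals form a product of the same kind, with deviations at most 2 d because |q n| >=
    1/2. Both products converge and their limits multiply to 1. *)
Lemma infinite_product_nz (p q : nat -> C) (d : nat -> R) :
  p O <> 0 -> (forall n, p (S n) = p n * q n) -> ex_series d ->
  (forall n, (Cmod (q n - 1) <= d n)%R) -> (forall n, (d n <= / 2)%R) ->
  exists L : C, L <> 0 /\ Clim p L.
Proof.
  intros P0 Hp Hd Hq Hd2.
  assert (Q : forall n, (/ 2 <= Cmod (q n))%R).
  { intros n. pose proof (Cmod_triangle (q n) (- (q n - 1))) as T.
    rewrite Cmod_opp in T. replace (q n + - (q n - 1)) with (RtoC 1) in T by ring.
    rewrite Cmod_1 in T. pose proof (Hq n). pose proof (Hd2 n). lra. }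
  assert (Qnz : forall n, q n <> 0) by (intros n; apply Cmod_gt_0; pose proof (Q n); lra).
  assert (Pnz : forall n, p n <> 0).
  { induction n as [|n IH]; auto. rewrite Hp. now apply Cmult_neq_0. }
  destruct (infinite_product p q d Hp Hd Hq) as [L HL].
  destruct (infinite_product (fun n => / p n) (fun n => / q n) (fun n => 2 * d n)%R) as [L' HL'].
  - intros n. rewrite Hp. field; auto.
  - exact (ex_series_scal (V := R_NormedModule) 2 d Hd).
  - intros n. replace (/ q n - 1) with (- ((q n - 1) / q n)) by (field; auto).
    rewrite Cmod_opp, Cmod_div by auto. unfold Rdiv. rewrite Rmult_comm.
    apply Rmult_le_compat; auto using Cmod_ge_0.
    + apply Rlt_le, Rinv_0_lt_compat. pose proof (Q n); lra.
    + replace 2%R with (/ / 2)%R by field. apply Rinv_le_contravar; auto; lra.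
  - exists L; split; auto. intros E. rewrite E in HL.
    apply C1_nz. apply (Clim_unique (fun n => p n * / p n)).
    + apply Clim_ext with (2 := Clim_const 1). intros n. rewrite Cinv_r; auto.
    + rewrite <- (Cmult_0_l L'). now apply Clim_mult.
Qed.

Lemma Cexp_plus (z w : C) : Cexp (z + w) = Cexp z * Cexp w.
Proof.
  destruct z as [a b], w as [c d]. unfold Cexp, Cmult; simpl.
  rewrite exp_plus, cos_plus, sin_plus. f_equal; ring.
Qed.

Lemma Cexp_0 : Cexp 0 = 1.
Proof. unfold Cexp; simpl. rewrite exp_0, cos_0, sin_0. unfold RtoC. f_equal; ring. Qed.

Lemma Cexp_nz (z : C) : Cexp z <> 0.
Proof.
  intros E. apply C1_nz. rewrite <- Cexp_0. replace (RtoC 0) with (z + - z) by ring.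
  rewrite Cexp_plus, E. ring.
Qed.

Lemma exp_taylor (x : R) : (Rabs x <= / 2)%R -> (0 <= exp x - 1 - x <= 2 * (x * x))%R.
Proof.
  intros H. apply Rabs_le_between in H.
  pose proof (exp_ineq1_le x). pose proof (exp_ineq1_le (- x)) as E.
  split; [lra|].
  assert (exp x * exp (- x) = 1)%R by (rewrite <- exp_plus, <- exp_0; f_equal; ring).
  pose proof (exp_pos x).
  assert (exp x * (1 - x) <= 1)%R by nra.
  assert ((1 + x + 2 * (x * x)) * (1 - x) >= 1)%R by nra.
  assert (exp x <= 1 + x + 2 * (x * x))%R; [|lra].
  apply Rmult_le_reg_r with (1 - x)%R; lra.
Qed.

Lemma cos_taylor (y : R) : (Rabs (cos y - 1) <= y * y / 2)%R.
Proof.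
  replace (cos y - 1)%R with (- (2 * (sin (y / 2) * sin (y / 2))))%R.
  2: { replace (cos y) with (cos (2 * (y / 2))) by (f_equal; field).
       rewrite cos_2a_sin. ring. }
  rewrite Rabs_Ropp.
  pose proof (sin_abs_le (y / 2)) as H. pose proof (Rabs_pos (sin (y / 2))).
  rewrite !Rabs_mult, (Rabs_pos_eq 2) by lra.
  assert (K : (Rabs (sin (y / 2)) * Rabs (sin (y / 2)) <= Rabs (y / 2) * Rabs (y / 2))%R)
    by (apply Rmult_le_compat; auto).
  rewrite <- Rabs_mult, <- Rabs_mult, (Rabs_pos_eq (y / 2 * (y / 2))) in K by nra.
  rewrite <- Rabs_mult. nra.
Qed.

Lemma sin_taylor (y : R) : (Rabs y <= 1)%R -> (Rabs (sin y - y) <= y * y / 2)%R.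
Proof.
  assert (K : forall t, (0 <= t <= 1)%R -> (Rabs (sin t - t) <= t * t / 2)%R).
  { intros t Ht. pose proof PI2_3_2.
    pose proof (x_cos_le_sin t ltac:(lra)) as H1.
    pose proof (cos_taylor t) as H2. apply Rabs_le_between in H2.
    pose proof (sin_abs_le t) as H3. rewrite (Rabs_pos_eq t) in H3 by lra.
    apply Rabs_le_between in H3.
    apply Rabs_le. nra. }
  intros H. destruct (Rle_or_lt 0 y).
  - apply K. rewrite Rabs_pos_eq in H; lra.
  - rewrite Rabs_left in H by auto.
    replace (sin y - y)%R with (- (sin (- y) - - y))%R by (rewrite sin_neg; ring).
    rewrite Rabs_Ropp. replace (y * y / 2)%R with (- y * - y / 2)%R by field.
    apply K; lra.
Qed.

Lemma Cexp_taylor (w : C) : (Cmod w <= / 2)%R ->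
  (Cmod (Cexp w - 1 - w) <= 4 * (Cmod w * Cmod w))%R.
Proof.
  intros H. pose proof (re_le_Cmod w) as H1.
  assert (H2 : (Rabs (Im w) <= Cmod w)%R).
  { eapply Rle_trans; [|apply Rmax_Cmod]. apply Rmax_r. }
  pose proof (Cmod2_alt w) as HN.
  destruct w as [x y]. cbn [Re Im fst snd] in *.
  pose proof (exp_taylor x ltac:(lra)) as A.
  pose proof (cos_taylor y) as B. pose proof (sin_taylor y ltac:(lra)) as D.
  eapply Rle_trans; [apply Cmod_le_abs|].
  change (Rabs (exp x * cos y - 1 - x) + Rabs (exp x * sin y - 0 - y)
    <= 4 * (Cmod (x, y) * Cmod (x, y)))%R.
  replace (Cmod (x, y) * Cmod (x, y))%R with (x * x + y * y)%R by nra.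
  assert (Hx : (Rabs x <= / 2)%R) by lra. assert (Hy : (Rabs y <= / 2)%R) by lra.
  assert (E1 : (Rabs (exp x * cos y - 1 - x) <= 2 * (x * x) + y * y)%R).
  { replace (exp x * cos y - 1 - x)%R with ((exp x - 1 - x) * cos y + (1 + x) * (cos y - 1))%R by ring.
    eapply Rle_trans; [apply Rabs_triang|]. rewrite !Rabs_mult.
    apply Rabs_le_between in Hx. pose proof (COS_bound y) as HC.
    assert (Rabs (cos y) <= 1)%R by (apply Rabs_le; lra).
    rewrite (Rabs_pos_eq (exp x - 1 - x)), (Rabs_pos_eq (1 + x)) by lra.
    pose proof (Rabs_pos (cos y)). pose proof (Rabs_pos (cos y - 1)). nra. }
  assert (E2 : (Rabs (exp x * sin y - 0 - y) <= 2 * (Rabs x * Rabs y) + y * y / 2)%R).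
  { replace (exp x * sin y - 0 - y)%R with ((exp x - 1) * sin y + (sin y - y))%R by ring.
    eapply Rle_trans; [apply Rabs_triang|]. rewrite !Rabs_mult.
    apply Rplus_le_compat; auto. rewrite <- Rmult_assoc.
    apply Rmult_le_compat; auto using Rabs_pos; [|apply sin_abs_le].
    replace (exp x - 1)%R with ((exp x - 1 - x) + x)%R by ring.
    eapply Rle_trans; [apply Rabs_triang|]. rewrite (Rabs_pos_eq (exp x - 1 - x)) by lra.
    assert (x * x <= / 2 * Rabs x)%R.
    { rewrite <- (Rabs_pos_eq (x * x)) by nra. rewrite Rabs_mult.
      apply Rmult_le_compat_r; auto using Rabs_pos. }
    lra. }
  assert (E3 : (2 * (Rabs x * Rabs y) <= x * x + y * y)%R).
  { assert (X2 : (x * x = Rabs x * Rabs x)%R) by (rewrite <- Rabs_mult, Rabs_pos_eq; nra).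
    assert (Y2 : (y * y = Rabs y * Rabs y)%R) by (rewrite <- Rabs_mult, Rabs_pos_eq; nra).
    pose proof (Rle_0_sqr (Rabs x - Rabs y)) as S. unfold Rsqr in S. lra. }
  nra.
Qed.

Definition euler_gamma (z : C) (n : nat) : C :=
  INR (fact n) * Cexp (z * ln (INR n)) / Crising z (S n).

Lemma ln_step (n : nat) : (0 < n)%nat ->
  (/ INR (S n) <= ln (INR (S n)) - ln (INR n) <= / INR n)%R.
Proof.
  intros Hn. assert (H : (0 < INR n)%R) by (apply lt_0_INR; lia).
  rewrite S_INR. set (x := INR n) in *.
  assert (K : forall t, (0 < t)%R -> (ln t <= t - 1)%R).
  { intros t Ht. pose proof (exp_ineq1_le (ln t)) as E. rewrite exp_ln in E by auto. lra. }
  split.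
  - rewrite <- (Ropp_involutive (ln (x + 1) - ln x)), Ropp_minus_distr, <- ln_div by lra.
    pose proof (K (x / (x + 1))%R ltac:(apply Rdiv_lt_0_compat; lra)) as L.
    replace (x / (x + 1) - 1)%R with (- / (x + 1))%R in L by (field; lra). lra.
  - rewrite <- ln_div by lra.
    pose proof (K ((x + 1) / x)%R ltac:(apply Rdiv_lt_0_compat; lra)) as L.
    replace ((x + 1) / x - 1)%R with (/ x)%R in L by (field; lra). lra.
Qed.

Lemma gamma_defined_nz (z : C) (n : nat) : gamma_defined z -> z + INR n <> 0.
Proof.
  intros H E. apply (H n). replace z with ((z + INR n) - INR n) by ring. rewrite E; ring.
Qed.

Lemma euler_gamma_ratio (z : C) (n : nat) : gamma_defined z ->
  euler_gamma z (S n) = euler_gamma z n *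
    (INR (S n) * Cexp (z * (ln (INR (S n)) - ln (INR n))%R) / (z + INR (S n))).
Proof.
  intros Hz. unfold euler_gamma.
  replace (z * ln (INR (S n))) with (z * ln (INR n) + z * (ln (INR (S n)) - ln (INR n))%R)
    by (rewrite RtoC_minus; ring).
  rewrite Cexp_plus, (Crising_S z (S n)), fact_simpl, mult_INR, RtoC_mult.
  field. split; [apply gamma_defined_nz; auto|].
  apply Crising_nz; intros i _; now apply gamma_defined_nz.
Qed.

(** The first-order terms cancel: exp(z h) - 1 equals z h up to order h^2, and h = ln((n + 1) / n)
    equals 1 / (n + 1) up to 1 / n^2. The remaining factor (n + 1) / (z + n + 1) has modulus at most
    2, which doubles both constants. *)
Lemma euler_gamma_ratio_bound (z : C) (n : nat) :
  (0 < n)%nat -> (2 * Cmod z <= INR n)%R ->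
  (Cmod (INR (S n) * Cexp (z * (ln (INR (S n)) - ln (INR n))%R) / (z + INR (S n)) - 1)
   <= (8 * (Cmod z * Cmod z) + 2 * Cmod z) * / (INR n * INR n))%R.
Proof.
  intros Hn Hz. pose proof (ln_step n Hn) as Hh.
  assert (H0 : (0 < INR n)%R) by (apply lt_0_INR; lia).
  set (h := (ln (INR (S n)) - ln (INR n))%R) in *.
  rewrite S_INR in *. set (x := INR n) in *.
  pose proof (Cmod_ge_0 z) as Z0.
  assert (D : ((x + 1) / 2 <= Cmod (z + RtoC (x + 1)))%R).
  { pose proof (Cmod_triangle (z + RtoC (x + 1)) (- z)) as T. rewrite Cmod_opp in T.
    replace (z + RtoC (x + 1) + - z) with (RtoC (x + 1)) in T by ring.
    rewrite Cmod_R, Rabs_pos_eq in T by lra. lra. }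
  assert (Dn : z + RtoC (x + 1) <> 0) by (apply Cmod_gt_0; lra).
  assert (Xn : RtoC (x + 1) <> 0) by (intros E; apply RtoC_inj in E; lra).
  replace (RtoC (x + 1) * Cexp (z * h) / (z + RtoC (x + 1)) - 1) with
    (RtoC (x + 1) / (z + RtoC (x + 1)) *
      ((Cexp (z * h) - 1 - z * h) + z * (h - / RtoC (x + 1)))) by (field; auto).
  rewrite Cmod_mult, Cmod_div, Cmod_R, Rabs_pos_eq by (auto; lra).
  assert (I1 : (0 < / x)%R) by (apply Rinv_0_lt_compat; lra).
  assert (I2 : (0 < / (x + 1))%R) by (apply Rinv_0_lt_compat; lra).
  assert (I3 : (/ x - / (x + 1) <= / x * / x)%R).
  { replace (/ x - / (x + 1))%R with (/ x * / (x + 1))%R by (field; lra).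
    apply Rmult_le_compat_l; [lra|]. apply Rinv_le_contravar; lra. }
  assert (Mw : Cmod (z * h) = (Cmod z * h)%R) by (rewrite Cmod_mult, Cmod_R, Rabs_pos_eq; lra).
  assert (Mh : (Cmod z * h <= Cmod z * / x)%R) by (apply Rmult_le_compat_l; lra).
  assert (Mz : (Cmod z * / x <= / 2)%R).
  { apply Rmult_le_reg_r with x; auto. rewrite Rmult_assoc, Rinv_l by lra. lra. }
  assert (B1 : (Cmod (Cexp (z * h) - 1 - z * h) <= 4 * (Cmod z * Cmod z * (/ x * / x)))%R).
  { eapply Rle_trans; [apply Cexp_taylor; rewrite Mw; lra|]. rewrite Mw.
    replace (Cmod z * Cmod z * (/ x * / x))%R with ((Cmod z * / x) * (Cmod z * / x))%R by ring.
    assert (0 <= Cmod z * h)%R by (apply Rmult_le_pos; lra).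
    apply Rmult_le_compat_l; [lra|]. apply Rmult_le_compat; auto. }
  assert (B2 : (Cmod (z * (h - / RtoC (x + 1))) <= Cmod z * (/ x * / x))%R).
  { rewrite <- RtoC_inv, <- RtoC_minus, Cmod_mult, Cmod_R, Rabs_pos_eq by lra.
    apply Rmult_le_compat_l; lra. }
  assert (B3 : ((x + 1) / Cmod (z + RtoC (x + 1)) <= 2)%R).
  { apply Rmult_le_reg_r with (Cmod (z + RtoC (x + 1))); [lra|].
    unfold Rdiv. rewrite Rmult_assoc, Rinv_l by lra. lra. }
  rewrite Rinv_mult.
  replace ((8 * (Cmod z * Cmod z) + 2 * Cmod z) * (/ x * / x))%R with
    (2 * (4 * (Cmod z * Cmod z * (/ x * / x)) + Cmod z * (/ x * / x)))%R by ring.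
  apply Rmult_le_compat; auto using Cmod_ge_0.
  - apply Rlt_le, Rdiv_lt_0_compat; lra.
  - eapply Rle_trans; [apply Cmod_triangle|]. lra.
Qed.

Lemma ex_series_inv_sqr (K : R) (N : nat) : (0 <= K)%R -> (0 < N)%nat ->
  ex_series (fun n => K * / (INR (n + N) * INR (n + N)))%R.
Proof.
  intros HK HN. apply (ex_series_scal (V := R_NormedModule) K
    (fun n => / (INR (n + N) * INR (n + N)))%R).
  assert (P : forall n, (0 < INR (n + N))%R) by (intros; apply lt_0_INR; lia).
  apply ex_series_Rsum_bound with (2 * / INR (0 + N))%R.
  - intros i. pose proof (P i). apply Rlt_le, Rinv_0_lt_compat. nra.
  - intros n.
    assert (E : (Rsum (fun n => / (INR (n + N) * INR (n + N))) n
              <= 2 * / INR (0 + N) - 2 * / INR (n + N))%R).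
    { induction n as [|n IH]; [simpl; lra|].
      change (Rsum (fun n => / (INR (n + N) * INR (n + N))) n + / (INR (n + N) * INR (n + N))
              <= 2 * / INR (0 + N) - 2 * / INR (S (n + N)))%R.
      pose proof (P n) as Hp. rewrite S_INR. set (x := INR (n + N)) in *.
      assert (Hx : (1 <= x)%R) by (apply (le_INR 1); lia).
      assert (/ (x * x) <= 2 * / x - 2 * / (x + 1))%R; [|lra].
      replace (2 * / x - 2 * / (x + 1))%R with (/ (x * (x + 1) / 2))%R by (field; lra).
      apply Rinv_le_contravar; nra. }
    pose proof (P n) as Hp. apply Rinv_0_lt_compat in Hp. lra.
Qed.

Lemma Clim_shift (x : nat -> C) (N : nat) (l : C) :
  Clim (fun n => x (n + N)%nat) l -> Clim x l.
Proof. intros H. apply (is_lim_seq_incr_n (fun n => Cmod (x n - l)) N). exact H. Qed.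

Lemma Clim_euler_gamma (z : C) : gamma_defined z ->
  exists G : C, G <> 0 /\ Clim (euler_gamma z) G /\ Cgamma z = G.
Proof.
  intros Hz. set (K := (8 * (Cmod z * Cmod z) + 2 * Cmod z)%R).
  pose proof (Cmod_ge_0 z) as Z0. assert (HK : (0 <= K)%R) by (unfold K; nra).
  (* Starting at N > 2 |z| permits [euler_gamma_ratio_bound], N > 2 K + 1 keeps the deviations K /
     n^2 below 1/2, and N > 0 excludes [ln] at 0. *)
  destruct (INR_unbounded (2 * Cmod z + 2 * K + 1)) as [N HN].
  assert (N0 : (0 < N)%nat).
  { destruct N; [simpl in HN; lra | lia]. }
  destruct (infinite_product_nz (fun n => euler_gamma z (n + N))
    (fun n => INR (S (n + N)) * Cexp (z * (ln (INR (S (n + N))) - ln (INR (n + N)))%R)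
              / (z + INR (S (n + N))))
    (fun n => K * / (INR (n + N) * INR (n + N)))%R) as (L & HL & HL').
  - unfold euler_gamma. apply Cmult_neq_0; [apply Cmult_neq_0|].
    + apply Cfact_nz.
    + apply Cexp_nz.
    + assert (D : Crising z (S (0 + N)) <> 0)
        by (apply Crising_nz; intros; now apply gamma_defined_nz).
      intros E. apply C1_nz. rewrite <- (Cinv_r _ D), E. ring.
  - intros n. now apply euler_gamma_ratio.
  - now apply ex_series_inv_sqr.
  - intros n. assert (HI : (INR N <= INR (n + N))%R) by (apply le_INR; lia).
    apply euler_gamma_ratio_bound; [lia | lra].
  - intros n. assert (HI : (INR N <= INR (n + N))%R) by (apply le_INR; lia).
    set (x := INR (n + N)) in *.
    apply Rmult_le_reg_r with (x * x)%R; [nra|].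
    rewrite Rmult_assoc, Rinv_l by nra. nra.
  - apply Clim_shift in HL'. exists L; repeat split; auto.
    apply CLim_seq_unique. exact HL'.
Qed.

(** * The closed form *)

Lemma PI_C_nz : RtoC PI <> 0.
Proof. intros E; apply RtoC_inj in E. pose proof PI_RGT_0; lra. Qed.

Lemma C2_nz : RtoC 2 <> 0.
Proof. intros E; apply RtoC_inj in E; lra. Qed.

Lemma Cexp_opp (z : C) : Cexp (- z) = / Cexp z.
Proof.
  apply (Cmult_eq_reg_l (Cexp z)); [|apply Cexp_nz].
  rewrite Cinv_r by apply Cexp_nz. rewrite <- Cexp_plus, <- Cexp_0. f_equal; ring.
Qed.

Lemma Ci_sqr : Ci * Ci = - (1).
Proof. unfold Ci, RtoC, Cmult, Copp; simpl. f_equal; ring. Qed.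

Lemma Csin_plus (x y : C) : Csin (x + y) = Csin x * Ccos y + Ccos x * Csin y.
Proof.
  unfold Csin, Ccos. rewrite Cmult_plus_distr_l, !Cexp_opp, Cexp_plus.
  pose proof (Cexp_nz (Ci * x)). pose proof (Cexp_nz (Ci * y)).
  pose proof C2_nz. pose proof Ci_nz.
  field. auto.
Qed.

Lemma Ccos_plus (x y : C) : Ccos (x + y) = Ccos x * Ccos y - Csin x * Csin y.
Proof.
  unfold Csin, Ccos. rewrite Cmult_plus_distr_l, !Cexp_opp, Cexp_plus.
  pose proof (Cexp_nz (Ci * x)). pose proof (Cexp_nz (Ci * y)).
  pose proof C2_nz. pose proof Ci_nz. pose proof Ci_sqr as Q.
  set (X := Cexp (Ci * x)) in *. set (Y := Cexp (Ci * y)) in *.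
  replace ((X - / X) / (2 * Ci) * ((Y - / Y) / (2 * Ci))) with
    ((X - / X) * (Y - / Y) / (4 * (Ci * Ci))) by (field; auto).
  rewrite Q. field. auto.
Qed.

Lemma Csin_opp (x : C) : Csin (- x) = - Csin x.
Proof.
  unfold Csin. replace (Ci * - x) with (- (Ci * x)) by ring.
  rewrite !Cexp_opp. pose proof (Cexp_nz (Ci * x)). pose proof C2_nz. pose proof Ci_nz.
  field. auto.
Qed.

Lemma Ccos_opp (x : C) : Ccos (- x) = Ccos x.
Proof.
  unfold Ccos. replace (Ci * - x) with (- (Ci * x)) by ring.
  rewrite !Cexp_opp. pose proof (Cexp_nz (Ci * x)). pose proof C2_nz.
  field. auto.
Qed.

Lemma Ccos_0 : Ccos 0 = 1.
Proof.
  unfold Ccos. rewrite Cmult_0_r. replace (- 0) with (RtoC 0) by ring.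
  rewrite Cexp_0. field.
Qed.

Lemma Ccos_sqr (x : C) : Ccos x * Ccos x = 1 - Csin x * Csin x.
Proof.
  pose proof (Ccos_plus x (- x)) as H. rewrite Ccos_opp, Csin_opp in H.
  replace (x + - x) with (RtoC 0) in H by ring. rewrite Ccos_0 in H.
  rewrite H. ring.
Qed.

(** Over the common denominator and with v = u + a + b, the bracket is a trigonometric polynomial in
    pi u, pi a, pi b. It factors, modulo sin^2 + cos^2 = 1, into the three sines that the limit of
    [bprod] produces. *)
Lemma A_factor_eq (u v a b : C) : v = u + (a + b) ->
  Csin (PI * u) <> 0 -> Csin (PI * v) <> 0 ->
  A_factor u v a b =
  Csin (PI * (a + b)) * Csin (PI * (u + a)) * Csin (PI * (u + b)) /
  (PI * Csin (PI * u) * Csin (PI * v)).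
Proof.
  intros Ev Hu Hv. unfold A_factor, Ccot.
  assert (K : Csin (PI * u) * Ccos (PI * u) - Csin (PI * v) * Ccos (PI * v)
     + Ccos (PI * (a - b)) * (Ccos (PI * u) * Csin (PI * v) - Ccos (PI * v) * Csin (PI * u))
     = 2 * (Csin (PI * (a + b)) * Csin (PI * (u + a)) * Csin (PI * (u + b)))).
  { rewrite Ev. clear.
    replace (PI * (a - b)) with (PI * a + - (PI * b)) by ring.
    replace (PI * (u + (a + b))) with (PI * u + (PI * a + PI * b)) by ring.
    replace (PI * (a + b)) with (PI * a + PI * b) by ring.
    replace (PI * (u + a)) with (PI * u + PI * a) by ring.
    replace (PI * (u + b)) with (PI * u + PI * b) by ring.
    rewrite !Csin_plus, !Ccos_plus, !Csin_plus, Ccos_opp, Csin_opp.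
    pose proof (Ccos_sqr (PI * u)) as Qu. pose proof (Ccos_sqr (PI * a)) as Qa.
    pose proof (Ccos_sqr (PI * b)) as Qb.
    ring [Qu Qa Qb]. }
  pose proof PI_C_nz. pose proof C2_nz.
  apply (Cmult_eq_reg_l (2 * PI * (Csin (PI * u) * Csin (PI * v)))).
  - transitivity (2 * (Csin (PI * (a + b)) * Csin (PI * (u + a)) * Csin (PI * (u + b)))).
    + rewrite <- K. field. auto.
    + field. auto.
  - exact (Cmult_neq_0 _ _ (Cmult_neq_0 _ _ C2_nz PI_C_nz) (Cmult_neq_0 _ _ Hu Hv)).
Qed.

Lemma Cexp_ln (n : nat) : (0 < n)%nat -> Cexp (ln (INR n)) = INR n.
Proof.
  intros H. apply lt_0_INR in H. unfold Cexp; simpl.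
  rewrite exp_ln, cos_0, sin_0 by auto. unfold RtoC. f_equal; ring.
Qed.

(** At every finite level n >= 1 the two Euler quotients times the partial sine product collapse to
    n / (n + 1 - z), which tends to 1. *)
Lemma Cgamma_reflection (z : C) : gamma_defined z -> gamma_defined (1 - z) ->
  Cgamma z * Cgamma (1 - z) * (Csin (PI * z) / PI) = 1.
Proof.
  intros H1 H2.
  destruct (Clim_euler_gamma z H1) as (G1 & _ & L1 & ->).
  destruct (Clim_euler_gamma (1 - z) H2) as (G2 & _ & L2 & ->).
  apply (Clim_unique (fun n => euler_gamma z n * euler_gamma (1 - z) n * sin_partial n z)).
  - apply Clim_mult; [now apply Clim_mult | apply Clim_sin_partial].
  - apply (Clim_ext_loc (fun n => (INR n + 0) / (INR n + (1 - z)))); [|apply Clim_shift_ratio].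
    exists 1%nat; intros n Hn. unfold euler_gamma, sin_partial.
    rewrite (Crising_head z), (Crising_S (1 - z)).
    assert (E : Cexp (z * ln (INR n)) * Cexp ((1 - z) * ln (INR n)) = INR n).
    { rewrite <- Cexp_plus, <- (Cexp_ln n Hn) at 1. f_equal; ring. }
    fold (Cfact n). replace (1 + z) with (z + 1) by ring.
    assert (F := Cfact_nz n).
    assert (Z0 : z <> 0).
    { pose proof (gamma_defined_nz z 0 H1) as Q. simpl in Q. now rewrite Cplus_0_r in Q. }
    assert (D1 : Crising (z + 1) n <> 0).
    { apply Crising_nz; intros i _. replace (z + 1 + INR i) with (z + INR (S i)) by (rewrite INR_C_S; ring).
      now apply gamma_defined_nz. }
    assert (D2 : Crising (1 - z) n <> 0).
    { apply Crising_nz; intros i _. now apply gamma_defined_nz. }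
    assert (D3 : 1 - z + INR n <> 0) by (now apply gamma_defined_nz).
    assert (D4 : INR n + (1 - z) <> 0) by (rewrite Cplus_comm; auto).
    rewrite <- E at 1. field. repeat split; auto.
Qed.

(** The rising factorials regroup exactly into partial sine products and Euler quotients; the powers
    of N agree on both sides because u + v = (u + a) + (u + b). The products stand on both sides so
    that no nonvanishing of partial products at s or u + a enters. *)
Lemma bprod_euler (u v s a b : C) (N : nat) :
  v = u + s -> a + b = s -> noint u -> noint v ->
  a <> 0 -> b <> 0 -> (Cmod a <= / 2)%R -> (Cmod b <= / 2)%R ->
  gamma_defined (u + a) -> gamma_defined (u + b) ->
  bprod u v s N a b * (sin_partial N u * sin_partial N v * (sin_partial N a * sin_partial N b))
    * (euler_gamma u N * euler_gamma v N) =
  sin_partial N s * (sin_partial N (u + a) * sin_partial N (u + b))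
    * (euler_gamma (u + a) N * euler_gamma (u + b) N).
Proof.
  intros Ev Es Hu Hv Ha Hb Ma Mb Gua Gub.
  unfold bprod, sin_partial, euler_gamma. fold (Cfact N).
  rewrite !Crising_head.
  assert (E : Cexp (u * ln (INR N)) * Cexp (v * ln (INR N)) =
              Cexp ((u + a) * ln (INR N)) * Cexp ((u + b) * ln (INR N))).
  { rewrite <- !Cexp_plus. f_equal. rewrite Ev, <- Es. ring. }
  assert (Da : forall c, (Cmod c <= / 2)%R -> Crising (1 - c) N <> 0)
    by (intros; apply Crising_minus_nz; intros; now apply noint_small_nz).
  assert (Db : forall c, (Cmod c <= / 2)%R -> Crising (1 + c) N <> 0).
  { intros c Hc. replace (1 + c) with (1 - - c) by ring. apply Da. now rewrite Cmod_opp. }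
  assert (Dg : forall z, gamma_defined z -> z <> 0 /\ Crising (1 + z) N <> 0).
  { intros z Hz. split.
    - pose proof (gamma_defined_nz z 0 Hz) as Q. simpl in Q. now rewrite Cplus_0_r in Q.
    - apply Crising_plus_nz; intros i _. rewrite Cplus_comm. now apply gamma_defined_nz. }
  destruct (Dg _ Gua) as [A1 A2]. destruct (Dg _ Gub) as [B1 B2].
  assert (A3 := Da a Ma). assert (A4 := Db a Ma). assert (B3 := Da b Mb). assert (B4 := Db b Mb).
  assert (U1 : Crising (1 - u) N <> 0) by (apply Crising_noint; auto with noint).
  assert (V1 : Crising (1 - v) N <> 0) by (apply Crising_noint; auto with noint).
  assert (U2 : Crising (1 + u) N <> 0) by (apply Crising_noint; auto with noint).
  assert (V2 : Crising (1 + v) N <> 0) by (apply Crising_noint; auto with noint).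
  assert (U0 : u <> 0) by nz. assert (V0 : v <> 0) by nz.
  assert (F := Cfact_nz N).
  replace (u + 1) with (1 + u) by ring. replace (v + 1) with (1 + v) by ring.
  replace (u + a + 1) with (1 + (u + a)) by ring. replace (u + b + 1) with (1 + (u + b)) by ring.
  replace (1 - u - a) with (1 - (u + a)) by ring. replace (1 - u - b) with (1 - (u + b)) by ring.
  set (e1 := Cexp (u * ln (INR N))) in *. set (e2 := Cexp (v * ln (INR N))) in *.
  set (e3 := Cexp ((u + a) * ln (INR N))) in *. set (e4 := Cexp ((u + b) * ln (INR N))) in *.
  transitivity (e1 * e2 * (s * Crising (1 - s) N * Crising (1 + s) N / (Cfact N * Cfact N)
    * (Crising (1 - (u + a)) N * Crising (1 - (u + b)) N) / (Cfact N * Cfact N))).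
  - field. repeat split; auto.
  - rewrite E. field. repeat split; auto.
Qed.

(** The limit of [bprod_euler] determines B, since the limits multiplying it are nonzero; the
    reflection formula then replaces the sines of pi a and pi b by gamma values. *)
Lemma bprod_closed_form (u v s a b : C) (B : C) :
  v = u + s -> a + b = s -> noint u -> noint v ->
  a <> 0 -> b <> 0 -> (Cmod a <= / 2)%R -> (Cmod b <= / 2)%R ->
  Csin (PI * u) <> 0 -> Csin (PI * v) <> 0 ->
  gamma_defined a -> gamma_defined (1 - a) ->
  gamma_defined b -> gamma_defined (1 - b) ->
  gamma_defined (u + a) -> gamma_defined (u + b) ->
  gamma_defined u -> gamma_defined v ->
  Clim (fun N => bprod u v s N a b) B ->
  B = A_factor u v a b
        * (Cgamma a * Cgamma (1 - a) * Cgamma b * Cgamma (1 - b)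
           * Cgamma (u + a) * Cgamma (u + b))
        / (Cgamma u * Cgamma v).
Proof.
  intros Ev Es Hu Hv Ha Hb Ma Mb Su Sv Ga Ga' Gb Gb' Gua Gub Gu Gv HB.
  pose proof (Cgamma_reflection a Ga Ga') as Ra.
  pose proof (Cgamma_reflection b Gb Gb') as Rb.
  destruct (Clim_euler_gamma _ Gua) as (X1 & _ & L1 & ->).
  destruct (Clim_euler_gamma _ Gub) as (X2 & _ & L2 & ->).
  destruct (Clim_euler_gamma _ Gu) as (X3 & N3 & L3 & ->).
  destruct (Clim_euler_gamma _ Gv) as (X4 & N4 & L4 & ->).
  assert (E := Clim_mult _ _ _ _ (Clim_mult _ _ _ _ HB
    (Clim_mult _ _ _ _ (Clim_mult _ _ _ _ (Clim_sin_partial u) (Clim_sin_partial v))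
                       (Clim_mult _ _ _ _ (Clim_sin_partial a) (Clim_sin_partial b))))
    (Clim_mult _ _ _ _ L3 L4)).
  apply (Clim_ext _ _ _ (fun N => bprod_euler u v s a b N Ev Es Hu Hv Ha Hb Ma Mb Gua Gub)) in E.
  assert (E' := Clim_mult _ _ _ _ (Clim_mult _ _ _ _ (Clim_sin_partial s)
    (Clim_mult _ _ _ _ (Clim_sin_partial (u + a)) (Clim_sin_partial (u + b))))
    (Clim_mult _ _ _ _ L1 L2)).
  pose proof (Clim_unique _ _ _ E E') as Q. clear E E'.
  rewrite A_factor_eq by (auto; rewrite Es; auto). rewrite Es.
  pose proof PI_C_nz as P0.
  set (ga := Cgamma a * Cgamma (1 - a)) in *. set (gb := Cgamma b * Cgamma (1 - b)) in *.
  replace (ga * Cgamma b * Cgamma (1 - b)) with (ga * gb) by (unfold gb; ring).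
  assert (Z : forall p q : C, p * q = 1 -> p <> 0 /\ q <> 0).
  { intros p q Epq; split; intros E; apply C1_nz; rewrite <- Epq, E; ring. }
  destruct (Z _ _ Ra) as [Za Za']. destruct (Z _ _ Rb) as [Zb Zb'].
  assert (Sa : Csin (PI * a) / PI = / ga).
  { apply (Cmult_eq_reg_l ga); auto. rewrite Ra, Cinv_r; auto. }
  assert (Sb : Csin (PI * b) / PI = / gb).
  { apply (Cmult_eq_reg_l gb); auto. rewrite Rb, Cinv_r; auto. }
  rewrite Sa, Sb in Q.
  apply (Cmult_eq_reg_l (Csin (PI * u) / PI * (Csin (PI * v) / PI) * (/ ga * / gb) * (X3 * X4))).
  - transitivity (B * (Csin (PI * u) / PI * (Csin (PI * v) / PI) * (/ ga * / gb)) * (X3 * X4));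
      [ring|].
    rewrite Q. field. repeat split; auto.
  - assert (Pi : / RtoC PI <> 0) by (apply (Z PI), Cinv_r, P0).
    assert (Ia : / ga <> 0) by (apply (Z ga), Cinv_r, Za).
    assert (Ib : / gb <> 0) by (apply (Z gb), Cinv_r, Zb).
    exact (Cmult_neq_0 _ _ (Cmult_neq_0 _ _ (Cmult_neq_0 _ _
      (Cmult_neq_0 _ _ Su Pi) (Cmult_neq_0 _ _ Sv Pi)) (Cmult_neq_0 _ _ Ia Ib))
      (Cmult_neq_0 _ _ N3 N4)).
Qed.

(** * Sums over words *)

Definition lsum {A : Type} (f : A -> C) (l : list A) : C :=
  fold_right (fun x acc => f x + acc) 0 l.

Lemma lsum_ext {A : Type} (f g : A -> C) (l : list A) :
  (forall x, In x l -> f x = g x) -> lsum f l = lsum g l.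
Proof.
  induction l as [|x l IH]; simpl; intros H; [reflexivity|].
  rewrite H, IH; auto.
Qed.

Lemma lsum_app {A : Type} (f : A -> C) (l l' : list A) :
  lsum f (l ++ l') = lsum f l + lsum f l'.
Proof. induction l as [|x l IH]; simpl; [ring|]. rewrite IH; ring. Qed.

Lemma lsum_map {A B : Type} (g : B -> A) (f : A -> C) (l : list B) :
  lsum f (map g l) = lsum (fun x => f (g x)) l.
Proof. induction l as [|x l IH]; simpl; [ring|]. now rewrite IH. Qed.

Lemma lsum_flat_map {A B : Type} (g : B -> list A) (f : A -> C) (l : list B) :
  lsum f (flat_map g l) = lsum (fun x => lsum f (g x)) l.
Proof. induction l as [|x l IH]; simpl; [ring|]. now rewrite lsum_app, IH. Qed.

Lemma lsum_filter {A : Type} (p : A -> bool) (f : A -> C) (l : list A) :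
  lsum f (filter p l) = lsum (fun x => if p x then f x else 0) l.
Proof.
  induction l as [|x l IH]; simpl; [ring|].
  destruct (p x); simpl; rewrite IH; ring.
Qed.

Lemma lsum_scal {A : Type} (c : C) (f : A -> C) (l : list A) :
  lsum (fun x => c * f x) l = c * lsum f l.
Proof. induction l as [|x l IH]; simpl; [ring|]. rewrite IH; ring. Qed.

Lemma lsum_plus {A : Type} (f g : A -> C) (l : list A) :
  lsum (fun x => f x + g x) l = lsum f l + lsum g l.
Proof. induction l as [|x l IH]; simpl; [ring|]. rewrite IH; ring. Qed.

Lemma lsum_0 {A : Type} (l : list A) : lsum (fun _ => 0) l = 0.
Proof. induction l as [|x l IH]; simpl; [ring|]. rewrite IH; ring. Qed.

Lemma lsum_Csum {A : Type} (f : nat -> A -> C) (l : list A) (n : nat) :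
  lsum (fun x => Csum (fun i => f i x) n) l = Csum (fun i => lsum (f i) l) n.
Proof.
  induction n as [|n IH]; simpl.
  - apply lsum_0.
  - rewrite lsum_plus, IH. reflexivity.
Qed.

Lemma lsum_seq (f : nat -> C) (n : nat) : lsum f (seq 1 n) = Csum (fun i => f (S i)) n.
Proof.
  induction n as [|n IH]; [reflexivity|].
  rewrite seq_S, lsum_app, IH. simpl. ring.
Qed.

Lemma lsum_words_S (f : list nat -> C) (l : list nat) (n : nat) :
  lsum f (words l (S n)) = lsum (fun k => lsum (fun ks => f (k :: ks)) (words l n)) l.
Proof.
  simpl. rewrite lsum_flat_map. apply lsum_ext; intros k _. apply lsum_map.
Qed.

(** An entry 1 adds one to n - s and carries v; an entry k >= 2 adds k - 2 to the exponent of u and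
    one to the height, so it carries u^(k-2) t^2. *)
Definition letter (u v t : C) (k : nat) : C :=
  match k with O => 0 | S O => v | S (S k') => u ^ k' * t ^ 2 end.

(** Admissibility forces the first entry to be at least 2. It carries no t^2, since the exponent of
    t is 2 s - 2; the value 0 at smaller entries removes inadmissible words. *)
Definition first_letter (u : C) (k : nat) : C :=
  match k with S (S k') => u ^ k' | _ => 0 end.

Fixpoint word (u v t : C) (ks : list nat) : C :=
  match ks with [] => 1 | k :: ks' => letter u v t k * word u v t ks' end.

Definition admissible_word (u v t : C) (ks : list nat) : C :=
  match ks with [] => 0 | k :: ks' => first_letter u k * word u v t ks' end.

Lemma word_eq (u v t : C) (ks : list nat) :
  Forall (fun k => 1 <= k)%nat ks ->
  (depth ks + height ks <= weight ks)%nat /\ (height ks <= depth ks)%nat /\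
  word u v t ks = u ^ (weight ks - depth ks - height ks) * v ^ (depth ks - height ks)
                  * t ^ (2 * height ks).
Proof.
  induction 1 as [|k ks Hk Hks (IH1 & IH2 & IH3)].
  - simpl. repeat split; auto. ring.
  - change (weight (k :: ks)) with (k + weight ks)%nat.
    change (depth (k :: ks)) with (S (depth ks)). cbn [word]. rewrite IH3.
    destruct k as [|[|k]]; [lia| |].
    + change (height (1%nat :: ks)) with (height ks). cbn [letter].
      repeat split; [lia..|].
      replace (1 + weight ks - S (depth ks) - height ks)%nat
        with (weight ks - depth ks - height ks)%nat by lia.
      replace (S (depth ks) - height ks)%nat with (S (depth ks - height ks)) by lia.
      rewrite Cpow_S. ring.
    + change (height (S (S k) :: ks)) with (S (height ks)). cbn [letter].
      repeat split; [lia..|].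
      replace (S (S k) + weight ks - S (depth ks) - S (height ks))%nat
        with (k + (weight ks - depth ks - height ks))%nat by lia.
      replace (S (depth ks) - S (height ks))%nat with (depth ks - height ks)%nat by lia.
      replace (2 * S (height ks))%nat with (2 + 2 * height ks)%nat by lia.
      rewrite !Cpow_add_r. ring.
Qed.

Lemma admissible_word_eq (u v t : C) (ks : list nat) : admissible ks ->
  (depth ks + height ks <= weight ks)%nat /\ (1 <= height ks <= depth ks)%nat /\
  admissible_word u v t ks =
    u ^ (weight ks - depth ks - height ks) * v ^ (depth ks - height ks)
    * t ^ (2 * height ks - 2).
Proof.
  intros [H1 H2]. destruct ks as [|k ks]; simpl in H2; [lia|].
  inversion H1 as [|? ? Hk Hks]; subst.
  destruct (word_eq u v t ks Hks) as (IH1 & IH2 & IH3).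
  change (weight (k :: ks)) with (k + weight ks)%nat.
  change (depth (k :: ks)) with (S (depth ks)). cbn [admissible_word]. rewrite IH3.
  destruct k as [|[|k]]; [lia|lia|].
  change (height (S (S k) :: ks)) with (S (height ks)). cbn [first_letter].
  repeat split; [lia..|].
  replace (S (S k) + weight ks - S (depth ks) - S (height ks))%nat
    with (k + (weight ks - depth ks - height ks))%nat by lia.
  replace (S (depth ks) - S (height ks))%nat with (depth ks - height ks)%nat by lia.
  replace (2 * S (height ks) - 2)%nat with (2 * height ks)%nat by lia.
  rewrite !Cpow_add_r. ring.
Qed.

Lemma admissible_word_0 (u v t : C) (ks : list nat) :
  (hd 0 ks <= 1)%nat -> admissible_word u v t ks = 0.
Proof.
  destruct ks as [|[|[|k]] ks]; simpl; intros H; try lia; ring.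
Qed.

(** [weighted_sum zeta_star] collects the terms of the series [Phi0star] of a
    given weight; truncations of the zeta-star values are summed in the same way. *)
Definition weighted_sum (Z : list nat -> R) (u v t : C) (k : nat) : C :=
  Csum (fun n => lsum (fun ks => if (weight ks =? k)%nat
                                 then Z ks * admissible_word u v t ks else 0)
                   (words (seq 1 k) n)) (S k).

(** For Z = [zeta_star] this is [Phi0star_term] up to unfolding. *)
Definition height_term (Z : list nat -> R) (u v t : C) (k n s : nat) : C :=
  if ((n + s <=? k) && (s <=? n) && (1 <=? s))%nat
  then fold_right Rplus 0%R (map Z (indices k n s))
       * u ^ (k - n - s) * v ^ (n - s) * t ^ (2 * s - 2)
  else 0.

Lemma RtoC_fold_right {A : Type} (f : A -> R) (l : list A) :
  RtoC (fold_right Rplus 0%R (map f l)) = lsum (fun x => RtoC (f x)) l.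
Proof. induction l as [|x l IH]; simpl; [reflexivity|]. now rewrite RtoC_plus, IH. Qed.

Lemma height_term_eq (Z : list nat -> R) (u v t : C) (k n s : nat) :
  height_term Z u v t k n s =
  lsum (fun ks => Z ks * admissible_word u v t ks) (indices k n s).
Proof.
  unfold height_term.
  destruct ((n + s <=? k) && (s <=? n) && (1 <=? s))%nat eqn:Hc.
  - rewrite RtoC_fold_right.
    rewrite (lsum_ext (fun ks => Z ks * admissible_word u v t ks)
      (fun ks => (u ^ (k - n - s) * v ^ (n - s) * t ^ (2 * s - 2)) * RtoC (Z ks))).
    + rewrite lsum_scal. ring.
    + intros ks Hks. apply In_indices in Hks as (Ha & Hw & Hd & Hh).
      destruct (admissible_word_eq u v t ks Ha) as (_ & _ & ->). subst. ring.
  - destruct (indices k n s) as [|ks l] eqn:E; [reflexivity|].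
    exfalso. assert (Hks : In ks (indices k n s)) by (rewrite E; left; auto).
    apply In_indices in Hks as (Ha & Hw & Hd & Hh).
    destruct (admissible_word_eq u v t ks Ha) as (H1 & H2 & _). subst.
    rewrite !andb_false_iff, !Nat.leb_gt in Hc. lia.
Qed.

Lemma Csum_indicator (x : C) (h n : nat) :
  Csum (fun s => if (h =? s)%nat then x else 0) n = if (h <? n)%nat then x else 0.
Proof.
  induction n as [|n IH]; [reflexivity|]. cbn [Csum]. rewrite IH.
  destruct (Nat.ltb_spec h n), (Nat.ltb_spec h (S n)), (Nat.eqb_spec h n); try lia; ring.
Qed.

(** Each word has exactly one height, and this is at most the weight, so the sum over s picks the
    word once. Words with first entry 1 contribute 0 on both sides. *)
Lemma sum_height_term (Z : list nat -> R) (u v t : C) (k : nat) :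
  sum_n (G := C_AbelianMonoid) (fun n => sum_n (G := C_AbelianMonoid)
    (height_term Z u v t k n) k) k = weighted_sum Z u v t k.
Proof.
  rewrite <- Csum_sum_n. unfold weighted_sum. apply Csum_ext; intros n _.
  rewrite <- Csum_sum_n.
  rewrite (Csum_ext _ (fun s => lsum (fun ks =>
     if (height ks =? s)%nat then
       if ((1 <? hd 0 ks) && (weight ks =? k))%nat then Z ks * admissible_word u v t ks else 0
     else 0) (words (seq 1 k) n))).
  - rewrite <- lsum_Csum. apply lsum_ext; intros ks Hks.
    rewrite Csum_indicator. apply In_words in Hks as [Hl Hk].
    assert (Hp : Forall (fun j => 1 <= j)%nat ks).
    { revert Hk; apply Forall_impl. intros j Hj; apply in_seq in Hj; lia. }
    destruct (word_eq u v t ks Hp) as (H1 & H2 & _).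
    destruct (Nat.ltb_spec 1 (hd 0%nat ks)) as [H3|H3], (Nat.eqb_spec (weight ks) k) as [H4|H4];
      simpl; destruct (Nat.ltb_spec (height ks) (S k)); try lia; try ring.
    all: rewrite admissible_word_0 by auto; ring.
  - intros s _. rewrite height_term_eq. unfold indices. rewrite lsum_filter.
    apply lsum_ext; intros ks _.
    destruct (height ks =? s)%nat, ((1 <? hd 0 ks) && (weight ks =? k))%nat; reflexivity.
Qed.

Lemma zeta_star_trunc_cons (k : nat) (ks : list nat) (N : nat) :
  zeta_star_trunc (k :: ks) N =
  Rsum (fun p => / INR (S p) ^ k * zeta_star_trunc ks (S p))%R N.
Proof.
  cbn [zeta_star_trunc]. induction N as [|N IH].
  - rewrite sum_n_m_zero by lia. reflexivity.
  - destruct N as [|N].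
    + rewrite sum_n_n. cbn [Rsum]. ring.
    + rewrite sum_n_Sm by lia. rewrite IH. reflexivity.
Qed.

Lemma RtoC_Rsum (f : nat -> R) (n : nat) : RtoC (Rsum f n) = Csum (fun i => RtoC (f i)) n.
Proof. induction n as [|n IH]; [reflexivity|]. simpl. now rewrite RtoC_plus, IH. Qed.

(** A sequence in the weight k, for the summation index p + 1. Prepending an entry to a word becomes
    the convolution of such sequences. *)
Definition letter_coef (u v t : C) (p k : nat) : C := letter u v t k * (/ INR (S p) ^ k)%R.
Definition first_coef (u : C) (p k : nat) : C := first_letter u k * (/ INR (S p) ^ k)%R.

(** Here n is the length, w the weight, m the bound on the summation indices. The outermost sum is
    over the first index p + 1; the rest of the word may use indices up to p + 1 again, since the
    inequalities between them are weak. *)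
Fixpoint word_sum (u v t : C) (n w m : nat) : C :=
  match n with
  | O => if (w =? 0)%nat then 1 else 0
  | S n' => Csum (fun p => conv (letter_coef u v t p)
                             (fun w' => word_sum u v t n' w' (S p)) w) m
  end.

(** The alphabet bound K is separate from the weight w, so that an induction can lower w while the
    words remain over the same alphabet. *)
Lemma lsum_words_cons (a : nat -> C) (g : list nat -> C) (K n w m : nat) :
  a O = 0 -> (w <= K)%nat ->
  lsum (fun ks => match ks with
                  | [] => 0
                  | k :: ks' => if (weight ks =? w)%nat
                                then zeta_star_trunc ks m * (a k * g ks') else 0
                  end) (words (seq 1 K) (S n)) =
  Csum (fun p => conv (fun k => a k * (/ INR (S p) ^ k)%R)
     (fun w' => lsum (fun ks => if (weight ks =? w')%nat
                                then zeta_star_trunc ks (S p) * g ks else 0)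
                  (words (seq 1 K) n)) w) m.
Proof.
  intros Ha Hw. rewrite lsum_words_S, lsum_seq.
  unfold conv. rewrite Csum_swap.
  rewrite (Csum_S _ w).
  rewrite (Csum_0 (fun i => a O * (/ INR (S i) ^ 0)%R * _)) by (intros; rewrite Ha; ring).
  rewrite Cplus_0_l.
  rewrite (Csum_extend _ w K Hw).
  - apply Csum_ext; intros i Hi.
    rewrite (lsum_ext _ (fun ks => Csum (fun p => a (S i) * (/ INR (S p) ^ S i)%R *
       (if (weight ks =? w - S i)%nat then zeta_star_trunc ks (S p) * g ks else 0)) m)).
    + rewrite lsum_Csum. apply Csum_ext; intros p _. apply lsum_scal.
    + intros ks _. change (weight (S i :: ks)) with (S i + weight ks)%nat.
      destruct (Nat.eqb_spec (S i + weight ks) w) as [H1|H1],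
        (Nat.eqb_spec (weight ks) (w - S i)) as [H2|H2]; try lia.
      * rewrite zeta_star_trunc_cons, RtoC_Rsum, Cmult_comm, <- Csum_scal.
        apply Csum_ext; intros p _. rewrite RtoC_mult. ring.
      * rewrite Csum_0; [reflexivity|]. intros; ring.
  - intros i Hi. rewrite (lsum_ext _ (fun _ => 0)); [apply lsum_0|].
    intros ks _. change (weight (S i :: ks)) with (S i + weight ks)%nat.
    destruct (Nat.eqb_spec (S i + weight ks) w); [lia|reflexivity].
Qed.

Lemma lsum_word_sum (u v t : C) (K n w m : nat) : (w <= K)%nat ->
  lsum (fun ks => if (weight ks =? w)%nat then zeta_star_trunc ks m * word u v t ks else 0)
    (words (seq 1 K) n) = word_sum u v t n w m.
Proof.
  revert w m; induction n as [|n IH]; intros w m Hw.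
  - simpl. unfold weight; simpl. destruct w; simpl; ring.
  - rewrite (lsum_ext _ (fun ks => match ks with
                  | [] => 0
                  | k :: ks' => if (weight ks =? w)%nat
                                then zeta_star_trunc ks m * (letter u v t k * word u v t ks') else 0
                  end)).
    + rewrite lsum_words_cons by auto. cbn [word_sum]. apply Csum_ext; intros p _.
      unfold conv. apply Csum_ext; intros i Hi. rewrite IH by lia. reflexivity.
    + intros [|k ks] Hks; [|reflexivity]. apply In_words in Hks as [Hl _]; discriminate.
Qed.

Lemma word_sum_0 (u v t : C) (n w m : nat) : (w < n)%nat -> word_sum u v t n w m = 0.
Proof.
  revert w m; induction n as [|n IH]; intros w m H; [lia|].
  cbn [word_sum]. apply Csum_0; intros p _. unfold conv. apply Csum_0; intros [|i] Hi.
  - unfold letter_coef; simpl; ring.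
  - rewrite IH by lia. ring.
Qed.

(** Lengths up to w exhaust the words of weight w, as every entry is at least 1. *)
Definition all_words (u v t : C) (m w : nat) : C :=
  Csum (fun n => word_sum u v t n w m) (S w).

Lemma all_words_extend (u v t : C) (m w L : nat) : (w < L)%nat ->
  Csum (fun n => word_sum u v t n w m) L = all_words u v t m w.
Proof.
  intros H. unfold all_words. apply Csum_extend; [lia|].
  intros i Hi; apply word_sum_0; lia.
Qed.

Lemma Csum_conv_swap (a : nat -> C) (b : nat -> nat -> C) (w n : nat) :
  Csum (fun i => conv a (b i) w) n = conv a (fun w' => Csum (fun i => b i w') n) w.
Proof.
  unfold conv. rewrite Csum_swap. apply Csum_ext; intros i _. apply Csum_scal.
Qed.

Lemma all_words_eq (u v t : C) (m w : nat) :
  all_words u v t m w =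
  (if (w =? 0)%nat then 1 else 0) +
  Csum (fun p => conv (letter_coef u v t p) (all_words u v t (S p)) w) m.
Proof.
  unfold all_words at 1. rewrite Csum_S. cbn [word_sum]. f_equal.
  rewrite Csum_swap. apply Csum_ext; intros p _. rewrite Csum_conv_swap.
  unfold conv. apply Csum_ext; intros [|i] Hi.
  - unfold letter_coef; simpl; ring.
  - rewrite all_words_extend by lia. reflexivity.
Qed.

Lemma all_words_0 (u v t : C) (w : nat) :
  all_words u v t 0 w = if (w =? 0)%nat then 1 else 0.
Proof. rewrite all_words_eq. simpl. ring. Qed.

(** The second summand collects the words whose first summation index equals [m + 1]. *)
Lemma all_words_S (u v t : C) (m w : nat) :
  all_words u v t (S m) w =
  all_words u v t m w + conv (letter_coef u v t m) (all_words u v t (S m)) w.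
Proof. rewrite all_words_eq, (all_words_eq u v t m). cbn [Csum]. ring. Qed.

(** The first entry is split off because it carries [first_letter]; behind it stands an arbitrary
    word with indices at most p + 1. *)
Lemma weighted_sum_trunc (u v t : C) (N k : nat) :
  weighted_sum (fun ks => zeta_star_trunc ks N) u v t k =
  Csum (fun p => conv (first_coef u p) (all_words u v t (S p)) k) N.
Proof.
  unfold weighted_sum. rewrite Csum_S.
  assert (E0 : forall f : list nat -> C, f [] = 0 -> lsum f (words (seq 1 k) 0) = 0).
  { intros f Hf. simpl. rewrite Hf. ring. }
  rewrite E0, Cplus_0_l by (cbn [admissible_word]; destruct (weight [] =? k)%nat; ring).
  rewrite (Csum_ext _ (fun n => Csum (fun p => conv (first_coef u p)
     (fun w' => word_sum u v t n w' (S p)) k) N)).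
  - rewrite Csum_swap. apply Csum_ext; intros p _. rewrite Csum_conv_swap.
    unfold conv. apply Csum_ext; intros [|i] Hi.
    + unfold first_coef; simpl; ring.
    + rewrite all_words_extend by lia. reflexivity.
  - intros n _.
    rewrite (lsum_ext _ (fun ks => match ks with
                  | [] => 0
                  | j :: ks' => if (weight ks =? k)%nat
                                then zeta_star_trunc ks N * (first_letter u j * word u v t ks') else 0
                  end)).
    + rewrite lsum_words_cons by auto. apply Csum_ext; intros p _.
      unfold conv. apply Csum_ext; intros i Hi. rewrite lsum_word_sum by lia. reflexivity.
    + intros [|j ks] Hks; [|reflexivity]. apply In_words in Hks as [Hl _]; discriminate.
Qed.

(** * Convergence of the generating function *)

Definition Rconv (a b : nat -> R) (k : nat) : R := Rsum (fun i => a i * b (k - i)%nat)%R (S k).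

Lemma Rsum_conv (a b : nat -> R) (n : nat) :
  Rsum (Rconv a b) n = Rsum (fun i => a i * Rsum b (n - i))%R n.
Proof.
  induction n as [|n IH]; [reflexivity|].
  cbn [Rsum]. rewrite IH. unfold Rconv.
  replace (S n - n)%nat with 1%nat by lia. cbn [Rsum].
  rewrite Nat.sub_diag.
  replace (Rsum (fun i => a i * Rsum b (S n - i))%R n) with
    (Rsum (fun i => a i * Rsum b (n - i) + a i * b (n - i)%nat)%R n).
  - rewrite Rsum_plus. ring.
  - apply Rsum_ext; intros i Hi. rewrite Nat.sub_succ_l by lia. simpl. ring.
Qed.

Lemma Rsum_conv_le (a b : nat -> R) (A B : R) (n : nat) :
  (forall i, (0 <= a i)%R) -> (forall i, (0 <= b i)%R) ->
  (Rsum a n <= A)%R -> (Rsum b n <= B)%R -> (Rsum (Rconv a b) n <= A * B)%R.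
Proof.
  intros Ha Hb HA HB. rewrite Rsum_conv.
  apply Rle_trans with (Rsum (fun i => B * a i)%R n).
  - apply Rsum_le; intros i Hi. rewrite Rmult_comm. apply Rmult_le_compat_r; auto.
    eapply Rle_trans; [|exact HB]. apply Rsum_incr; auto; lia.
  - rewrite Rsum_scal, Rmult_comm. apply Rmult_le_compat_r; auto.
    eapply Rle_trans; [|exact HB]. apply Rsum_ge_0; auto.
Qed.

(** The coefficients at u = v = t = r0, where an entry 1 and an entry k >= 2 both contribute
    r0^k. *)
Definition letter_bound (p k : nat) : R :=
  match k with O => 0%R | _ => (r0 ^ k * / INR (S p) ^ k)%R end.
Definition first_bound (p k : nat) : R :=
  match k with S (S k') => (r0 ^ k' * / INR (S p) ^ k)%R | _ => 0%R end.

Lemma INR_S_pos (p : nat) : (1 <= INR (S p))%R.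
Proof. rewrite S_INR. pose proof (pos_INR p). lra. Qed.

Lemma inv_pow_pos (p k : nat) : (0 < / INR (S p) ^ k)%R.
Proof. apply Rinv_0_lt_compat, pow_lt. pose proof (INR_S_pos p). lra. Qed.

Lemma r0_pow_pos (k : nat) : (0 < r0 ^ k)%R.
Proof. apply pow_lt. r0lra. Qed.

Lemma letter_bound_nonneg (p k : nat) : (0 <= letter_bound p k)%R.
Proof.
  unfold letter_bound. destruct k; [lra|]. apply Rlt_le, Rmult_lt_0_compat.
  - apply r0_pow_pos.
  - apply inv_pow_pos.
Qed.

Lemma first_bound_nonneg (p k : nat) : (0 <= first_bound p k)%R.
Proof.
  unfold first_bound. destruct k as [|[|k]]; [lra|lra|]. apply Rlt_le, Rmult_lt_0_compat.
  - apply r0_pow_pos.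
  - apply inv_pow_pos.
Qed.

Lemma letter_coef_r0 (p k : nat) : letter_coef r0 r0 r0 p k = letter_bound p k.
Proof.
  unfold letter_coef, letter_bound. destruct k as [|[|k]]; cbn [letter].
  - ring.
  - rewrite RtoC_mult, (pow_1 r0). reflexivity.
  - rewrite RtoC_mult, !RtoC_pow. f_equal. rewrite <- Cpow_add_r. f_equal. lia.
Qed.

Lemma first_coef_r0 (p k : nat) : first_coef r0 p k = first_bound p k.
Proof.
  unfold first_coef, first_bound. destruct k as [|[|k]]; cbn [first_letter].
  - ring.
  - ring.
  - rewrite RtoC_mult, !RtoC_pow. reflexivity.
Qed.

Lemma Cmod_pow_le (u : C) (k : nat) : (Cmod u <= r0)%R -> (Cmod (u ^ k) <= r0 ^ k)%R.
Proof. intros H. rewrite Cmod_pow. apply pow_incr. split; auto using Cmod_ge_0. Qed.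

Lemma Cmod_inv_pow (p k : nat) : Cmod (/ INR (S p) ^ k)%R = (/ INR (S p) ^ k)%R.
Proof. rewrite Cmod_R. apply Rabs_pos_eq. left; apply inv_pow_pos. Qed.

Lemma letter_coef_le (u v t : C) (p k : nat) :
  (Cmod u <= r0)%R -> (Cmod v <= r0)%R -> (Cmod t <= r0)%R ->
  (Cmod (letter_coef u v t p k) <= letter_bound p k)%R.
Proof.
  intros Hu Hv Ht. unfold letter_coef, letter_bound. rewrite Cmod_mult, Cmod_inv_pow.
  destruct k as [|k]; [cbn [letter]; rewrite Cmod_0; lra|].
  apply Rmult_le_compat_r; [left; apply inv_pow_pos|].
  destruct k as [|k]; cbn [letter]; [rewrite pow_1; auto|].
  rewrite Cmod_mult. replace (S (S k)) with (k + 2)%nat by lia. rewrite pow_add.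
  apply Rmult_le_compat; auto using Cmod_ge_0, Cmod_pow_le.
Qed.

Lemma first_coef_le (u : C) (p k : nat) :
  (Cmod u <= r0)%R -> (Cmod (first_coef u p k) <= first_bound p k)%R.
Proof.
  intros Hu. unfold first_coef, first_bound. rewrite Cmod_mult, Cmod_inv_pow.
  destruct k as [|[|k]]; cbn [first_letter]; try (rewrite Cmod_0; lra).
  apply Rmult_le_compat_r; [left; apply inv_pow_pos|]. now apply Cmod_pow_le.
Qed.

Lemma Cmod_r0 : (Cmod r0 <= r0)%R.
Proof. rewrite Cmod_R, Rabs_pos_eq; r0lra. Qed.

Lemma ratio_bounds (p : nat) : (0 <= r0 * / INR (S p) < 1)%R.
Proof.
  pose proof (INR_S_pos p) as H. split.
  - apply Rmult_le_pos; [r0lra|]. apply Rlt_le, Rinv_0_lt_compat; lra.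
  - apply Rmult_lt_reg_r with (INR (S p)); [lra|]. rewrite Rmult_assoc, Rinv_l by lra.
    r0lra.
Qed.

Lemma Clim_geom (z : C) : (Cmod z < 1)%R -> Clim (Csum (fun k => z ^ k)) (/ (1 - z)).
Proof.
  intros Hz.
  assert (Nz : 1 - z <> 0).
  { intros E. assert (K : z = 1) by (replace z with (1 - (1 - z)) by ring; rewrite E; ring).
    rewrite K, Cmod_1 in Hz. lra. }
  apply (Clim_ext (fun n => / (1 - z) * (1 - z ^ n))).
  - intros n. induction n as [|n IH]; [simpl; ring|].
    cbn [Csum]. rewrite <- IH, Cpow_S. field. auto.
  - eapply Clim_eq; [apply Clim_scal, Clim_minus; [apply Clim_const|]|].
    + apply Clim_le with (fun n => (Cmod z ^ n)%R).
      * exists O; intros n _. replace (z ^ n - 0) with (z ^ n) by ring.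
        rewrite Cmod_pow. lra.
      * apply is_lim_seq_geom. rewrite Rabs_pos_eq; auto using Cmod_ge_0.
    + ring.
Qed.

Lemma Clim_Csum_S (f : nat -> C) (l : C) :
  Clim (Csum (fun i => f (S i))) l -> Clim (Csum f) (f O + l).
Proof.
  intros H. apply Clim_incr_1.
  apply Clim_ext with (2 := Clim_plus _ _ _ _ (Clim_const (f O)) H).
  intros n. symmetry; apply Csum_S.
Qed.

Lemma ratio_lt_1 (u : C) (p : nat) : (Cmod u <= r0)%R -> (Cmod (u * / INR (S p)) < 1)%R.
Proof.
  intros Hu. pose proof (INR_S_pos p) as H.
  rewrite Cmod_mult, <- RtoC_inv, Cmod_R, Rabs_pos_eq; try lra.
  - pose proof (ratio_bounds p). eapply Rle_lt_trans; [|apply H0].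
    apply Rmult_le_compat_r; auto. apply Rlt_le, Rinv_0_lt_compat; lra.
  - apply Rlt_le, Rinv_0_lt_compat; lra.
Qed.

Lemma RtoC_inv_pow (p k : nat) : RtoC (/ INR (S p) ^ k)%R = (/ INR (S p)) ^ k.
Proof.
  rewrite RtoC_inv by (apply pow_nonzero; pose proof (INR_S_pos p); lra).
  rewrite RtoC_pow, Cpow_inv by apply INR_C_nz. reflexivity.
Qed.

Lemma small_denominator (u : C) (p : nat) : (Cmod u <= r0)%R -> INR (S p) - u <> 0.
Proof. intros Hu. apply noint_small_nz. r0lra. Qed.

Lemma Clim_first_coef (u : C) (p : nat) : (Cmod u <= r0)%R ->
  Clim (Csum (first_coef u p)) (/ (INR (S p) * (INR (S p) - u))).
Proof.
  intros Hu. assert (N0 := INR_C_nz p). assert (N1 := small_denominator u p Hu).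
  eapply Clim_eq.
  - apply Clim_Csum_S, Clim_Csum_S.
    apply (Clim_ext (fun n => / INR (S p) ^ 2 * Csum (fun k => (u * / INR (S p)) ^ k) n)).
    + intros n. rewrite <- Csum_scal. apply Csum_ext; intros k _.
      unfold first_coef; cbn [first_letter]. rewrite RtoC_inv_pow, !Cpow_S, Cpow_mult_l.
      field. auto.
    + apply Clim_scal, Clim_geom, ratio_lt_1, Hu.
  - unfold first_coef; cbn [first_letter]. field. repeat split; auto.
Qed.

Lemma Clim_letter_coef (u v t : C) (p : nat) : (Cmod u <= r0)%R ->
  Clim (Csum (letter_coef u v t p))
    (v / INR (S p) + t ^ 2 / (INR (S p) * (INR (S p) - u))).
Proof.
  intros Hu. assert (N0 := INR_C_nz p). assert (N1 := small_denominator u p Hu).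
  eapply Clim_eq.
  - apply Clim_Csum_S, Clim_Csum_S.
    apply (Clim_ext (fun n => t ^ 2 * / INR (S p) ^ 2 * Csum (fun k => (u * / INR (S p)) ^ k) n)).
    + intros n. rewrite <- Csum_scal. apply Csum_ext; intros k _.
      unfold letter_coef; cbn [letter]. rewrite RtoC_inv_pow, !Cpow_S, Cpow_mult_l.
      field. auto.
    + apply Clim_scal, Clim_geom, ratio_lt_1, Hu.
  - unfold letter_coef; cbn [letter]. rewrite !RtoC_inv_pow. field. repeat split; auto.
Qed.

Lemma Rsum_le_Clim (f : nat -> R) (L : R) (n : nat) :
  (forall i, (0 <= f i)%R) -> Clim (Csum (fun i => RtoC (f i))) L -> (Rsum f n <= L)%R.
Proof.
  intros Hf H. apply Clim_Re in H. rewrite re_RtoC in H.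
  apply (is_lim_seq_incr_compare (Rsum f)).
  - apply is_lim_seq_ext with (2 := H). intros m. apply Re_Csum.
  - intros m. simpl. pose proof (Hf m); lra.
Qed.

Lemma Rsum_letter_bound (p n : nat) :
  (Rsum (letter_bound p) n <= r0 / (INR (S p) - r0))%R.
Proof.
  pose proof (INR_S_pos p) as H. apply Rsum_le_Clim; [apply letter_bound_nonneg|].
  apply (Clim_ext (Csum (letter_coef r0 r0 r0 p))).
  { intros m. apply Csum_ext; intros i _. apply letter_coef_r0. }
  eapply Clim_eq; [apply Clim_letter_coef, Cmod_r0|].
  assert (N1 := small_denominator r0 p Cmod_r0). assert (N0 := INR_C_nz p).
  rewrite RtoC_div, RtoC_minus by r0lra. field. auto.
Qed.

Lemma Rsum_first_bound (p n : nat) :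
  (Rsum (first_bound p) n <= / (INR (S p) * (INR (S p) - r0)))%R.
Proof.
  pose proof (INR_S_pos p) as H. apply Rsum_le_Clim; [apply first_bound_nonneg|].
  apply (Clim_ext (Csum (first_coef r0 p))).
  { intros m. apply Csum_ext; intros i _. apply first_coef_r0. }
  eapply Clim_eq; [apply Clim_first_coef, Cmod_r0|].
  rewrite RtoC_inv, RtoC_mult, RtoC_minus; [reflexivity|].
  apply Rmult_integral_contrapositive; r0lra.
Qed.

Definition words_bound (m w : nat) : R := Re (all_words r0 r0 r0 m w).

Lemma Re_conv (a : nat -> R) (b : nat -> C) (w : nat) :
  Re (conv (fun i => RtoC (a i)) b w) = Rconv a (fun i => Re (b i)) w.
Proof.
  unfold conv. rewrite Re_Csum. apply Rsum_ext; intros i _. apply re_scal_l.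
Qed.

Lemma conv_ext (a a' b b' : nat -> C) (w : nat) :
  (forall i, a i = a' i) -> (forall i, b i = b' i) -> conv a b w = conv a' b' w.
Proof. intros Ha Hb. apply Csum_ext; intros i _. now rewrite Ha, Hb. Qed.

Lemma words_bound_0 (w : nat) : words_bound 0 w = if (w =? 0)%nat then 1%R else 0%R.
Proof. unfold words_bound. rewrite all_words_0. destruct (w =? 0)%nat; reflexivity. Qed.

Lemma words_bound_S (m w : nat) :
  words_bound (S m) w = (words_bound m w + Rconv (letter_bound m) (words_bound (S m)) w)%R.
Proof.
  unfold words_bound at 1. rewrite all_words_S.
  change (Re (all_words r0 r0 r0 m w) +
    Re (conv (letter_coef r0 r0 r0 m) (all_words r0 r0 r0 (S m)) w) =
    words_bound m w + Rconv (letter_bound m) (words_bound (S m)) w)%R.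
  f_equal.
  transitivity (Re (conv (fun i => RtoC (letter_bound m i)) (all_words r0 r0 r0 (S m)) w));
    [|apply Re_conv].
  f_equal. apply conv_ext; auto. intros i. apply letter_coef_r0.
Qed.

(** In [all_words_S] the level m + 1 occurs on both sides, but on the right only at smaller weights
    because entries 0 have coefficient 0. Hence a strong induction on w inside the induction on
    m. *)
Lemma all_words_le (u v t : C) (m w : nat) :
  (Cmod u <= r0)%R -> (Cmod v <= r0)%R -> (Cmod t <= r0)%R ->
  (Cmod (all_words u v t m w) <= words_bound m w)%R.
Proof.
  intros Hu Hv Ht. revert w. induction m as [|m IHm]; intros w.
  - rewrite all_words_0, words_bound_0. destruct (w =? 0)%nat; rewrite ?Cmod_1, ?Cmod_0; lra.
  - induction w as [w IHw] using (well_founded_induction lt_wf).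
    rewrite all_words_S, words_bound_S.
    eapply Rle_trans; [apply Cmod_triangle|]. apply Rplus_le_compat; auto.
    apply Cmod_Csum. intros [|i] Hi.
    + unfold letter_coef; cbn [letter letter_bound]. rewrite !Cmult_0_l, Cmod_0. lra.
    + rewrite Cmod_mult. apply Rmult_le_compat; auto using Cmod_ge_0, letter_coef_le.
      apply IHw. lia.
Qed.

Lemma words_bound_nonneg (m w : nat) : (0 <= words_bound m w)%R.
Proof.
  eapply Rle_trans; [apply Cmod_ge_0|].
  apply (all_words_le r0 r0 r0); apply Cmod_r0.
Qed.

(** At u = v = t = r0 one has al + be = 2 r0 and al be = 0, so the roots are 2 r0 and 0 and the
    factorials cancel: this is the value of the product over j <= m of j (j - u) / ((j - al) (j -
    be)). *)
Definition words_total (m : nat) : R := (Rrising (1 - r0) m / Rrising (1 - 2 * r0) m)%R.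

(** A partial sum T at level m + 1 satisfies T <= [words_total] m + c T, where c = r0 / (m + 1 - r0)
    < 1 is the sum of the letter bounds; as T is finite, the inequality can be solved for it. *)
Lemma Rsum_words_bound (m n : nat) : (Rsum (words_bound m) n <= words_total m)%R.
Proof.
  revert n; induction m as [|m IH]; intros n.
  - rewrite (Rsum_ext _ _ n (fun w _ => words_bound_0 w)).
    assert (E : (Rsum (fun w => if (w =? 0)%nat then 1%R else 0%R) n <= 1)%R).
    { destruct n as [|n]; [simpl; lra|]. rewrite Rsum_S.
      rewrite (Rsum_ext _ (fun _ => 0 * 0)%R) by (intros; simpl; ring).
      rewrite Rsum_scal. simpl. lra. }
    unfold words_total; simpl. lra.
  - assert (K : (Rsum (words_bound (S m)) n <=
        words_total m + r0 / (INR (S m) - r0) * Rsum (words_bound (S m)) n)%R).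
    { rewrite (Rsum_ext _ _ n (fun w _ => words_bound_S m w)) at 1.
      rewrite Rsum_plus. apply Rplus_le_compat; auto.
      apply Rsum_conv_le; auto using letter_bound_nonneg, words_bound_nonneg.
      - apply Rsum_letter_bound.
      - lra. }
    pose proof (INR_S_pos m) as Hm. set (T := Rsum (words_bound (S m)) n) in *.
    assert (P : (0 < Rrising (1 - 2 * r0) m)%R) by (apply Rrising_pos; r0lra).
    assert (E : words_total (S m) =
      (words_total m * ((INR (S m) - r0) / (INR (S m) - 2 * r0)))%R).
    { unfold words_total; cbn [Rrising]. rewrite S_INR in *.
      field. r0lra. }
    rewrite E. apply Rmult_le_reg_r with ((INR (S m) - 2 * r0) / (INR (S m) - r0))%R.
    + apply Rdiv_lt_0_compat; r0lra.
    + replace (words_total m * ((INR (S m) - r0) / (INR (S m) - 2 * r0))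
         * ((INR (S m) - 2 * r0) / (INR (S m) - r0)))%R with (words_total m)
        by (field; r0lra).
      replace ((INR (S m) - 2 * r0) / (INR (S m) - r0))%R with (1 - r0 / (INR (S m) - r0))%R
        by (field; r0lra).
      lra.
Qed.

Definition sum_bound (N k : nat) : R :=
  Re (weighted_sum (fun ks => zeta_star_trunc ks N) r0 r0 r0 k).

Lemma sum_bound_eq (N k : nat) :
  sum_bound N k = Rsum (fun p => Rconv (first_bound p) (words_bound (S p)) k) N.
Proof.
  unfold sum_bound. rewrite weighted_sum_trunc, Re_Csum. apply Rsum_ext; intros p _.
  transitivity (Re (conv (fun i => RtoC (first_bound p i)) (all_words r0 r0 r0 (S p)) k));
    [|apply Re_conv].
  f_equal. apply conv_ext; auto. intros i. apply first_coef_r0.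
Qed.

(** Chosen so that its differences are multiples of [words_total] m / ((m + 1 - 2 r0) (m + 2 - 2
    r0)), a term of the same order as those to be summed. *)
Definition kappa (m : nat) : R := (Rrising (1 - r0) m / Rrising (2 - 2 * r0) m)%R.

Lemma kappa_pos (m : nat) : (0 < kappa m)%R.
Proof. apply Rdiv_lt_0_compat; apply Rrising_pos; r0lra. Qed.

Lemma words_total_kappa (m : nat) :
  (words_total m / ((INR m + 1 - 2 * r0) * (INR m + 2 - 2 * r0)) =
   (kappa m - kappa (S m)) / ((1 - r0) * (1 - 2 * r0)))%R.
Proof.
  unfold words_total, kappa. cbn [Rrising].
  replace (2 - 2 * r0)%R with ((1 - 2 * r0) + 1)%R by ring.
  rewrite Rrising_shift by r0lra.
  assert (P : (0 < Rrising (1 - 2 * r0) m)%R) by (apply Rrising_pos; r0lra).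
  pose proof (pos_INR m). field. r0lra.
Qed.

(** The factor 8 pays for replacing p (p - r0) by (p + 1 - 2 r0) (p + 2 - 2 r0) for p >= 1. *)
Definition total_bound : R := (8 * (kappa 1 / ((1 - r0) * (1 - 2 * r0))))%R.

(** Summing over weights first bounds the contribution of each first index p + 1 by a difference of
    [kappa]. The result is uniform in the truncation N and in the number n of weights. *)
Lemma Rsum_sum_bound (N n : nat) : (Rsum (sum_bound N) n <= total_bound)%R.
Proof.
  rewrite (Rsum_ext _ _ n (fun k _ => sum_bound_eq N k)), Rsum_swap.
  apply Rle_trans with (Rsum (fun p => 8 * ((kappa (S p) - kappa (S (S p))) / ((1 - r0) * (1 - 2 * r0))))%R N).
  - apply Rsum_le; intros p _.
    apply Rle_trans with (/ (INR (S p) * (INR (S p) - r0)) * words_total (S p))%R.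
    + apply Rsum_conv_le; auto using first_bound_nonneg, words_bound_nonneg.
      * apply Rsum_first_bound.
      * apply Rsum_words_bound.
    + rewrite <- words_total_kappa. pose proof (INR_S_pos p) as H. set (x := INR (S p)) in *.
      assert (P : (0 < words_total (S p))%R)
        by (apply Rdiv_lt_0_compat; apply Rrising_pos; r0lra).
      replace (8 * (words_total (S p) / ((x + 1 - 2 * r0) * (x + 2 - 2 * r0))))%R with
        (/ ((x + 1 - 2 * r0) * (x + 2 - 2 * r0) / 8) * words_total (S p))%R
        by (field; r0lra).
      apply Rmult_le_compat_r; [lra|]. apply Rinv_le_contravar; unfold r0; nra.
  - rewrite Rsum_scal. unfold total_bound. apply Rmult_le_compat_l; [lra|].
    assert (E : Rsum (fun p => (kappa (S p) - kappa (S (S p))) / ((1 - r0) * (1 - 2 * r0)))%R N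
      = ((kappa 1 - kappa (S N)) / ((1 - r0) * (1 - 2 * r0)))%R).
    { induction N as [|N IH]; cbn [Rsum]; [unfold Rdiv; ring|]. rewrite IH. unfold Rdiv; ring. }
    rewrite E. pose proof (kappa_pos (S N)).
    apply Rmult_le_compat_r; [|lra]. apply Rlt_le, Rinv_0_lt_compat. r0lra.
Qed.

Lemma word_r0 (ks : list nat) : exists x, (0 <= x)%R /\ word r0 r0 r0 ks = RtoC x.
Proof.
  induction ks as [|k ks (x & Hx & E)].
  - exists 1%R; split; [lra|reflexivity].
  - cbn [word]. rewrite E. destruct k as [|[|k]]; cbn [letter].
    + exists 0%R; split; [lra|ring].
    + exists (r0 * x)%R; split; [apply Rmult_le_pos; r0lra|]. now rewrite RtoC_mult.
    + exists (r0 ^ k * r0 ^ 2 * x)%R; split.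
      * apply Rmult_le_pos; auto. left. apply Rmult_lt_0_compat; apply r0_pow_pos.
      * now rewrite !RtoC_mult, !RtoC_pow.
Qed.

Lemma admissible_word_r0 (ks : list nat) :
  exists x, (0 <= x)%R /\ admissible_word r0 r0 r0 ks = RtoC x.
Proof.
  destruct ks as [|k ks].
  - exists 0%R; split; [lra|reflexivity].
  - cbn [admissible_word]. destruct (word_r0 ks) as (x & Hx & ->).
    destruct k as [|[|k]]; cbn [first_letter].
    + exists 0%R; split; [lra|ring].
    + exists 0%R; split; [lra|ring].
    + exists (r0 ^ k * x)%R; split.
      * apply Rmult_le_pos; auto. left; apply r0_pow_pos.
      * now rewrite RtoC_mult, RtoC_pow.
Qed.

Lemma admissible_word_r0_pos (ks : list nat) : admissible ks ->
  exists x, (0 < x)%R /\ admissible_word r0 r0 r0 ks = RtoC x.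
Proof.
  intros H. destruct (admissible_word_eq r0 r0 r0 ks H) as (_ & _ & ->).
  exists (r0 ^ (weight ks - depth ks - height ks) * r0 ^ (depth ks - height ks)
          * r0 ^ (2 * height ks - 2))%R. split.
  - repeat apply Rmult_lt_0_compat; apply r0_pow_pos.
  - now rewrite !RtoC_mult, !RtoC_pow.
Qed.

Lemma Re_lsum_le {A : Type} (f g : A -> C) (l : list A) :
  (forall x, In x l -> (Re (f x) <= Re (g x))%R) -> (Re (lsum f l) <= Re (lsum g l))%R.
Proof.
  induction l as [|x l IH]; intros H; [simpl; lra|].
  change (Re (f x) + Re (lsum f l) <= Re (g x) + Re (lsum g l))%R.
  apply Rplus_le_compat; [apply H; left; auto | apply IH; intros; apply H; right; auto].
Qed.

Lemma Re_lsum_nonneg {A : Type} (f : A -> C) (l : list A) :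
  (forall x, In x l -> (0 <= Re (f x))%R) -> (0 <= Re (lsum f l))%R.
Proof.
  intros H. pose proof (Re_lsum_le (fun _ => 0) f l) as K. rewrite lsum_0 in K.
  apply K. exact H.
Qed.

Lemma Re_lsum_ge_term {A : Type} (f : A -> C) (l : list A) (x : A) :
  (forall y, In y l -> (0 <= Re (f y))%R) -> In x l -> (Re (f x) <= Re (lsum f l))%R.
Proof.
  induction l as [|y l IH]; intros H Hx; [destruct Hx|].
  change (Re (f x) <= Re (f y) + Re (lsum f l))%R.
  assert (H0 : (0 <= Re (lsum f l))%R)
    by (apply Re_lsum_nonneg; intros; apply H; right; auto).
  destruct Hx as [-> | Hx]; [lra|].
  pose proof (IH (fun z Hz => H z (or_intror Hz)) Hx).
  pose proof (H y (or_introl eq_refl)). lra.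
Qed.

Lemma zeta_star_trunc_nonneg (ks : list nat) (N : nat) : (0 <= zeta_star_trunc ks N)%R.
Proof.
  revert N; induction ks as [|k ks IH]; intros N; [simpl; lra|].
  rewrite zeta_star_trunc_cons. apply Rsum_ge_0; intros p _.
  apply Rmult_le_pos; auto. left; apply inv_pow_pos.
Qed.

Lemma zeta_star_trunc_incr (ks : list nat) (N : nat) :
  (zeta_star_trunc ks N <= zeta_star_trunc ks (S N))%R.
Proof.
  destruct ks as [|k ks]; [simpl; lra|]. rewrite !zeta_star_trunc_cons. cbn [Rsum].
  pose proof (zeta_star_trunc_nonneg ks (S N)). pose proof (inv_pow_pos N k). nra.
Qed.

Lemma trunc_term_nonneg (N k : nat) (ks : list nat) :
  (0 <= Re (if (weight ks =? k)%nat
            then (zeta_star_trunc ks N * admissible_word r0 r0 r0 ks)%C else 0%C))%R.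
Proof.
  pose proof (zeta_star_trunc_nonneg ks N) as H. destruct (weight ks =? k)%nat; [|simpl; lra].
  destruct (admissible_word_r0 ks) as (x & Hx & ->). rewrite re_scal_l.
  simpl. now apply Rmult_le_pos.
Qed.

Lemma In_words_admissible (ks : list nat) : admissible ks ->
  In ks (words (seq 1 (weight ks)) (depth ks)) /\ (depth ks < S (weight ks))%nat.
Proof.
  intros H. destruct (admissible_word_eq 0 0 0 ks H) as (H1 & H2 & _).
  assert (K : In ks (indices (weight ks) (depth ks) (height ks))) by (now apply In_indices).
  unfold indices in K. apply filter_In in K as [K _]. split; [exact K | lia].
Qed.

Lemma sum_bound_nonneg (N k : nat) : (0 <= sum_bound N k)%R.
Proof.
  unfold sum_bound, weighted_sum. rewrite Re_Csum. apply Rsum_ge_0; intros n _.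
  apply Re_lsum_nonneg; intros ks _.
  apply trunc_term_nonneg.
Qed.

Lemma Rsum_ge_term (f : nat -> R) (i n : nat) :
  (forall j, (0 <= f j)%R) -> (i < n)%nat -> (f i <= Rsum f n)%R.
Proof.
  intros H Hi. apply Rle_trans with (Rsum f (S i)).
  - cbn [Rsum]. pose proof (Rsum_ge_0 f i ltac:(auto)). lra.
  - apply Rsum_incr; auto.
Qed.

(** A truncated value times its positive coefficient at u = v = t = r0 is one of the nonnegative
    terms of [sum_bound], which is bounded uniformly in N; the truncations increase, so they
    converge. *)
Lemma is_lim_zeta_star (ks : list nat) : admissible ks ->
  is_lim_seq (zeta_star_trunc ks) (zeta_star ks).
Proof.
  intros H. destruct (admissible_word_r0_pos ks H) as (x & Hx & Ex).
  destruct (ex_finite_lim_seq_incr (zeta_star_trunc ks) (total_bound / x)%R) as [l Hl].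
  - apply zeta_star_trunc_incr.
  - intros N. apply Rmult_le_reg_r with x; auto. unfold Rdiv.
    rewrite Rmult_assoc, Rinv_l, Rmult_1_r by lra.
    apply Rle_trans with (sum_bound N (weight ks)).
    + destruct (In_words_admissible ks H) as [K1 K2].
      unfold sum_bound, weighted_sum. rewrite Re_Csum.
      eapply Rle_trans; [|apply (Rsum_ge_term _ (depth ks)); auto].
      * eapply Rle_trans; [|apply (Re_lsum_ge_term _ _ ks); auto].
        -- cbv beta. rewrite Nat.eqb_refl, Ex, re_scal_l. apply Rle_refl.
        -- intros ks' _. apply trunc_term_nonneg.
      * intros n. apply Re_lsum_nonneg; intros ks' _.
        apply trunc_term_nonneg.
    + eapply Rle_trans; [apply (Rsum_ge_term (sum_bound N) (weight ks) (S (weight ks)))|].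
      * intros; apply sum_bound_nonneg.
      * lia.
      * apply Rsum_sum_bound.
  - unfold zeta_star. rewrite (is_lim_seq_unique _ _ Hl). exact Hl.
Qed.

Lemma zeta_star_nonneg (ks : list nat) : admissible ks -> (0 <= zeta_star ks)%R.
Proof.
  intros H. pose proof (is_lim_zeta_star ks H) as L.
  apply (is_lim_seq_le (fun _ => 0%R) (zeta_star_trunc ks) 0%R (zeta_star ks)); auto.
  - intros; apply zeta_star_trunc_nonneg.
  - apply is_lim_seq_const.
Qed.

Lemma ex_series_letter_bound (p : nat) : ex_series (letter_bound p).
Proof.
  apply ex_series_Rsum_bound with (1 := letter_bound_nonneg p) (2 := Rsum_letter_bound p).
Qed.

Lemma ex_series_first_bound (p : nat) : ex_series (first_bound p).
Proof.
  apply ex_series_Rsum_bound with (1 := first_bound_nonneg p) (2 := Rsum_first_bound p).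
Qed.


(** * The generating function as a hypergeometric series *)

(** The product over j <= m of j (j - u) / ((j - a) (j - b)). In this part a and b are the roots al
    and be, with sum u + v and product u v - t^2. *)
Definition words_limit (u a b : C) (m : nat) : C :=
  Cfact m * Crising (1 - u) m / (Crising (1 - a) m * Crising (1 - b) m).

Lemma Crising_small_nz (a : C) (n : nat) : (Cmod a <= / 2)%R -> Crising (1 - a) n <> 0.
Proof.
  intros H. apply Crising_minus_nz; intros. now apply noint_small_nz.
Qed.

(** Summing [all_words_S] over the weights gives T = T' + L T for consecutive levels, with L the sum
    of a letter at n = m + 1 and 1 - L = (n - a) (n - b) / (n (n - u)). The existence of T, needed
    before the equation can be solved, comes from [words_bound]. *)
Lemma Clim_all_words (u v t a b : C) (m : nat) :
  (Cmod u <= r0)%R -> (Cmod v <= r0)%R -> (Cmod t <= r0)%R ->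
  (Cmod a <= / 2)%R -> (Cmod b <= / 2)%R ->
  a + b = u + v -> a * b = u * v - t ^ 2 ->
  Clim (Csum (all_words u v t m)) (words_limit u a b m).
Proof.
  intros Hu Hv Ht Ha Hb Es Ep. induction m as [|m IH].
  - apply (Clim_ext_loc (fun _ => 1)).
    + exists 1%nat; intros [|n] Hn; [lia|]. rewrite Csum_S, all_words_0.
      rewrite Csum_0 by (intros i _; rewrite all_words_0; reflexivity). simpl; ring.
    + unfold words_limit, Cfact; simpl. eapply Clim_eq; [apply Clim_const|]. field.
  - destruct (abs_conv (all_words u v t (S m)) (words_bound (S m))) as [T HT].
    + apply ex_series_Rsum_bound with (words_total (S m));
        [apply words_bound_nonneg | apply Rsum_words_bound].
    + intros w. now apply all_words_le.
    + assert (HC := Clim_conv _ _ _ _ _ (ex_series_letter_bound m)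
        (fun k => letter_coef_le u v t m k Hu Hv Ht) (Clim_letter_coef u v t m Hu) HT).
      assert (E := Clim_plus _ _ _ _ IH HC).
      apply (Clim_ext _ (Csum (all_words u v t (S m)))) in E.
      2: { intros n. rewrite <- Csum_plus. apply Csum_ext; intros w _.
           symmetry; apply all_words_S. }
      pose proof (Clim_unique _ _ _ HT E) as Q. clear E HC.
      eapply Clim_eq; [exact HT|].
      set (L := v / INR (S m) + t ^ 2 / (INR (S m) * (INR (S m) - u))) in *.
      assert (N0 := INR_C_nz m). assert (N1 := small_denominator u m Hu).
      assert (Na := noint_small_nz a m Ha). assert (Nb := noint_small_nz b m Hb).
      assert (Da := Crising_small_nz a m Ha). assert (Db := Crising_small_nz b m Hb).
      assert (EL : (1 - L) * (INR (S m) * (INR (S m) - u)) = (INR (S m) - a) * (INR (S m) - b)).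
      { replace ((INR (S m) - a) * (INR (S m) - b)) with
          (INR (S m) * INR (S m) - INR (S m) * (a + b) + a * b) by ring.
        rewrite Es, Ep. unfold L. field. auto. }
      assert (ET : T * ((INR (S m) - a) * (INR (S m) - b)) =
                   words_limit u a b m * (INR (S m) * (INR (S m) - u))).
      { rewrite <- EL.
        transitivity ((T - L * T) * (INR (S m) * (INR (S m) - u))); [ring|].
        f_equal. rewrite Q at 1. ring. }
      apply (Cmult_eq_reg_l ((INR (S m) - a) * (INR (S m) - b))); [|now apply Cmult_neq_0].
      rewrite Cmult_comm, ET. unfold words_limit. rewrite Cfact_S, !Crising_S.
      rewrite INR_C_S in *. field.
      repeat split; auto;
        [ replace (1 - b + INR m) with (INR m + 1 - b) by ring
        | replace (1 - a + INR m) with (INR m + 1 - a) by ring ]; auto.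
Qed.

Lemma Clim_weighted_sum_trunc (u v t a b : C) (N : nat) :
  (Cmod u <= r0)%R -> (Cmod v <= r0)%R -> (Cmod t <= r0)%R ->
  (Cmod a <= / 2)%R -> (Cmod b <= / 2)%R ->
  a + b = u + v -> a * b = u * v - t ^ 2 ->
  Clim (Csum (weighted_sum (fun ks => zeta_star_trunc ks N) u v t))
    (Csum (fun p => / (INR (S p) * (INR (S p) - u)) * words_limit u a b (S p)) N).
Proof.
  intros Hu Hv Ht Ha Hb Es Ep.
  apply (Clim_ext (fun K => Csum (fun p =>
    Csum (conv (first_coef u p) (all_words u v t (S p))) K) N)).
  - intros K. rewrite Csum_swap. apply Csum_ext; intros k _.
    symmetry; apply weighted_sum_trunc.
  - apply (Clim_Csum (fun K p => Csum (conv (first_coef u p) (all_words u v t (S p))) K)).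
    intros p _.
    apply (Clim_conv _ _ (first_bound p)).
    + apply ex_series_first_bound.
    + intros i; now apply first_coef_le.
    + now apply Clim_first_coef.
    + now apply (Clim_all_words u v t a b).
Qed.

Lemma Clim_lsum {A : Type} (x : nat -> A -> C) (y : A -> C) (l : list A) :
  (forall a, In a l -> Clim (fun N => x N a) (y a)) ->
  Clim (fun N => lsum (x N) l) (lsum y l).
Proof.
  induction l as [|a l IH]; intros H; simpl.
  - apply Clim_const.
  - apply Clim_plus; [apply H; left; auto | apply IH; intros; apply H; right; auto].
Qed.

Lemma Clim_RtoC (x : nat -> R) (l : R) : is_lim_seq x l -> Clim (fun n => RtoC (x n)) (RtoC l).
Proof.
  intros H. apply Clim_pair; simpl; auto. apply is_lim_seq_const.
Qed.

Lemma words_admissible (k n : nat) (ks : list nat) :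
  In ks (words (seq 1 k) n) -> (1 < hd 0 ks)%nat -> admissible ks.
Proof.
  intros H H1. apply In_words in H as [_ H]. split; auto.
  revert H; apply Forall_impl. intros j Hj; apply in_seq in Hj; lia.
Qed.

Lemma Clim_weighted_sum (u v t : C) (k : nat) :
  Clim (fun N => weighted_sum (fun ks => zeta_star_trunc ks N) u v t k)
    (weighted_sum zeta_star u v t k).
Proof.
  unfold weighted_sum.
  apply (Clim_Csum (fun N n => lsum (fun ks => if (weight ks =? k)%nat
     then zeta_star_trunc ks N * admissible_word u v t ks else 0) (words (seq 1 k) n))).
  intros n _. apply Clim_lsum. intros ks Hks.
  destruct (weight ks =? k)%nat; [|apply Clim_const].
  destruct (Nat.le_gt_cases (hd 0%nat ks) 1) as [H|H].
  - rewrite admissible_word_0 by auto.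
    apply (Clim_ext (fun _ => 0)); [intros; ring|].
    eapply Clim_eq; [apply Clim_const | ring].
  - apply Clim_mult; [|apply Clim_const]. apply Clim_RtoC, is_lim_zeta_star.
    now apply words_admissible in Hks.
Qed.

Definition weight_bound (k : nat) : R := Re (weighted_sum zeta_star r0 r0 r0 k).

Lemma sum_bound_le (N k : nat) : (sum_bound N k <= weight_bound k)%R.
Proof.
  unfold sum_bound, weight_bound, weighted_sum. rewrite !Re_Csum.
  apply Rsum_le; intros n _. apply Re_lsum_le; intros ks Hks.
  destruct (weight ks =? k)%nat; [|lra].
  destruct (Nat.le_gt_cases (hd 0%nat ks) 1) as [H|H].
  - rewrite admissible_word_0 by auto. rewrite !Cmult_0_r. lra.
  - destruct (admissible_word_r0 ks) as (x & Hx & ->).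
    rewrite !re_scal_l. simpl (Re x). apply Rmult_le_compat_r; auto.
    apply is_lim_seq_incr_compare; [|apply zeta_star_trunc_incr].
    apply is_lim_zeta_star. now apply words_admissible in Hks.
Qed.

Lemma weight_bound_nonneg (k : nat) : (0 <= weight_bound k)%R.
Proof. eapply Rle_trans; [apply (sum_bound_nonneg 0) | apply sum_bound_le]. Qed.

Lemma ex_series_weight_bound : ex_series weight_bound.
Proof.
  apply ex_series_Rsum_bound with total_bound; [apply weight_bound_nonneg|].
  intros n. unfold weight_bound. rewrite <- Re_Csum.
  assert (L := Clim_Re _ _ (Clim_Csum (fun N k => weighted_sum (fun ks => zeta_star_trunc ks N) r0 r0 r0 k)
    _ n (fun k _ => Clim_weighted_sum r0 r0 r0 k))).
  apply (is_lim_seq_le _ (fun _ => total_bound) _ total_bound) with (2 := L).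
  - intros N. rewrite Re_Csum. apply (Rsum_sum_bound N n).
  - apply is_lim_seq_const.
Qed.

Lemma weighted_sum_trunc_le (u v t : C) (N k : nat) :
  (Cmod u <= r0)%R -> (Cmod v <= r0)%R -> (Cmod t <= r0)%R ->
  (Cmod (weighted_sum (fun ks => zeta_star_trunc ks N) u v t k) <= sum_bound N k)%R.
Proof.
  intros Hu Hv Ht. rewrite weighted_sum_trunc, sum_bound_eq.
  apply Cmod_Csum; intros p _. apply Cmod_Csum; intros i _.
  rewrite Cmod_mult. apply Rmult_le_compat; auto using Cmod_ge_0, first_coef_le, all_words_le.
Qed.

Lemma CSeries_unique (f : nat -> C) (L : C) : Clim (Csum f) L -> CSeries f = L.
Proof.
  intros H. apply Clim_incr_1 in H.
  assert (E : forall n, Re (Csum f (S n)) = sum_n (fun k => Re (f k)) n).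
  { intros n. rewrite Re_Csum. apply Rsum_sum_n. }
  assert (E' : forall n, Im (Csum f (S n)) = sum_n (fun k => Im (f k)) n).
  { intros n. rewrite <- Rsum_sum_n. induction (S n) as [|m IH]; [reflexivity|].
    cbn [Rsum]. rewrite <- IH. reflexivity. }
  unfold CSeries, Series.
  rewrite (is_lim_seq_unique _ (Re L)), (is_lim_seq_unique _ (Im L)).
  - now destruct L.
  - apply is_lim_seq_ext with (1 := E'), Clim_Im, H.
  - apply is_lim_seq_ext with (1 := E), Clim_Re, H.
Qed.

Lemma CSeries_ext (f g : nat -> C) : (forall n, f n = g n) -> CSeries f = CSeries g.
Proof.
  intros H. unfold CSeries. f_equal; apply Series_ext; intros n; now rewrite H.
Qed.

(** For a fixed truncation N the sum over all weights is the finite sum over p; [weight_bound],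
    which is independent of N, allows the limit in N to be taken inside the sum over weights. *)
Lemma Phi0star_limit (u v t a b : C) :
  (Cmod u <= r0)%R -> (Cmod v <= r0)%R -> (Cmod t <= r0)%R ->
  (Cmod a <= / 2)%R -> (Cmod b <= / 2)%R ->
  a + b = u + v -> a * b = u * v - t ^ 2 ->
  Clim (Csum (fun p => / (INR (S p) * (INR (S p) - u)) * words_limit u a b (S p)))
    (Phi0star u v t).
Proof.
  intros Hu Hv Ht Ha Hb Es Ep.
  destruct (tannery (fun N k => weighted_sum (fun ks => zeta_star_trunc ks N) u v t k)
    (weighted_sum zeta_star u v t) weight_bound
    (Csum (fun p => / (INR (S p) * (INR (S p) - u)) * words_limit u a b (S p))))
    as (L & HL1 & HL2).
  - apply ex_series_weight_bound.
  - intros N k. eapply Rle_trans; [now apply weighted_sum_trunc_le | apply sum_bound_le].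
  - intros k. apply Clim_weighted_sum.
  - intros N. now apply Clim_weighted_sum_trunc.
  - replace (Phi0star u v t) with L; [exact HL2|]. symmetry. unfold Phi0star.
    rewrite (CSeries_ext _ (weighted_sum zeta_star u v t)).
    + now apply CSeries_unique.
    + intros k. apply (sum_height_term zeta_star).
Qed.

Lemma X0star_nonneg (k n s : nat) : (0 <= X0star k n s)%R.
Proof.
  unfold X0star. assert (H : forall ks, In ks (indices k n s) -> (0 <= zeta_star ks)%R).
  { intros ks Hks. apply In_indices in Hks as (Ha & _). now apply zeta_star_nonneg. }
  induction (indices k n s) as [|ks l IH]; simpl; [lra|].
  apply Rplus_le_le_0_compat; [apply H; left; auto | apply IH; intros; apply H; right; auto].
Qed.

Lemma Cmod_Phi0star_term (u v t : C) (k n s : nat) :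
  (Cmod u <= r0)%R -> (Cmod v <= r0)%R -> (Cmod t <= r0)%R ->
  (Cmod (Phi0star_term u v t k n s) <= Re (Phi0star_term r0 r0 r0 k n s))%R.
Proof.
  intros Hu Hv Ht. unfold Phi0star_term.
  destruct ((n + s <=? k) && (s <=? n) && (1 <=? s))%nat.
  - rewrite <- !RtoC_pow, <- !RtoC_mult, re_RtoC, !Cmod_mult, Cmod_R.
    pose proof (X0star_nonneg k n s) as HX. rewrite Rabs_pos_eq by auto.
    repeat apply Rmult_le_compat; repeat apply Rmult_le_pos;
      auto using Cmod_ge_0, Cmod_pow_le, Rle_refl.
  - rewrite Cmod_0. simpl. lra.
Qed.

Lemma Phi0star_summable_small (u v t : C) :
  (Cmod u <= r0)%R -> (Cmod v <= r0)%R -> (Cmod t <= r0)%R -> Phi0star_summable u v t.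
Proof.
  intros Hu Hv Ht. unfold Phi0star_summable.
  apply (ex_series_le (V := R_CompleteNormedModule) _ weight_bound);
    [|apply ex_series_weight_bound].
  intros k. unfold norm; simpl. unfold abs; simpl.
  assert (E : weight_bound k = Rsum (fun n => Rsum (fun s => Re (Phi0star_term r0 r0 r0 k n s)) (S k)) (S k)).
  { unfold weight_bound. rewrite <- (sum_height_term zeta_star), <- Csum_sum_n, Re_Csum.
    apply Rsum_ext; intros n _. rewrite <- Csum_sum_n, Re_Csum. reflexivity. }
  rewrite E, <- Rsum_sum_n, Rabs_pos_eq.
  - apply Rsum_le; intros n _. rewrite <- Rsum_sum_n. apply Rsum_le; intros s _.
    now apply Cmod_Phi0star_term.
  - apply Rsum_ge_0; intros n _. rewrite <- Rsum_sum_n. apply Rsum_ge_0; intros s _.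
    apply Cmod_ge_0.
Qed.

(** * The identity near the origin *)

Lemma Csin_PI_nz (u : C) : Csin (PI * u) <> 0 -> u <> 0.
Proof.
  intros H E. apply H. rewrite E, Csin_PI. simpl.
  rewrite !Rmult_0_r, sin_0. unfold sh. rewrite Ropp_0. unfold RtoC. f_equal; field.
Qed.

(** The root satisfies a^2 = c a - d, and for |a| > 1/2 the right-hand side is too small. *)
Lemma root_small (a b c d : C) : a + b = c -> a * b = d ->
  (Cmod c <= / 16)%R -> (Cmod d <= / 16)%R -> (Cmod a <= / 2)%R.
Proof.
  intros Es Ep Hc Hd. apply Rnot_lt_le; intros H.
  assert (E : (Cmod a * Cmod a <= Cmod c * Cmod a + Cmod d)%R).
  { rewrite <- !Cmod_mult. replace (a * a) with (c * a + - d) by (rewrite <- Es, <- Ep; ring).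
    rewrite <- (Cmod_opp d). apply Cmod_triangle. }
  assert (Cmod c * Cmod a <= / 16 * Cmod a)%R by (apply Rmult_le_compat_r; lra).
  nra.
Qed.

(** The factor u is absorbed by u (1 + u)_m / (m + u) = (u)_m, with m = p + 1; this is where the
    combination in the identity comes from. *)
Lemma one_sided_limit_Phi0star (u v t a b : C) :
  (Cmod u <= r0)%R -> (Cmod v <= r0)%R -> (Cmod t <= r0)%R ->
  (Cmod a <= / 2)%R -> (Cmod b <= / 2)%R ->
  a + b = - u + v -> a * b = - (u * v) - t ^ 2 ->
  Clim (Csum (one_sided_term u a b)) (u * Phi0star (- u) v t).
Proof.
  intros Hu Hv Ht Ha Hb Es Ep.
  apply (Clim_ext (fun N => u * Csum (fun p =>
    / (INR (S p) * (INR (S p) - - u)) * words_limit (- u) a b (S p)) N)).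
  - intros N. rewrite <- Csum_scal. apply Csum_ext; intros p _.
    unfold one_sided_term, words_limit.
    replace (1 - - u) with (u + 1) by ring.
    assert (E : u * Crising (u + 1) (S p) = Crising u (S p) * (u + INR (S p)))
      by (rewrite <- Crising_head; reflexivity).
    assert (N1 : INR (S p) - - u <> 0) by (apply small_denominator; now rewrite Cmod_opp).
    assert (N0 := INR_C_nz p).
    assert (Da := Crising_small_nz a (S p) Ha). assert (Db := Crising_small_nz b (S p) Hb).
    transitivity (/ (INR (S p) * (INR (S p) - - u)) * Cfact (S p) * (u * Crising (u + 1) (S p))
      / (Crising (1 - a) (S p) * Crising (1 - b) (S p))); [field; auto|].
    rewrite E, Cfact_S, <- INR_C_S. field. repeat split; auto.
  - apply Clim_scal, Phi0star_limit; rewrite ?Cmod_opp; auto.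
    rewrite Ep. ring.
Qed.

Theorem theorem2p2 :
  exists r : R, (0 < r)%R /\
  forall u v t : C,
    (Cmod u < r)%R -> (Cmod v < r)%R -> (Cmod t < r)%R ->
    Phi0star_summable (- u) v t /\
    Phi0star_summable (- v) u t /\
    forall a b : C,
      a + b = - u + v ->
      a * b = - (u * v) - t ^ 2 ->
      a * b <> 0 ->
      Csin (PI * u) <> 0 ->
      Csin (PI * v) <> 0 ->
      gamma_defined a -> gamma_defined (1 - a) ->
      gamma_defined b -> gamma_defined (1 - b) ->
      gamma_defined (u + a) -> gamma_defined (u + b) ->
      gamma_defined u -> gamma_defined v ->
      u * Phi0star (- u) v t - v * Phi0star (- v) u t =
      (u - v) / (a * b)
      + A_factor u v a b
        * (Cgamma a * Cgamma (1 - a) * Cgamma b * Cgamma (1 - b)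
           * Cgamma (u + a) * Cgamma (u + b))
        / (Cgamma u * Cgamma v).
Proof.
  exists r0. split; [r0lra|].
  intros u v t Hu Hv Ht.
  assert (Hu' : (Cmod u <= r0)%R) by lra. assert (Hv' : (Cmod v <= r0)%R) by lra.
  assert (Ht' : (Cmod t <= r0)%R) by lra.
  split; [|split].
  1, 2: apply Phi0star_summable_small; rewrite ?Cmod_opp; auto.
  intros a b Es Ep Hab Su Sv Ga Ga' Gb Gb' Gua Gub Gu Gv.
  assert (Na : a <> 0) by (intros E; apply Hab; rewrite E; ring).
  assert (Nb : b <> 0) by (intros E; apply Hab; rewrite E; ring).
  (* For u = v the left-hand side, the rational term and [A_factor] all vanish. *)
  destruct (Ceq_dec (v - u) 0) as [E0 | Ns].
  - assert (E : v = u) by (now apply Ceq_minus). subst v.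
    unfold A_factor, Cdiv. ring.
  - set (s := v - u) in *.
    assert (Hs : (Cmod s <= / 16)%R).
    { eapply Rle_trans; [apply Cmod_triangle|]. rewrite Cmod_opp. r0lra. }
    assert (Es' : a + b = s) by (rewrite Es; unfold s; ring).
    (* The product of the roots is bounded by 2 r0^2 and their sum by 2 r0 = 1/16, as [root_small]
       requires. *)
    assert (Hp : (Cmod (- (u * v) - t ^ 2) <= / 16)%R).
    { eapply Rle_trans; [apply Cmod_triangle|].
      rewrite !Cmod_opp, Cmod_mult, Cmod_pow.
      pose proof (Cmod_ge_0 u). pose proof (Cmod_ge_0 v). pose proof (Cmod_ge_0 t).
      unfold r0 in *. nra. }
    assert (Ma : (Cmod a <= / 2)%R) by (exact (root_small a b _ _ Es' Ep Hs Hp)).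
    assert (Mb : (Cmod b <= / 2)%R).
    { refine (root_small b a _ _ _ _ Hs Hp); rewrite ?(Cplus_comm b), ?(Cmult_comm b); auto. }
    assert (Iu : noint u) by (apply noint_small; [now apply Csin_PI_nz | r0lra]).
    assert (Iv : noint v) by (apply noint_small; [now apply Csin_PI_nz | r0lra]).
    assert (Is : noint s) by (apply noint_small; [auto | lra]).
    assert (Ev : v = u + s) by (unfold s; ring).
    destruct (bprod_limit u v s a b) as (F & G & HF & HG & HB); auto.
    { repeat split; auto. }
    assert (EF := Clim_unique _ _ _ HF
      (one_sided_limit_Phi0star u v t a b Hu' Hv' Ht' Ma Mb Es Ep)).
    assert (EG := Clim_unique _ _ _ HG
      (one_sided_limit_Phi0star v u t (- a) (- b) Hv' Hu' Ht'
        ltac:(now rewrite Cmod_opp) ltac:(now rewrite Cmod_opp)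
        ltac:(replace (- a + - b) with (- (a + b)) by ring; rewrite Es; ring)
        ltac:(replace (- a * - b) with (a * b) by ring; rewrite Ep; ring))).
    rewrite <- EF, <- EG.
    (* The closed form equals the limit s / (a b) + F - G of [bprod], and s / (a b) cancels against
       (u - v) / (a b). *)
    rewrite <- (bprod_closed_form u v s a b _ Ev Es' Iu Iv Na Nb Ma Mb
                  Su Sv Ga Ga' Gb Gb' Gua Gub Gu Gv HB).
    unfold s. field. auto.
Qed.
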